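(* Let $k$ be a real number, let $\Gamma$ be a finite index subgroup of $\mathrm{SL}_2(\mathbb{Z})$, and let $f$ be a non-zero modular function of weight $k$ for $\Gamma$ (with respect to some automorphy factors). If $f$ is not holomorphic on the upper half plane $\mathfrak{H}$, then $f$ is not lacunary.
   Context: Expansions. For $r\in\mathbb{R}$ let $\mathfrak{H}_r=\{z\in\mathbb{C} : \mathrm{Im}(z)>r\}$, and let $\mathfrak{H}=\mathfrak{H}_0$. Let $g$ be holomorphic on some $\mathfrak{H}_r$ and suppose there are a real $h>0$ and $u\in\mathbb{C}$ with $|u|=1$ and $g(z+h)=u\,g(z)$ for all $z\in\mathfrak{H}_r$. Then $g$ has a unique expansion $g(z)=\sum_{\lambda\in\Lambda}a(\lambda)e^{2\pi i\lambda z}$, where $\Lambda=\{\lambda\in\mathbb{R} : e^{2\pi i\lambda h}=u\}$, called the expansion of $g$ at $\infty$. We say $g$ has finite order at $\infty$ if $\{\lambda<0 : a(\lambda)\neq0\}$ is finite. If $g$ has finite order at $\infty$, its expansion at $\infty$ is lacunary if $\#\{\lambda\le x : a(\lambda)\ne0\}=o(x)$ when $x\to+\infty$. These notions do not depend on the choice of $h$ and $u$. Modular functions. For $z\in\mathbb{C}^*$, $z^k=e^{k\log z}$ with the imaginary part of $\log z$ in $]-\pi,\pi]$. A meromorphic function $f$ on $\mathfrak{H}$ is a modular function of weight $k$ for $\Gamma$ if: (a) for each $\gamma=\begin{pmatrix}a&b\\c&d\end{pmatrix}\in\Gamma$, $f(\gamma z)=j(\gamma,z)f(z)$, where $\gamma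 z=\frac{az+b}{cz+d}$ and $j(\gamma,\cdot)$ (the automorphy factor) is a holomorphic function on $\mathfrak{H}$ with $|j(\gamma,z)|=|cz+d|^k$; (b) for any $\begin{pmatrix}a&b\\c&d\end{pmatrix}\in\mathrm{SL}_2(\mathbb{Z})$, the function $z\mapsto(cz+d)^{-k}f\left(\frac{az+b}{cz+d}\right)$ is holomorphic on some half plane $\mathfrak{H}_r$ (hence, by (a), it satisfies the conditions on $g$ above) and it has finite order at $\infty$. A modular function is said to be lacunary if its expansion at $\infty$ is lacunary. *)

(* Defs.v *)
From Stdlib Require Export Reals ZArith List.
From Stdlib Require Import Lia.
From Coquelicot Require Export Coquelicot.

Set Implicit Arguments.
Unset Strict Implicit.
Unset Printing Implicit Defensive.

Open Scope R_scope.

Definition Cexp (z : C) : C :=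
  (exp (Re z) * cos (Im z), exp (Re z) * sin (Im z)).

(* Principal argument, with values in ]-PI, PI] (junk at 0). *)
Definition Carg (z : C) : R :=
  if Rle_dec 0 (Im z) then acos (Re z / Cmod z) else - acos (Re z / Cmod z).

Definition Clog (z : C) : C := (ln (Cmod z), Carg z).

Definition Crpow (z : C) (k : R) : C := Cexp (RtoC k * Clog z)%C.

Definition half_plane (r : R) (z : C) : Prop := r < Im z.

(* The Riemann sphere, [None] being the point at infinity.  A meromorphic
   function is a sphere-valued function that takes the value infinity exactly
   at its poles, so no value at a pole or at a removable singularity is left
   arbitrary. *)
Definition sphere : Type := option C.

(* Only used with a nonzero scalar, for which c * infinity = infinity. *)
Definition smul (c : C) (w : sphere) : sphere := option_map (Cmult c) w.

Definition complex_differentiable (g : C -> C) (z : C) : Prop :=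
  @ex_derive C_AbsRing C_NormedModule g z.

Definition regular_at (f : C -> sphere) (z0 : C) : Prop :=
  exists g : C -> C,
    locally z0 (fun z => f z = Some (g z) /\ complex_differentiable g z).

Definition pole_at (f : C -> sphere) (z0 : C) : Prop :=
  f z0 = None /\
  exists (g : C -> C) (m : nat),
    (0 < m)%nat /\
    g z0 <> RtoC 0 /\
    locally z0 (complex_differentiable g) /\
    locally' z0 (fun z => f z = Some (g z / (z - z0) ^ m)%C).

Definition holomorphic_on (U : C -> Prop) (f : C -> sphere) : Prop :=
  forall z, U z -> regular_at f z.

Definition meromorphic_on (U : C -> Prop) (f : C -> sphere) : Prop :=
  forall z, U z -> regular_at f z \/ pole_at f z.

(* Unconditional summation: [s] is the limit of the finite sums of [t] along
   the finite subsets of [A] ordered by inclusion. *)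
Definition is_sum_over (A : R -> Prop) (t : R -> C) (s : C) : Prop :=
  forall eps : posreal, exists l0 : list R,
    List.Forall A l0 /\
    forall l : list R, NoDup l -> List.Forall A l -> incl l0 l ->
      Cmod (fold_right Cplus (RtoC 0) (map t l) - s)%C < eps.

Definition e2pi (lambda : R) (z : C) : C :=
  Cexp (RtoC (2 * PI * lambda) * Ci * z)%C.

Definition frequencies (h : R) (u : C) (lambda : R) : Prop :=
  e2pi lambda (RtoC h) = u.

(* [a] is the coefficient function of the expansion of [g], extended by 0 to
   all real numbers. *)
Definition is_expansion (g : C -> sphere) (a : R -> C) : Prop :=
  exists (r h : R) (u : C),
    0 < h /\
    Cmod u = 1 /\
    holomorphic_on (half_plane r) g /\
    (forall z, half_plane r z -> g (z + RtoC h)%C = smul u (g z)) /\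
    (forall lambda, a lambda <> RtoC 0 -> frequencies h u lambda) /\
    (forall z, half_plane r z ->
       exists w : C, g z = Some w /\
         is_sum_over (frequencies h u) (fun lambda => a lambda * e2pi lambda z)%C w).

Definition has_card (A : R -> Prop) (n : nat) : Prop :=
  exists l : list R, NoDup l /\ length l = n /\ forall x, In x l <-> A x.

Definition finite_order_expansion (a : R -> C) : Prop :=
  exists n, has_card (fun lambda => lambda < 0 /\ a lambda <> RtoC 0) n.

Definition finite_order_at_infty (g : C -> sphere) : Prop :=
  exists a, is_expansion g a /\ finite_order_expansion a.

Definition lacunary_expansion (a : R -> C) : Prop :=
  finite_order_expansion a /\
  exists N : R -> nat,
    (forall x, has_card (fun lambda => lambda <= x /\ a lambda <> RtoC 0) (N x)) /\
    is_lim (fun x => INR (N x) / x) p_infty 0.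

Definition lacunary (g : C -> sphere) : Prop :=
  exists a, is_expansion g a /\ lacunary_expansion a.

Record SL2Z : Type := mkSL2Z {
  ma : Z; mb : Z; mc : Z; md : Z;
  sl2_det : (ma * md - mb * mc = 1)%Z
}.

Lemma sl2_one_det : (1 * 1 - 0 * 0 = 1)%Z.
Proof. reflexivity. Qed.

Lemma sl2_mul_det (g h : SL2Z) :
  ((ma g * ma h + mb g * mc h) * (mc g * mb h + md g * md h)
   - (ma g * mb h + mb g * md h) * (mc g * ma h + md g * mc h) = 1)%Z.
Proof.
pose proof (sl2_det g) as Hg; pose proof (sl2_det h) as Hh.
replace 1%Z with ((ma g * md g - mb g * mc g) * (ma h * md h - mb h * mc h))%Z
  by (rewrite Hg, Hh; reflexivity).
ring.
Qed.

Lemma sl2_inv_det (g : SL2Z) : (md g * ma g - (- mb g) * (- mc g) = 1)%Z.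
Proof. pose proof (sl2_det g); lia. Qed.

Definition sl2_one : SL2Z := mkSL2Z sl2_one_det.
Definition sl2_mul (g h : SL2Z) : SL2Z := mkSL2Z (sl2_mul_det g h).
Definition sl2_inv (g : SL2Z) : SL2Z := mkSL2Z (sl2_inv_det g).

Definition is_subgroup (G : SL2Z -> Prop) : Prop :=
  G sl2_one /\
  (forall g h, G g -> G h -> G (sl2_mul g h)) /\
  (forall g, G g -> G (sl2_inv g)).

(* Finitely many left cosets of [G] cover SL_2(Z). *)
Definition finite_index (G : SL2Z -> Prop) : Prop :=
  exists l : list SL2Z,
    forall g, exists s, In s l /\ G (sl2_mul (sl2_inv s) g).

Definition denom (g : SL2Z) (z : C) : C :=
  (RtoC (IZR (mc g)) * z + RtoC (IZR (md g)))%C.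

Definition moebius (g : SL2Z) (z : C) : C :=
  ((RtoC (IZR (ma g)) * z + RtoC (IZR (mb g))) / denom g z)%C.

Definition automorphy_factor (k : R) (g : SL2Z) (j : C -> C) : Prop :=
  holomorphic_on (half_plane 0) (fun z => Some (j z)) /\
  forall z, half_plane 0 z -> Cmod (j z) = Rpower (Cmod (denom g z)) k.

Definition slash (k : R) (g : SL2Z) (f : C -> sphere) (z : C) : sphere :=
  smul (Crpow (denom g z) (- k)) (f (moebius g z)).

(* The values of [f] outside the upper half plane are irrelevant. *)
Definition modular_function (k : R) (G : SL2Z -> Prop) (f : C -> sphere) : Prop :=
  meromorphic_on (half_plane 0) f /\
  (exists j : SL2Z -> C -> C,
     forall g, G g ->
       automorphy_factor k g (j g) /\
       forall z, half_plane 0 z -> f (moebius g z) = smul (j g z) (f z)) /\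
  (forall g : SL2Z,
     (exists r : R, holomorphic_on (half_plane r) (slash k g f)) /\
     finite_order_at_infty (slash k g f)).

(* Main.v *)
Require Import Defs.
From Stdlib Require Import Lra Lia Psatz Classical ClassicalEpsilon FinFun Eqdep_dec.

(** Let [y0] be the largest imaginary part of a pole of [f], [m] the maximal order
    of the poles on the line [Im z = y0], and [p] a pole of order [m] on it.  Some
    translation [z + T] lies in [Gamma], so, up to a factor [e2pi l0 z], [f] is a
    power series in [q = e2pi (/ T) z] whose coefficients [c_n] are those of its
    expansion.  On the line [Im z = y0 + t] the mean square of [f] is
    [O(t^(1-2m))], while [f (p + 2it)] is at least a constant times [t^(-m)].  By
    Cauchy's formula and Cauchy-Schwarz the square of the latter is at most the
    former times the sum of [exp (-4 pi n t / T)] over the [n] with [c_n <> 0]; this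
    sum is [o(1/t)] when these [n] have density zero, a contradiction. *)

(** The comparison is sharp up to a constant. If every [n] were allowed, the sum of
    [exp (-4 pi n t / T)] would have order [1/t] and the upper bound order [t^(-2m)], exactly that
    of the squared lower bound. Only a factor [o(1)] separates the two, so density zero is used in
    full, and the mean square must gain a factor [t] over the trivial bound [t^(-2m)]; this factor
    is the integral of a Poisson kernel. The expansion is given on a half plane that may lie well
    above the poles, with a period [h] and a multiplier that need not be those provided by [Gamma].
    One implication is carried down to the line [y0 + t]: where the coefficient of the expansion
    vanishes, so does the Fourier coefficient for the period [T]. It comes from averages over long
    segments and from contour shifts. Cauchy's formula is used with the periodic kernel
    [1 / (1 - e2pi (/ T) (w - z))], truncated to a finite geometric sum with an explicit remainder,
    so no infinite series is integrated. Cauchy-Schwarz takes the form [2 p q <= g p^2 + q^2 / g]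
    with a free weight [g]. *)

(** * Discs, continuity and complex differentiability *)

Definition near (z : C) (P : C -> Prop) : Prop :=
  exists d, 0 < d /\ forall w, Cmod (w - z)%C < d -> P w.

Lemma near_and z P Q : near z P -> near z Q -> near z (fun w => P w /\ Q w).
Proof.
  intros [d [Hd HP]] [e [He HQ]]; exists (Rmin d e); split.
  - now apply Rmin_pos.
  - intros w Hw; split; [apply HP | apply HQ]; eapply Rlt_le_trans; eauto;
      [apply Rmin_l | apply Rmin_r].
Qed.

Lemma near_imp z (P Q : C -> Prop) : (forall w, P w -> Q w) -> near z P -> near z Q.
Proof. intros H [d [Hd HP]]; exists d; auto. Qed.

Lemma Cmod_sub_self z : Cmod (z - z)%C = 0.
Proof. replace (z - z)%C with (RtoC 0) by ring. apply Cmod_0. Qed.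

Lemma Cmod_sub_sym z w : Cmod (z - w)%C = Cmod (w - z)%C.
Proof. rewrite <- Cmod_opp. f_equal. ring. Qed.

Lemma Cmod_sub_tri (x y z : C) : Cmod (x - z)%C <= Cmod (x - y)%C + Cmod (y - z)%C.
Proof. replace (x - z)%C with ((x - y) + (y - z))%C by ring. apply Cmod_triangle. Qed.

Lemma near_self z P : near z P -> P z.
Proof. intros [d [Hd HP]]; apply HP. now rewrite Cmod_sub_self. Qed.

Lemma near_half_plane r z : r < Im z -> near z (fun w => r < Im w).
Proof.
  intros H; exists (Im z - r); split; [lra|]; intros w Hw.
  pose proof (Rmax_Cmod (w - z)%C).
  pose proof (Rmax_r (Rabs (fst (w - z)%C)) (Rabs (snd (w - z)%C))).
  unfold Cminus, Cplus, Copp in *; simpl in *.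
  assert (Rabs (snd w + - snd z) < Im z - r) by lra.
  apply Rabs_def2 in H2. unfold Im in *. lra.
Qed.

(** The uniform structure of [C] is that of a product, with squares as balls, whereas [near] uses
    discs. The square of half-width [d / 2] lies in the disc of radius [d] because [sqrt 2 < 2]. *)
Lemma locally_near (z : C) (P : C -> Prop) : locally z P <-> near z P.
Proof.
  split.
  - intros [d Hd]; exists d; split; [apply cond_pos|].
    intros w Hw; apply Hd. apply C_NormedModule_mixin_compat1. exact Hw.
  - intros [d [Hd H]].
    exists (mkposreal (d / 2) ltac:(lra)); intros w Hw; apply H.
    pose proof (C_NormedModule_mixin_compat2 z w _ Hw) as H1. simpl in H1.
    assert (sqrt 2 < 2). { rewrite <- (sqrt_Rsqr 2) at 2 by lra. apply sqrt_lt_1; unfold Rsqr; lra. }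
    eapply Rlt_le_trans; [exact H1|]. nra.
Qed.

Definition ccont (g : C -> C) (z : C) : Prop :=
  forall e, 0 < e -> near z (fun w => Cmod (g w - g z)%C < e).

Lemma ccont_const c z : ccont (fun _ => c) z.
Proof. intros e He; exists 1; split; [lra|]; intros; now rewrite Cmod_sub_self. Qed.

Lemma ccont_id z : ccont (fun w => w) z.
Proof. intros e He; exists e; split; auto. Qed.

Lemma ccont_plus g h z : ccont g z -> ccont h z -> ccont (fun w => g w + h w)%C z.
Proof.
  intros Hg Hh e He.
  generalize (near_and _ _ _ (Hg (e / 2) ltac:(lra)) (Hh (e / 2) ltac:(lra))).
  apply near_imp; intros w [H1 H2].
  replace (g w + h w - (g z + h z))%C with ((g w - g z) + (h w - h z))%C by ring.
  eapply Rle_lt_trans; [apply Cmod_triangle|lra].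
Qed.

Lemma ccont_mult g h z : ccont g z -> ccont h z -> ccont (fun w => g w * h w)%C z.
Proof.
  intros Hg Hh e He.
  pose proof (Cmod_ge_0 (g z)) as P1. pose proof (Cmod_ge_0 (h z)) as P2.
  set (A := Cmod (g z) + Cmod (h z) + 1).
  assert (HA : 0 < A) by (unfold A; lra).
  set (d := Rmin 1 (e / (2 * A))).
  assert (Hd : 0 < d) by (apply Rmin_pos; [lra | apply Rdiv_lt_0_compat; lra]).
  assert (Hd1 : d <= 1) by apply Rmin_l.
  assert (Hd2 : d * (2 * A) <= e).
  { apply Rle_trans with (e / (2 * A) * (2 * A)).
    - apply Rmult_le_compat_r; [lra|apply Rmin_r].
    - right; field; lra. }
  generalize (near_and _ _ _ (Hg d Hd) (Hh d Hd)).
  apply near_imp; intros w [H1 H2].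
  replace (g w * h w - g z * h z)%C
    with ((g w - g z) * (h w - h z) + (g z * (h w - h z) + (g w - g z) * h z))%C by ring.
  eapply Rle_lt_trans; [apply Cmod_triangle|].
  pose proof (Cmod_triangle (g z * (h w - h z)) ((g w - g z) * h z))%C.
  rewrite !Cmod_mult in *.
  pose proof (Cmod_ge_0 (g w - g z)%C). pose proof (Cmod_ge_0 (h w - h z)%C).
  unfold A in *. nra.
Qed.

Lemma ccont_opp g z : ccont g z -> ccont (fun w => - g w)%C z.
Proof.
  intros Hg e He. generalize (Hg e He). apply near_imp; intros w H.
  replace (- g w - - g z)%C with (- (g w - g z))%C by ring. now rewrite Cmod_opp.
Qed.

Lemma ccont_minus g h z : ccont g z -> ccont h z -> ccont (fun w => g w - h w)%C z.
Proof. intros; apply ccont_plus; [|apply ccont_opp]; auto. Qed.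

Lemma ccont_ext g h z : near z (fun w => g w = h w) -> ccont g z -> ccont h z.
Proof.
  intros Hn Hg e He. rewrite <- (near_self _ _ Hn).
  generalize (near_and _ _ _ Hn (Hg e He)).
  apply near_imp; intros w [H1 H2]. now rewrite <- H1.
Qed.

Lemma ccont_lower g z : ccont g z -> g z <> RtoC 0 ->
  near z (fun w => Cmod (g z) / 2 < Cmod (g w)).
Proof.
  intros Hg Hz. apply Cmod_gt_0 in Hz.
  generalize (Hg (Cmod (g z) / 2) ltac:(lra)); apply near_imp; intros w Hw.
  pose proof (Cmod_triangle (g w) (g z - g w)%C).
  rewrite Cmod_sub_sym in Hw. replace (g w + (g z - g w))%C with (g z) in H by ring. lra.
Qed.

Lemma ccont_upper g z : ccont g z -> near z (fun w => Cmod (g w) < Cmod (g z) + 1).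
Proof.
  intros Hg.
  generalize (Hg 1 ltac:(lra)); apply near_imp; intros w Hw.
  pose proof (Cmod_triangle (g z) (g w - g z)%C).
  replace (g z + (g w - g z))%C with (g w) in H by ring. lra.
Qed.

Lemma ccont_inv g z : ccont g z -> g z <> RtoC 0 -> ccont (fun w => / g w)%C z.
Proof.
  intros Hg Hz e He. pose proof (ccont_lower _ _ Hg Hz) as Hl.
  pose proof (proj1 (Cmod_gt_0 _) Hz) as P.
  set (A := Cmod (g z)) in *.
  assert (0 < e * A * A / 2) by (apply Rdiv_lt_0_compat; [|lra]; repeat apply Rmult_lt_0_compat; lra).
  generalize (near_and _ _ _ Hl (Hg _ H)); apply near_imp; intros w [H1 H2].
  assert (Hw : g w <> RtoC 0) by (intros E; rewrite E, Cmod_0 in H1; lra).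
  replace (/ g w - / g z)%C with (- (g w - g z) * (/ g w * / g z))%C by (field; auto).
  rewrite !Cmod_mult, Cmod_opp, !Cmod_inv by auto. fold A.
  set (B := Cmod (g w)) in *.
  apply Rlt_le_trans with (e * A * A / 2 * (/ B * / A)).
  - apply Rmult_lt_compat_r; auto.
    apply Rmult_lt_0_compat; apply Rinv_0_lt_compat; lra.
  - replace (e * A * A / 2 * (/ B * / A)) with (e * ((A / 2) / B)) by (field; lra).
    rewrite <- (Rmult_1_r e) at 2. apply Rmult_le_compat_l; [lra|].
    apply Rmult_le_reg_r with B; [lra|]. unfold Rdiv. rewrite Rmult_assoc, Rinv_l; lra.
Qed.

(* Caratheodory's form of differentiability: the difference quotient extends
   continuously. *)
Definition cderiv (g : C -> C) (z l : C) : Prop :=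
  exists s : C -> C, ccont s z /\ s z = l /\
    near z (fun w => g w = g z + (w - z) * s w)%C.

Definition cdiff (g : C -> C) (z : C) : Prop := exists l, cderiv g z l.

Lemma cderiv_cont g z l : cderiv g z l -> ccont g z.
Proof.
  intros [s [Hs [_ He]]].
  apply ccont_ext with (fun w => g z + (w - z) * s w)%C.
  - revert He; apply near_imp; intros; congruence.
  - apply ccont_plus; [apply ccont_const|apply ccont_mult; auto].
    apply ccont_minus; [apply ccont_id|apply ccont_const].
Qed.

Lemma cdiff_cont g z : cdiff g z -> ccont g z.
Proof. intros [l H]; eapply cderiv_cont; eauto. Qed.

Lemma cderiv_const c z : cderiv (fun _ => c) z 0.
Proof.
  exists (fun _ => RtoC 0); repeat split; [apply ccont_const|].
  exists 1; split; [lra|]; intros; ring.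
Qed.

Lemma cderiv_id z : cderiv (fun w => w) z 1.
Proof.
  exists (fun _ => RtoC 1); repeat split; [apply ccont_const|].
  exists 1; split; [lra|]; intros; ring.
Qed.

Lemma cderiv_plus g h z l m : cderiv g z l -> cderiv h z m ->
  cderiv (fun w => g w + h w)%C z (l + m).
Proof.
  intros [s [Hs [E He]]] [t [Ht [F Hf]]].
  exists (fun w => s w + t w)%C; repeat split; [now apply ccont_plus|congruence|].
  generalize (near_and _ _ _ He Hf); apply near_imp; intros w [-> ->]; ring.
Qed.

Lemma cderiv_mult g h z l m : cderiv g z l -> cderiv h z m ->
  cderiv (fun w => g w * h w)%C z (l * h z + g z * m).
Proof.
  intros Hg Hh. pose proof (cderiv_cont _ _ _ Hg) as Cg.
  destruct Hg as [s [Hs [E He]]]; destruct Hh as [t [Ht [F Hf]]].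
  exists (fun w => s w * h z + g w * t w)%C; repeat split.
  - apply ccont_plus; apply ccont_mult; auto using ccont_const.
  - congruence.
  - generalize (near_and _ _ _ He Hf); apply near_imp; intros w [Eg ->]. rewrite !Eg; ring.
Qed.

Lemma cderiv_inv g z l : cderiv g z l -> g z <> RtoC 0 ->
  cderiv (fun w => / g w)%C z (- l * / (g z * g z)).
Proof.
  intros Hg Hz. pose proof (cderiv_cont _ _ _ Hg) as Cg.
  pose proof (ccont_lower _ _ Cg Hz) as Hl.
  destruct Hg as [s [Hs [E He]]].
  exists (fun w => - s w * / (g w * g z))%C; repeat split.
  - apply ccont_mult; [now apply ccont_opp|]. apply ccont_inv.
    + apply ccont_mult; auto using ccont_const.
    + now apply Cmult_neq_0.
  - congruence.
  - generalize (near_and _ _ _ He Hl); apply near_imp; intros w [Eg L].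
    assert (Hw : g w <> RtoC 0).
    { intros Z; rewrite Z, Cmod_0 in L. pose proof (Cmod_ge_0 (g z)); lra. }
    replace (/ g w)%C with (/ g z + (/ g w - / g z))%C by ring. f_equal.
    transitivity (- (g w - g z) * / (g w * g z))%C; [field; auto|].
    rewrite Eg at 1. ring.
Qed.

Lemma cderiv_ext g h z l : near z (fun w => g w = h w) -> cderiv g z l -> cderiv h z l.
Proof.
  intros Hn [s [Hs [E He]]]; exists s; repeat split; auto.
  rewrite <- (near_self _ _ Hn).
  generalize (near_and _ _ _ Hn He); apply near_imp; intros w [<- H]; auto.
Qed.

Lemma cdiff_ext g h z : near z (fun w => g w = h w) -> cdiff g z -> cdiff h z.
Proof. intros Hn [l Hl]; exists l; eapply cderiv_ext; eauto. Qed.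

Lemma cdiff_mult g h z : cdiff g z -> cdiff h z -> cdiff (fun w => g w * h w)%C z.
Proof. intros [l Hl] [m Hm]; eexists; eapply cderiv_mult; eauto. Qed.

Lemma complex_differentiable_cdiff g z : complex_differentiable g z -> cdiff g z.
Proof.
  intros [l [_ H]].
  specialize (H z (fun P HP => HP)).
  exists l.
  set (s := fun w => if excluded_middle_informative (w = z) then l
                     else ((g w - g z) / (w - z))%C).
  assert (Sz : s z = l) by (unfold s; destruct (excluded_middle_informative (z = z)); tauto).
  exists s; split; [|split]; auto.
  - intros e He. rewrite Sz.
    specialize (H (mkposreal (e / 2) ltac:(lra))).
    apply locally_C, locally_near in H.
    revert H; apply near_imp; intros w Hw.
    unfold s. destruct (excluded_middle_informative (w = z)) as [->|Hwz].
    + now rewrite Cmod_sub_self.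
    + assert (Hn : (w - z)%C <> RtoC 0).
      { intros E; apply Hwz. replace w with ((w - z) + z)%C by ring. rewrite E; ring. }
      change (Cmod ((g w - g z) - (w - z) * l)%C <= e / 2 * Cmod (w - z)%C) in Hw.
      pose proof (proj1 (Cmod_gt_0 _) Hn).
      replace ((g w - g z) / (w - z) - l)%C with (((g w - g z) - (w - z) * l) / (w - z))%C
        by (field; auto).
      rewrite Cmod_div by auto.
      apply Rle_lt_trans with (e / 2); [|lra].
      apply Rmult_le_reg_r with (Cmod (w - z)%C); auto.
      unfold Rdiv at 1. rewrite Rmult_assoc, Rinv_l by lra. lra.
  - exists 1; split; [lra|]; intros w _. unfold s.
    destruct (excluded_middle_informative (w = z)) as [->|Hwz]; [ring|].
    field. intros E; apply Hwz. replace w with ((w - z) + z)%C by ring. rewrite E; ring.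
Qed.

(** * The exponential functions [e2pi] *)

Lemma is_derive_small (f : R -> R) (x l : R) : is_derive f x l ->
  forall e, 0 < e -> exists d, 0 < d /\
    forall y, Rabs (y - x) < d -> Rabs (f y - f x - (y - x) * l) <= e * Rabs (y - x).
Proof.
  intros [_ H] e He. specialize (H x (fun P HP => HP) (mkposreal e He)).
  destruct H as [d Hd]; exists d; split; [apply cond_pos|]. exact Hd.
Qed.

Lemma Cexp_add z w : Cexp (z + w) = (Cexp z * Cexp w)%C.
Proof.
  destruct z as [x y], w as [u v].
  unfold Cexp, Re, Im, Cmult, Cplus; simpl.
  rewrite exp_plus, cos_plus, sin_plus. f_equal; ring.
Qed.

Lemma Cexp_0 : Cexp 0 = RtoC 1.
Proof. unfold Cexp, Re, Im, RtoC; simpl. rewrite exp_0, cos_0, sin_0. f_equal; ring. Qed.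

Lemma Cmod_le_abs (z : C) : Cmod z <= Rabs (Re z) + Rabs (Im z).
Proof.
  replace z with ((RtoC (Re z)) + Ci * RtoC (Im z))%C.
  - eapply Rle_trans; [apply Cmod_triangle|].
    rewrite Cmod_mult, !Cmod_R.
    rewrite Cmod_Ci.
    unfold RtoC, Ci, Re, Im, Cplus, Cmult; simpl.
    repeat rewrite ?Rmult_0_l, ?Rmult_1_l, ?Rmult_0_r, ?Rplus_0_l, ?Rplus_0_r, ?Rminus_0_r. lra.
  - destruct z; unfold RtoC, Ci, Re, Im, Cplus, Cmult; simpl. f_equal; ring.
Qed.

Lemma Rabs_Re_le z : Rabs (Re z) <= Cmod z.
Proof. eapply Rle_trans; [|apply Rmax_Cmod]. apply Rmax_l. Qed.

Lemma Rabs_Im_le z : Rabs (Im z) <= Cmod z.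
Proof. eapply Rle_trans; [|apply Rmax_Cmod]. apply Rmax_r. Qed.

Lemma Cexp_small e : 0 < e ->
  near 0 (fun z => Cmod (Cexp z - 1 - z)%C <= e * Cmod z).
Proof.
  intros He.
  (* The real and imaginary parts of the error produce nine terms, each at most [d * Cmod z]; hence
     the divisor 10. *)
  set (d := Rmin 1 (e / 10)).
  assert (Hd : 0 < d) by (apply Rmin_pos; lra).
  assert (Hd1 : d <= 1) by apply Rmin_l.
  assert (Hd2 : d <= e / 10) by apply Rmin_r.
  assert (D1 : is_derive exp 0 1) by (auto_derive; auto; rewrite exp_0; ring).
  assert (D2 : is_derive cos 0 0) by (auto_derive; auto; rewrite sin_0; ring).
  assert (D3 : is_derive sin 0 1) by (auto_derive; auto; rewrite cos_0; ring).
  destruct (is_derive_small _ _ _ D1 d Hd) as [d1 [P1 H1]].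
  destruct (is_derive_small _ _ _ D2 d Hd) as [d2 [P2 H2]].
  destruct (is_derive_small _ _ _ D3 d Hd) as [d3 [P3 H3]].
  exists (Rmin d (Rmin d1 (Rmin d2 d3))); split; [repeat (apply Rmin_pos; [assumption|]); assumption|].
  intros z Hz.
  replace (z - 0)%C with z in Hz by ring.
  assert (Cmod z < d /\ Cmod z < d1 /\ Cmod z < d2 /\ Cmod z < d3) as [Z0 [Z1 [Z2 Z3]]].
  { repeat split; eapply Rlt_le_trans; try exact Hz.
    - apply Rmin_l.
    - eapply Rle_trans; [apply Rmin_r|]. apply Rmin_l.
    - do 2 (eapply Rle_trans; [apply Rmin_r|]). apply Rmin_l.
    - do 2 (eapply Rle_trans; [apply Rmin_r|]). apply Rmin_r. }
  pose proof (Rabs_Re_le z) as Rx. pose proof (Rabs_Im_le z) as Ry.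
  pose proof (Cmod_ge_0 z) as Rz.
  destruct z as [x y]; simpl in Rx, Ry.
  set (r := Cmod (x, y)) in *.
  specialize (H1 x). specialize (H2 y). specialize (H3 y).
  rewrite Rminus_0_r, exp_0 in H1. rewrite Rminus_0_r, cos_0 in H2. rewrite Rminus_0_r, sin_0 in H3.
  specialize (H1 ltac:(lra)). specialize (H2 ltac:(lra)). specialize (H3 ltac:(lra)).
  eapply Rle_trans; [apply Cmod_le_abs|].
  unfold Cexp, RtoC, Cminus, Cplus, Copp; cbn [Re Im fst snd].
  set (A := exp x - 1 - x * 1) in *. set (B := cos y - 1 - y * 0) in *.
  set (S := sin y - 0 - y * 1) in *.
  replace (exp x) with (A + 1 + x) by (unfold A; ring).
  replace (cos y) with (B + 1) by (unfold B; ring).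
  replace (sin y) with (S + y) by (unfold S; ring).
  pose proof (Rabs_pos A); pose proof (Rabs_pos B); pose proof (Rabs_pos S).
  pose proof (Rabs_pos x); pose proof (Rabs_pos y).
  assert (E1 : Rabs ((A + 1 + x) * (B + 1) + - (1) + - x)
               <= Rabs A * Rabs B + Rabs A + Rabs B + Rabs x * Rabs B).
  { replace ((A + 1 + x) * (B + 1) + - (1) + - x) with (A * B + A + B + x * B) by ring.
    rewrite <- !Rabs_mult.
    eapply Rle_trans; [apply Rabs_triang|].
    pose proof (Rabs_triang (A * B + A) B). pose proof (Rabs_triang (A * B) A). lra. }
  assert (E2 : Rabs ((A + 1 + x) * (S + y) + - 0 + - y)
               <= Rabs A * Rabs S + Rabs A * Rabs y + Rabs S + Rabs x * Rabs S + Rabs x * Rabs y).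
  { replace ((A + 1 + x) * (S + y) + - 0 + - y) with (A * S + A * y + S + x * S + x * y) by ring.
    rewrite <- !Rabs_mult.
    eapply Rle_trans; [apply Rabs_triang|].
    pose proof (Rabs_triang (A * S + A * y + S) (x * S)).
    pose proof (Rabs_triang (A * S + A * y) S). pose proof (Rabs_triang (A * S) (A * y)). lra. }
  assert (Q1 : Rabs A <= d * r) by nra. assert (Q2 : Rabs B <= d * r) by nra.
  assert (Q3 : Rabs S <= d * r) by nra.
  assert (Q : forall u v, 0 <= u -> 0 <= v -> u <= 1 -> v <= d * r -> u * v <= d * r).
  { intros u v U0 V0 U V. apply Rle_trans with (1 * v); [apply Rmult_le_compat_r|]; lra. }
  assert (A1 : Rabs A <= 1) by nra.
  assert (Rabs x * Rabs y <= d * r) by (apply Rmult_le_compat; lra).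
  assert (X1 : Rabs x <= 1) by lra. assert (Y1 : Rabs y <= 1) by lra.
  assert (Rabs A * Rabs B <= d * r) by (apply Q; auto using Rabs_pos).
  assert (Rabs x * Rabs B <= d * r) by (apply Q; auto using Rabs_pos).
  assert (Rabs A * Rabs S <= d * r) by (apply Q; auto using Rabs_pos).
  assert (Rabs x * Rabs S <= d * r) by (apply Q; auto using Rabs_pos).
  assert (Rabs A * Rabs y <= d * r) by (rewrite Rmult_comm; apply Q; auto using Rabs_pos).
  assert (9 * (d * r) <= e * r).
  { replace (9 * (d * r)) with (9 * d * r) by ring. apply Rmult_le_compat_r; lra. }
  lra.
Qed.

Lemma e2pi_addl l m z : e2pi (l + m) z = (e2pi l z * e2pi m z)%C.
Proof.
  unfold e2pi. rewrite <- Cexp_add. f_equal.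
  rewrite <- !Cmult_plus_distr_r, <- RtoC_plus. do 3 f_equal. ring.
Qed.

Lemma e2pi_addr l z w : e2pi l (z + w) = (e2pi l z * e2pi l w)%C.
Proof. unfold e2pi. rewrite <- Cexp_add. f_equal. ring. Qed.

Lemma e2pi_0l z : e2pi 0 z = RtoC 1.
Proof. unfold e2pi. rewrite Rmult_0_r, !Cmult_0_l. apply Cexp_0. Qed.

Lemma e2pi_0r l : e2pi l 0 = RtoC 1.
Proof. unfold e2pi. rewrite Cmult_0_r. apply Cexp_0. Qed.

Lemma e2pi_rect l x y : e2pi l (x, y) =
  (exp (- (2 * PI * l * y)) * cos (2 * PI * l * x), exp (- (2 * PI * l * y)) * sin (2 * PI * l * x)).
Proof.
  unfold e2pi, Cexp, RtoC, Ci, Cmult; cbn [Re Im fst snd].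
  f_equal; (f_equal; [f_equal; ring|f_equal; ring]).
Qed.

Lemma Cmod_e2pi l z : Cmod (e2pi l z) = exp (- (2 * PI * l * Im z)).
Proof.
  destruct z as [x y]. rewrite e2pi_rect. unfold Cmod; cbn [Im fst snd].
  set (A := exp _). set (t := 2 * PI * l * x).
  replace ((A * cos t) ^ 2 + (A * sin t) ^ 2) with (A * A * (Rsqr (sin t) + Rsqr (cos t)))
    by (unfold Rsqr; ring).
  rewrite sin2_cos2, Rmult_1_r. apply sqrt_square. left; apply exp_pos.
Qed.

Lemma e2pi_neq0 l z : e2pi l z <> RtoC 0.
Proof. apply Cmod_gt_0. rewrite Cmod_e2pi. apply exp_pos. Qed.

Lemma e2pi_oppl l z : e2pi (- l) z = (/ e2pi l z)%C.
Proof.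
  assert (e2pi (- l) z * e2pi l z = 1)%C.
  { rewrite <- e2pi_addl, Rplus_opp_l. apply e2pi_0l. }
  rewrite <- (Cmult_1_l (/ e2pi l z)), <- H. field. apply e2pi_neq0.
Qed.

Lemma e2pi_pow l z n : (e2pi l z ^ n = e2pi (INR n * l) z)%C.
Proof.
  induction n as [|n IH].
  - simpl. now rewrite Rmult_0_l, e2pi_0l.
  - change (e2pi l z ^ S n)%C with (e2pi l z * e2pi l z ^ n)%C.
    rewrite IH, S_INR, <- e2pi_addl. f_equal; ring.
Qed.

(** By additivity the difference quotient at [z] is [e2pi l z] times the one of [Cexp] at 0, which
    [Cexp_small] controls. *)
Lemma cderiv_e2pi l z :
  cderiv (e2pi l) z (RtoC (2 * PI * l) * Ci * e2pi l z).
Proof.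
  set (k := (RtoC (2 * PI * l) * Ci)%C).
  assert (Hk : forall v, e2pi l v = Cexp (k * v)) by reflexivity.
  set (s := fun w => if excluded_middle_informative (w = z) then (k * e2pi l z)%C
                     else ((e2pi l w - e2pi l z) / (w - z))%C).
  assert (Sz : s z = (k * e2pi l z)%C)
    by (unfold s; destruct (excluded_middle_informative (z = z)); tauto).
  exists s; split; [|split]; auto.
  - intros e He. rewrite Sz.
    set (A := Cmod (e2pi l z)).
    assert (HA : 0 < A) by (apply Cmod_gt_0, e2pi_neq0).
    pose proof (Cmod_ge_0 k).
    set (e' := e / (2 * (Cmod k + 1) * A)).
    assert (He' : 0 < e').
    { apply Rdiv_lt_0_compat; auto. repeat apply Rmult_lt_0_compat; lra. }
    destruct (Cexp_small _ He') as [d [Hd H1]].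
    exists (d / (Cmod k + 1)); split; [apply Rdiv_lt_0_compat; lra|].
    intros w Hw. unfold s.
    destruct (excluded_middle_informative (w = z)) as [->|Hwz].
    { now rewrite Cmod_sub_self. }
    assert (Hn : (w - z)%C <> RtoC 0).
    { intros E; apply Hwz. replace w with ((w - z) + z)%C by ring. rewrite E; ring. }
    pose proof (proj1 (Cmod_gt_0 _) Hn) as Pn.
    assert (Cmod (k * (w - z) - 0)%C < d).
    { replace (k * (w - z) - 0)%C with (k * (w - z))%C by ring. rewrite Cmod_mult.
      apply Rle_lt_trans with ((Cmod k + 1) * Cmod (w - z)%C).
      - apply Rmult_le_compat_r; lra.
      - apply Rmult_lt_reg_r with (/ (Cmod k + 1)); [apply Rinv_0_lt_compat; lra|].
        unfold Rdiv in Hw. eapply Rle_lt_trans; [|exact Hw]. right; field; lra. }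
    specialize (H1 _ H0).
    replace ((e2pi l w - e2pi l z) / (w - z) - k * e2pi l z)%C
      with (e2pi l z * ((Cexp (k * (w - z)) - 1 - k * (w - z)) / (w - z)))%C.
    2:{ replace (e2pi l w) with (e2pi l z * Cexp (k * (w - z)))%C.
        - field; auto.
        - rewrite !Hk, <- Cexp_add. f_equal. ring. }
    rewrite Cmod_mult, Cmod_div by auto. fold A.
    apply Rle_lt_trans with (A * (e' * (Cmod k + 1))).
    + apply Rmult_le_compat_l; [lra|].
      apply Rmult_le_reg_r with (Cmod (w - z)%C); auto.
      unfold Rdiv. rewrite Rmult_assoc, Rinv_l, Rmult_1_r by lra.
      eapply Rle_trans; [exact H1|]. rewrite Cmod_mult.
      rewrite Rmult_assoc. apply Rmult_le_compat_l; [lra|]. apply Rmult_le_compat_r; lra.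
    + unfold e'. replace (A * (e / (2 * (Cmod k + 1) * A) * (Cmod k + 1))) with (e / 2)
        by (field; lra). lra.
  - exists 1; split; [lra|]; intros w _. unfold s.
    destruct (excluded_middle_informative (w = z)) as [->|Hwz]; [ring|].
    field. intros E; apply Hwz. replace w with ((w - z) + z)%C by ring. rewrite E; ring.
Qed.

Lemma cdiff_e2pi l z : cdiff (e2pi l) z.
Proof. eexists; apply cderiv_e2pi. Qed.

(** * Complex integrals over real intervals *)

Definition CInt (g : R -> C) (a b : R) : C := @RInt C_R_CompleteNormedModule g a b.

Definition rcont (g : R -> C) (x : R) : Prop := @continuous R_UniformSpace C_R_NormedModule g x.

Lemma rcont_eps g x : rcont g x <->
  forall e, 0 < e -> exists d, 0 < d /\ forall y, Rabs (y - x) < d -> Cmod (g y - g x)%C < e.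
Proof.
  split.
  - intros H e He.
    destruct (H (fun w => Cmod (w - g x)%C < e)) as [d Hd].
    { apply (proj2 (locally_near _ _)). exists e; split; auto. }
    exists d; split; [apply cond_pos|]. exact Hd.
  - intros H P HP. apply (proj1 (locally_near _ _)) in HP. destruct HP as [e [He HP]].
    destruct (H e He) as [d [Hd H1]].
    exists (mkposreal d Hd). intros y Hy. apply HP, H1. exact Hy.
Qed.

Lemma rcont_ccont (g : C -> C) (p : R -> C) x :
  (forall y, Cmod (p y - p x)%C <= Rabs (y - x)) -> ccont g (p x) -> rcont (fun y => g (p y)) x.
Proof.
  intros Hp Hg. apply rcont_eps. intros e He. destruct (Hg e He) as [d [Hd H]].
  exists d; split; auto. intros y Hy; apply H. eapply Rle_lt_trans; eauto.
Qed.

Lemma Cmod_hor (x x' y : R) : Cmod ((x, y) - (x', y))%C = Rabs (x - x').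
Proof.
  replace ((x, y) - (x', y))%C with (RtoC (x - x')).
  - apply Cmod_R.
  - unfold Cminus, Cplus, Copp, RtoC; simpl. f_equal; ring.
Qed.

Lemma Cmod_ver (x y y' : R) : Cmod ((x, y) - (x, y'))%C = Rabs (y - y').
Proof.
  replace ((x, y) - (x, y'))%C with (Ci * RtoC (y - y'))%C.
  - rewrite Cmod_mult, Cmod_R.
    rewrite Cmod_Ci. ring.
  - unfold Cminus, Cplus, Copp, RtoC, Ci, Cmult; simpl. f_equal; ring.
Qed.

Lemma rcont_hor g x y : ccont g (x, y) -> rcont (fun t => g (t, y)) x.
Proof. apply (rcont_ccont g (fun t => (t, y))). intros; rewrite Cmod_hor; lra. Qed.

Lemma rcont_ver g x y : ccont g (x, y) -> rcont (fun t => g (x, t)) y.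
Proof. apply (rcont_ccont g (fun t => (x, t))). intros; rewrite Cmod_ver; lra. Qed.

Definition Cintegrable (g : R -> C) (a b : R) : Prop := @ex_RInt C_R_NormedModule g a b.

Lemma rcont_integrable g a b : a <= b -> (forall x, a <= x <= b -> rcont g x) -> Cintegrable g a b.
Proof.
  intros Hab H. apply (ex_RInt_continuous (V := C_R_CompleteNormedModule)).
  rewrite Rmin_left, Rmax_right by auto. exact H.
Qed.

Lemma is_CInt g a b : Cintegrable g a b -> @is_RInt C_R_NormedModule g a b (CInt g a b).
Proof. apply (RInt_correct (V := C_R_CompleteNormedModule)). Qed.

Lemma CInt_plus g h a b : Cintegrable g a b -> Cintegrable h a b ->
  CInt (fun x => g x + h x)%C a b = (CInt g a b + CInt h a b)%C.
Proof. apply (RInt_plus (V := C_R_CompleteNormedModule)). Qed.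

Lemma CInt_minus g h a b : Cintegrable g a b -> Cintegrable h a b ->
  CInt (fun x => g x - h x)%C a b = (CInt g a b - CInt h a b)%C.
Proof. apply (RInt_minus (V := C_R_CompleteNormedModule)). Qed.

(** Integrals are taken in [C] as a real module, where only real scalars come for free; a complex
    constant is handled on the two components. *)
Lemma is_CInt_scal (g : R -> C) (a b : R) (c l : C) :
  @is_RInt C_R_NormedModule g a b l -> @is_RInt C_R_NormedModule (fun x => c * g x)%C a b (c * l)%C.
Proof.
  intros H.
  pose proof (is_RInt_fct_extend_fst (U := R_NormedModule) (V := R_NormedModule) _ _ _ _ H) as H1.
  pose proof (is_RInt_fct_extend_snd (U := R_NormedModule) (V := R_NormedModule) _ _ _ _ H) as H2.
  unfold Cmult.
  apply (is_RInt_fct_extend_pair (U := R_NormedModule) (V := R_NormedModule)); cbn [fst snd].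
  - apply (is_RInt_minus (V := R_NormedModule));
      apply (is_RInt_scal (V := R_NormedModule)); assumption.
  - apply (is_RInt_plus (V := R_NormedModule));
      apply (is_RInt_scal (V := R_NormedModule)); assumption.
Qed.

Lemma Cintegrable_scal c g a b : Cintegrable g a b -> Cintegrable (fun x => c * g x)%C a b.
Proof. intros H; eexists; apply is_CInt_scal, is_CInt, H. Qed.

Lemma Cintegrable_plus g h a b : Cintegrable g a b -> Cintegrable h a b ->
  Cintegrable (fun x => g x + h x)%C a b.
Proof. apply (ex_RInt_plus (V := C_R_NormedModule)). Qed.

Lemma CInt_scal c g a b : Cintegrable g a b -> CInt (fun x => c * g x)%C a b = (c * CInt g a b)%C.
Proof.
  intros H. apply (is_RInt_unique (V := C_R_CompleteNormedModule)). apply is_CInt_scal, is_CInt, H.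
Qed.

Lemma CInt_ext (g h : R -> C) a b : a <= b -> (forall x, a < x < b -> g x = h x) ->
  CInt g a b = CInt h a b.
Proof.
  intros Hab H. apply (RInt_ext (V := C_R_CompleteNormedModule)).
  rewrite Rmin_left, Rmax_right by auto. exact H.
Qed.

Lemma CInt_Chasles g a b c : Cintegrable g a b -> Cintegrable g b c ->
  (CInt g a b + CInt g b c)%C = CInt g a c.
Proof. apply (RInt_Chasles (V := C_R_CompleteNormedModule)). Qed.

Lemma CInt_point g a : CInt g a a = RtoC 0.
Proof. apply (RInt_point (V := C_R_CompleteNormedModule)). Qed.

Lemma CInt_const c a b : CInt (fun _ => c) a b = (RtoC (b - a) * c)%C.
Proof.
  unfold CInt. rewrite (RInt_const (V := C_R_CompleteNormedModule)).
  destruct c; unfold scal; simpl; unfold prod_scal, scal, RtoC, Cmult; simpl; unfold mult; simpl.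
  f_equal; ring.
Qed.

Lemma norm_C_R (x : C) : @norm R_AbsRing C_R_NormedModule x = Cmod x.
Proof.
  change (sqrt (Rabs (fst x) ^ 2 + Rabs (snd x) ^ 2) = Cmod x).
  now rewrite !pow2_abs.
Qed.

Lemma CInt_norm g (h : R -> R) a b : a <= b -> Cintegrable g a b -> ex_RInt h a b ->
  (forall x, a <= x <= b -> Cmod (g x) <= h x) -> Cmod (CInt g a b) <= RInt h a b.
Proof.
  intros Hab Hg Hh H.
  rewrite <- norm_C_R.
  apply (norm_RInt_le (V := C_R_NormedModule) g h a b); auto.
  - intros x Hx. rewrite norm_C_R. auto.
  - now apply is_CInt.
  - now apply (RInt_correct (V := R_CompleteNormedModule)).
Qed.

Lemma CInt_norm_const g M a b : a <= b -> Cintegrable g a b ->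
  (forall x, a <= x <= b -> Cmod (g x) <= M) -> Cmod (CInt g a b) <= M * (b - a).
Proof.
  intros Hab Hg H. rewrite Rmult_comm.
  replace ((b - a) * M) with (RInt (fun _ => M) a b) by (rewrite RInt_const; reflexivity).
  apply CInt_norm; auto. apply ex_RInt_const.
Qed.

Lemma CInt_shift g a b v : Cintegrable g (a + v) (b + v) ->
  CInt (fun x => g (x + v)) a b = CInt g (a + v) (b + v).
Proof.
  intros H. unfold CInt.
  pose proof (RInt_comp_lin (V := C_R_CompleteNormedModule) g 1 v a b) as E.
  rewrite !Rmult_1_l in E. rewrite <- E by exact H.
  apply (RInt_ext (V := C_R_CompleteNormedModule)). intros x _.
  rewrite (scal_one (V := C_R_CompleteNormedModule)). now rewrite Rmult_1_l.
Qed.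

Lemma is_derive_path (g : C -> C) (p : R -> C) (x : R) (v l : C) :
  (forall y, p y = p x + RtoC (y - x) * v)%C -> cderiv g (p x) l ->
  @is_derive R_AbsRing C_R_NormedModule (fun t => g (p t)) x (v * l)%C.
Proof.
  intros Hp [s [Hs [E [d0 [Hd0 He]]]]].
  split.
  - apply is_linear_scal_l.
  - intros x0 Hx0 e.
    apply (is_filter_lim_locally_unique (K := R_AbsRing) (V := R_NormedModule)) in Hx0. subst x0.
    pose proof (Cmod_ge_0 v) as Pv.
    set (e' := e / (Cmod v + 1)).
    assert (He' : 0 < e') by (apply Rdiv_lt_0_compat; [apply cond_pos|lra]).
    destruct (Hs e' He') as [d1 [Hd1 H1]].
    set (d := Rmin d0 d1 / (Cmod v + 1)).
    assert (Hd : 0 < d) by (apply Rdiv_lt_0_compat; [now apply Rmin_pos|lra]).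
    exists (mkposreal d Hd). intros y Hy.
    change (Rabs (y - x) < d) in Hy.
    rewrite norm_C_R.
    change (Cmod ((g (p y) - g (p x)) - @scal R_AbsRing C_R_NormedModule (y - x)%R (v * l))%C <= e * Rabs (y - x)).
    assert (Hv : Cmod (p y - p x)%C < Rmin d0 d1).
    { rewrite Hp. replace (p x + RtoC (y - x) * v - p x)%C with (RtoC (y - x) * v)%C by ring.
      rewrite Cmod_mult, Cmod_R.
      apply Rle_lt_trans with (Rabs (y - x) * (Cmod v + 1)).
      - apply Rmult_le_compat_l; [apply Rabs_pos|lra].
      - apply Rlt_le_trans with (d * (Cmod v + 1)); [apply Rmult_lt_compat_r; lra|].
        right; unfold d; field; lra. }
    rewrite He by (eapply Rlt_le_trans; [exact Hv|apply Rmin_l]).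
    replace (@scal R_AbsRing C_R_NormedModule (y - x)%R (v * l)%C) with (RtoC (y - x) * v * l)%C.
    2:{ destruct v, l; unfold scal; simpl; unfold prod_scal, scal, RtoC, Cmult; simpl; unfold mult; simpl.
        f_equal; ring. }
    replace (g (p x) + (p y - p x) * s (p y) - g (p x) - RtoC (y - x) * v * l)%C
      with (RtoC (y - x) * v * (s (p y) - s (p x)))%C.
    2:{ rewrite E, (Hp y). ring. }
    rewrite !Cmod_mult, Cmod_R.
    assert (Cmod (s (p y) - s (p x))%C < e')
      by (apply H1; eapply Rlt_le_trans; [exact Hv|apply Rmin_r]).
    rewrite Rmult_assoc, (Rmult_comm e).
    apply Rmult_le_compat_l; [apply Rabs_pos|].
    apply Rle_trans with ((Cmod v + 1) * e').
    + apply Rmult_le_compat; try lra; apply Cmod_ge_0.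
    + right; unfold e'; field; lra.
Qed.

(** Fundamental theorem of calculus along an affine path of velocity [v]. The values [1] and [Ci] of
    [v] serve the sides of rectangles, general ones the segments in [unimodular_constant]. *)
Lemma CInt_path (g g' : C -> C) (p : R -> C) (v : C) a b : a <= b ->
  (forall x y, p y = p x + RtoC (y - x) * v)%C ->
  (forall x, a <= x <= b -> cderiv g (p x) (g' (p x))) ->
  (forall x, a <= x <= b -> rcont (fun t => g' (p t)) x) ->
  (v * CInt (fun t => g' (p t)) a b = g (p b) - g (p a))%C.
Proof.
  intros Hab Hp Hd Hc.
  rewrite <- CInt_scal by (apply rcont_integrable; auto).
  apply (is_RInt_unique (V := C_R_CompleteNormedModule)).
  apply (is_RInt_derive (V := C_R_CompleteNormedModule) (fun t => g (p t))).
  - rewrite Rmin_left, Rmax_right by auto. intros x Hx. now apply is_derive_path; auto.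
  - rewrite Rmin_left, Rmax_right by auto. intros x Hx.
    apply rcont_eps. intros e He.
    pose proof (Cmod_ge_0 v) as Pv.
    destruct (proj1 (rcont_eps _ _) (Hc x Hx) (e / (Cmod v + 1))) as [d [D H]].
    { apply Rdiv_lt_0_compat; lra. }
    exists d; split; auto. intros y Hy. specialize (H y Hy).
    replace (v * g' (p y) - v * g' (p x))%C with (v * (g' (p y) - g' (p x)))%C by ring.
    rewrite Cmod_mult.
    apply Rle_lt_trans with ((Cmod v) * (e / (Cmod v + 1))).
    + apply Rmult_le_compat_l; lra.
    + apply Rmult_lt_reg_r with (Cmod v + 1); [lra|].
      replace (Cmod v * (e / (Cmod v + 1)) * (Cmod v + 1)) with (Cmod v * e) by (field; lra). nra.
Qed.

Lemma CInt_hor (g g' : C -> C) a b y : a <= b ->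
  (forall x, a <= x <= b -> cderiv g (x, y) (g' (x, y))) ->
  (forall x, a <= x <= b -> rcont (fun t => g' (t, y)) x) ->
  (CInt (fun t => g' (t, y)) a b = g (b, y) - g (a, y))%C.
Proof.
  intros Hab H1 H2.
  rewrite <- (CInt_path g g' (fun t => (t, y)) 1); auto; [ring|].
  intros s t. unfold RtoC, Cplus, Cmult; simpl. f_equal; ring.
Qed.

Lemma CInt_ver (g g' : C -> C) x c d : c <= d ->
  (forall y, c <= y <= d -> cderiv g (x, y) (g' (x, y))) ->
  (forall y, c <= y <= d -> rcont (fun t => g' (x, t)) y) ->
  (Ci * CInt (fun t => g' (x, t)) c d = g (x, d) - g (x, c))%C.
Proof.
  intros Hab H1 H2.
  rewrite <- (CInt_path g g' (fun t => (x, t)) Ci); auto.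
  intros s t. unfold RtoC, Ci, Cplus, Cmult; simpl. f_equal; ring.
Qed.

Global Opaque CInt.

(** * Compactness by bisection *)

Lemma half_pow_small (L e : R) : 0 < e -> exists k, L / 2 ^ k < e.
Proof.
  intros He.
  destruct (pow_lt_1_zero (/ 2)) with (y := e / (Rabs L + 1)) as [k Hk].
  - rewrite Rabs_pos_eq; lra.
  - apply Rdiv_lt_0_compat; [lra|]. pose proof (Rabs_pos L); lra.
  - exists k. specialize (Hk k (le_n k)).
    pose proof (Rabs_pos L). pose proof (Rle_abs L).
    assert (0 < (/ 2) ^ k) by (apply pow_lt; lra).
    rewrite Rabs_pos_eq in Hk by lra.
    unfold Rdiv. rewrite <- pow_inv.
    apply Rle_lt_trans with ((Rabs L + 1) * (/ 2) ^ k); [apply Rmult_le_compat_r; lra|].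
    apply Rlt_le_trans with ((Rabs L + 1) * (e / (Rabs L + 1))).
    + apply Rmult_lt_compat_l; lra.
    + right; field; lra.
Qed.

(** If [P] fails on a rectangle it fails on one of its quarters; iteration gives nested rectangles
    shrinking to a point, where the local hypothesis is contradicted. The local hypothesis may use
    that the sides are exactly [(b - a) / 2 ^ k] and [(d - c) / 2 ^ k]: the constant ratio of the
    sides is what lets [goursat] compare a squared perimeter with an area. *)
Lemma rectangle_bisection (P : R -> R -> R -> R -> Prop) a b c d :
  a < b -> c < d ->
  (forall a b c d, a < b -> c < d ->
    P a ((a + b) / 2) c ((c + d) / 2) -> P ((a + b) / 2) b c ((c + d) / 2) ->
    P a ((a + b) / 2) ((c + d) / 2) d -> P ((a + b) / 2) b ((c + d) / 2) d -> P a b c d) ->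
  (forall x y, a <= x <= b -> c <= y <= d -> exists e, 0 < e /\
    forall k a' b' c' d', a <= a' <= x -> x <= b' <= b -> c <= c' <= y -> y <= d' <= d ->
      b' - a' = (b - a) / 2 ^ k -> d' - c' = (d - c) / 2 ^ k ->
      b' - a' < e -> d' - c' < e -> P a' b' c' d') ->
  P a b c d.
Proof.
  intros Hab Hcd Hadd Hloc. apply NNPP; intros HN.
  (* A type of failing rectangles turns the choice of a failing quarter into a function that can be
     iterated. *)
  set (rect := { q : (R * R) * (R * R) |
    fst (fst q) < snd (fst q) /\ fst (snd q) < snd (snd q) /\
    ~ P (fst (fst q)) (snd (fst q)) (fst (snd q)) (snd (snd q)) }).
  assert (step : forall q : rect, { q' : rect |
     let '((a, b), (c, d)) := proj1_sig q in let '((a', b'), (c', d')) := proj1_sig q' in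
     a <= a' /\ b' <= b /\ c <= c' /\ d' <= d /\ b' - a' = (b - a) / 2 /\ d' - c' = (d - c) / 2 }).
  { intros q. apply constructive_indefinite_description.
    destruct q as [[[u v] [s t]] [H1 [H2 H3]]]; cbn [fst snd proj1_sig] in *.
    destruct (classic (P u ((u + v) / 2) s ((s + t) / 2))) as [Q1|Q1].
    2:{ assert (A : u < (u + v) / 2 /\ s < (s + t) / 2) by lra.
        exists (exist _ ((u, (u + v) / 2), (s, (s + t) / 2)) (conj (proj1 A) (conj (proj2 A) Q1))).
        simpl; lra. }
    destruct (classic (P ((u + v) / 2) v s ((s + t) / 2))) as [Q2|Q2].
    2:{ assert (A : (u + v) / 2 < v /\ s < (s + t) / 2) by lra.
        exists (exist _ (((u + v) / 2, v), (s, (s + t) / 2)) (conj (proj1 A) (conj (proj2 A) Q2))).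
        simpl; lra. }
    destruct (classic (P u ((u + v) / 2) ((s + t) / 2) t)) as [Q3|Q3].
    2:{ assert (A : u < (u + v) / 2 /\ (s + t) / 2 < t) by lra.
        exists (exist _ ((u, (u + v) / 2), ((s + t) / 2, t)) (conj (proj1 A) (conj (proj2 A) Q3))).
        simpl; lra. }
    destruct (classic (P ((u + v) / 2) v ((s + t) / 2) t)) as [Q4|Q4].
    2:{ assert (A : (u + v) / 2 < v /\ (s + t) / 2 < t) by lra.
        exists (exist _ (((u + v) / 2, v), ((s + t) / 2, t)) (conj (proj1 A) (conj (proj2 A) Q4))).
        simpl; lra. }
    exfalso; apply H3; auto. }
  set (q0 := exist _ ((a, b), (c, d)) (conj Hab (conj Hcd HN)) : rect).
  set (q := fix q n := match n with O => q0 | S n => proj1_sig (step (q n)) end).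
  set (A := fun n => fst (fst (proj1_sig (q n)))). set (B := fun n => snd (fst (proj1_sig (q n)))).
  set (D := fun n => fst (snd (proj1_sig (q n)))). set (E := fun n => snd (snd (proj1_sig (q n)))).
  assert (HS : forall n, A n <= A (S n) /\ B (S n) <= B n /\ D n <= D (S n) /\ E (S n) <= E n /\
     B (S n) - A (S n) = (B n - A n) / 2 /\ E (S n) - D (S n) = (E n - D n) / 2).
  { intros n. unfold A, B, D, E. cbn [q]. destruct (step (q n)) as [q' Hq']; cbn [proj1_sig].
    destruct (proj1_sig (q n)) as [[? ?] [? ?]]. destruct (proj1_sig q') as [[? ?] [? ?]].
    simpl in *; tauto. }
  assert (HQ : forall n, A n < B n /\ D n < E n /\ ~ P (A n) (B n) (D n) (E n))
    by (intros n; exact (proj2_sig (q n))).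
  assert (Hsize : forall n, B n - A n = (b - a) / 2 ^ n /\ E n - D n = (d - c) / 2 ^ n).
  { induction n as [|n [I1 I2]].
    - unfold A, B, D, E; simpl. lra.
    - destruct (HS n) as [_ [_ [_ [_ [S1 S2]]]]]. rewrite S1, S2, I1, I2. simpl.
      assert (2 ^ n <> 0) by (apply pow_nonzero; lra). split; field; auto. }
  assert (HmA : forall n m, (n <= m)%nat -> A n <= A m /\ B m <= B n /\ D n <= D m /\ E m <= E n).
  { intros n m H. induction H as [|m H IH]; [lra|]. pose proof (HS m). lra. }
  assert (Hcross : forall n m, A n <= B m /\ D n <= E m).
  { intros n m. destruct (Nat.le_ge_cases n m) as [H|H].
    - pose proof (HmA _ _ H). pose proof (HQ m). lra.
    - pose proof (HmA _ _ H). pose proof (HQ n). lra. }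
  assert (Hlim : forall U V : nat -> R, (forall n m, U n <= V m) ->
     exists x, forall n, U n <= x <= V n).
  { intros U V H. destruct (completeness (fun x => exists n, x = U n)) as [x [X1 X2]].
    - exists (V O). intros y [n ->]; auto.
    - exists (U O); exists O; auto.
    - exists x. intros n; split; [apply X1; now exists n|]. apply X2. intros y [m ->]; auto. }
  destruct (Hlim A B) as [x Hx]; [intros; apply Hcross|].
  destruct (Hlim D E) as [y Hy]; [intros; apply Hcross|].
  destruct (Hloc x y (Hx O) (Hy O)) as [e [He Hl]].
  destruct (half_pow_small ((b - a) + (d - c)) e He) as [k Hk].
  assert (0 < (b - a) / 2 ^ k /\ 0 < (d - c) / 2 ^ k).
  { assert (0 < 2 ^ k) by (apply pow_lt; lra). split; apply Rdiv_lt_0_compat; lra. }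
  assert (((b - a) + (d - c)) / 2 ^ k = (b - a) / 2 ^ k + (d - c) / 2 ^ k) by (unfold Rdiv; ring).
  destruct (Hsize k) as [S1 S2]. destruct (HmA O k) as [M1 [M2 [M3 M4]]]; [lia|].
  change (A O) with a in *. change (B O) with b in *. change (D O) with c in *. change (E O) with d in *.
  apply (proj2 (proj2 (HQ k))). specialize (Hx k). specialize (Hy k).
  apply Hl with k; auto; lra.
Qed.

(** Compactness of a segment in Cousin's form, read off from the bisection of [[a, b] x [0, 1]] for
    a property that ignores the second side. It replaces every extraction of a finite subcover
    below. *)
Lemma interval_cousin (P : R -> R -> Prop) a b : a < b ->
  (forall u m v, a <= u < m -> m < v <= b -> P u m -> P m v -> P u v) ->
  (forall x, a <= x <= b -> exists e, 0 < e /\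
    forall u v, a <= u <= x -> x <= v <= b -> u < v -> v - u < e -> P u v) ->
  P a b.
Proof.
  intros Hab Hadd Hloc.
  enough (H : a <= a -> b <= b -> P a b) by (apply H; lra).
  apply (rectangle_bisection (fun u v _ _ => a <= u -> v <= b -> P u v) a b 0 1); auto; [lra| |].
  - intros u v s t Huv _ H1 H2 _ _ Hu Hv.
    apply Hadd with ((u + v) / 2); try lra; [apply H1|apply H2]; lra.
  - intros x y Hx _. destruct (Hloc x Hx) as [e [He H]]. exists e; split; auto.
    intros k u v s t Hu Hv _ _ Hk _ Hs _ _ _. apply H; auto.
    assert (0 < (b - a) / 2 ^ k); [|lra].
    apply Rdiv_lt_0_compat; [lra|apply pow_lt; lra].
Qed.

(** * Goursat's lemma *)

(** The contour integral of [F], counterclockwise around the rectangle [[a, b] x [c, d]]. *)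
Definition bdry (F : C -> C) (a b c d : R) : C :=
  (CInt (fun x => F (x, c)) a b - CInt (fun x => F (x, d)) a b
   + Ci * (CInt (fun y => F (b, y)) c d - CInt (fun y => F (a, y)) c d))%C.

Definition cont_rect (F : C -> C) (a b c d : R) : Prop :=
  forall x y, a <= x <= b -> c <= y <= d -> ccont F (x, y).

Lemma cont_rect_hor F a b c d y u v : cont_rect F a b c d -> a <= u -> u <= v -> v <= b ->
  c <= y <= d -> Cintegrable (fun x => F (x, y)) u v.
Proof.
  intros H Hu Huv Hv Hy. apply rcont_integrable; auto.
  intros x Hx. apply rcont_hor, H; lra.
Qed.

Lemma cont_rect_ver F a b c d x u v : cont_rect F a b c d -> c <= u -> u <= v -> v <= d ->
  a <= x <= b -> Cintegrable (fun y => F (x, y)) u v.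
Proof.
  intros H Hu Huv Hv Hx. apply rcont_integrable; auto.
  intros y Hy. apply rcont_ver, H; lra.
Qed.

Lemma bdry_split F a b c d m n : cont_rect F a b c d -> a <= m <= b -> c <= n <= d ->
  bdry F a b c d =
  (bdry F a m c n + bdry F m b c n + bdry F a m n d + bdry F m b n d)%C.
Proof.
  intros H Hm Hn. unfold bdry.
  assert (Ehor : forall y, c <= y <= d ->
    CInt (fun x => F (x, y)) a b = (CInt (fun x => F (x, y)) a m + CInt (fun x => F (x, y)) m b)%C).
  { intros y Hy. symmetry. apply CInt_Chasles; eapply cont_rect_hor; try exact H; lra. }
  assert (Ever : forall x, a <= x <= b ->
    CInt (fun y => F (x, y)) c d = (CInt (fun y => F (x, y)) c n + CInt (fun y => F (x, y)) n d)%C).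
  { intros x Hx. symmetry. apply CInt_Chasles; eapply cont_rect_ver; try exact H; lra. }
  rewrite (Ehor c), (Ehor d), (Ever a), (Ever b) by lra.
  ring.
Qed.

Lemma bdry_minus F G a b c d : a <= b -> c <= d -> cont_rect F a b c d -> cont_rect G a b c d ->
  bdry (fun z => F z - G z)%C a b c d = (bdry F a b c d - bdry G a b c d)%C.
Proof.
  intros Hab Hcd HF HG. unfold bdry.
  assert (Ehor : forall y, c <= y <= d -> CInt (fun x => F (x, y) - G (x, y))%C a b
    = (CInt (fun x => F (x, y)) a b - CInt (fun x => G (x, y)) a b)%C).
  { intros y Hy. apply CInt_minus;
      [apply (cont_rect_hor F a b c d y)|apply (cont_rect_hor G a b c d y)]; auto; lra. }
  assert (Ever : forall x, a <= x <= b -> CInt (fun y => F (x, y) - G (x, y))%C c d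
    = (CInt (fun y => F (x, y)) c d - CInt (fun y => G (x, y)) c d)%C).
  { intros x Hx. apply CInt_minus;
      [apply (cont_rect_ver F a b c d x)|apply (cont_rect_ver G a b c d x)]; auto; lra. }
  rewrite (Ehor c), (Ehor d), (Ever a), (Ever b) by lra.
  ring.
Qed.

Lemma bdry_bound F M a b c d : a <= b -> c <= d -> cont_rect F a b c d ->
  (forall x y, a <= x <= b -> c <= y <= d -> Cmod (F (x, y)) <= M) ->
  Cmod (bdry F a b c d) <= 2 * M * ((b - a) + (d - c)).
Proof.
  intros Hab Hcd HF HM. unfold bdry.
  assert (H1 : Cmod (CInt (fun x => F (x, c)) a b) <= M * (b - a)).
  { apply CInt_norm_const; auto; [eapply cont_rect_hor; [eassumption|lra..]|].
    intros; apply HM; lra. }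
  assert (H2 : Cmod (CInt (fun x => F (x, d)) a b) <= M * (b - a)).
  { apply CInt_norm_const; auto; [eapply cont_rect_hor; [eassumption|lra..]|].
    intros; apply HM; lra. }
  assert (H3 : Cmod (CInt (fun y => F (b, y)) c d) <= M * (d - c)).
  { apply CInt_norm_const; auto; [eapply cont_rect_ver; [eassumption|lra..]|].
    intros; apply HM; lra. }
  assert (H4 : Cmod (CInt (fun y => F (a, y)) c d) <= M * (d - c)).
  { apply CInt_norm_const; auto; [eapply cont_rect_ver; [eassumption|lra..]|].
    intros; apply HM; lra. }
  eapply Rle_trans; [apply Cmod_triangle|]. rewrite Cmod_mult.
  rewrite Cmod_Ci.
  assert (S : forall u v : C, Cmod (u - v)%C <= Cmod u + Cmod v).
  { intros u v. unfold Cminus. rewrite <- (Cmod_opp v). apply Cmod_triangle. }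
  pose proof (S (CInt (fun x => F (x, c)) a b) (CInt (fun x => F (x, d)) a b)).
  pose proof (S (CInt (fun y => F (b, y)) c d) (CInt (fun y => F (a, y)) c d)).
  lra.
Qed.

Lemma bdry_primitive F G a b c d : a <= b -> c <= d -> cont_rect G a b c d ->
  (forall x y, a <= x <= b -> c <= y <= d -> cderiv F (x, y) (G (x, y))) ->
  bdry G a b c d = 0.
Proof.
  intros Hab Hcd HG H. unfold bdry.
  assert (Ehor : forall y, c <= y <= d -> CInt (fun x => G (x, y)) a b = (F (b, y) - F (a, y))%C).
  { intros y Hy. apply (CInt_hor F G); auto. intros x Hx; apply rcont_hor, HG; auto. }
  assert (Ever : forall x, a <= x <= b ->
    (Ci * CInt (fun y => G (x, y)) c d)%C = (F (x, d) - F (x, c))%C).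
  { intros x Hx. apply (CInt_ver F G); auto. intros y Hy; apply rcont_ver, HG; auto. }
  assert (D : forall u v, (Ci * (u - v) = Ci * u - Ci * v)%C) by (intros; ring).
  rewrite D, (Ehor c), (Ehor d), (Ever a), (Ever b) by lra.
  ring.
Qed.

(** The bound [e * area] is additive under quartering, so it suffices to have it for small
    rectangles around each point. There [F] differs from its affine part by at most [e'] times the
    distance, and the affine part has a primitive, hence integrates to 0. *)
Lemma goursat F a b c d : a < b -> c < d ->
  (forall x y, a <= x <= b -> c <= y <= d -> cdiff F (x, y)) -> bdry F a b c d = 0.
Proof.
  intros Hab Hcd HF.
  assert (HC : cont_rect F a b c d) by (intros x y Hx Hy; apply cdiff_cont; auto).
  assert (sub : forall G a' b' c' d', cont_rect G a b c d -> a <= a' -> b' <= b -> c <= c' -> d' <= d ->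
    cont_rect G a' b' c' d').
  { intros G a' b' c' d' HG H1 H2 H3 H4 x y Hx Hy. apply HG; lra. }
  enough (K : forall e, 0 < e -> Cmod (bdry F a b c d) <= e * ((b - a) * (d - c))).
  { apply Cmod_eq_0. apply Rle_antisym; [|apply Cmod_ge_0].
    apply Rnot_lt_le; intros N.
    assert (0 < (b - a) * (d - c)) by (apply Rmult_lt_0_compat; lra).
    specialize (K (Cmod (bdry F a b c d) / (2 * ((b - a) * (d - c)))) ltac:(apply Rdiv_lt_0_compat; lra)).
    replace (Cmod (bdry F a b c d) / (2 * ((b - a) * (d - c))) * ((b - a) * (d - c)))
      with (Cmod (bdry F a b c d) / 2) in K by (field; split; lra). lra. }
  intros e He.
  enough (K : a <= a -> b <= b -> c <= c -> d <= d ->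
     Cmod (bdry F a b c d) <= e * ((b - a) * (d - c))) by (apply K; lra).
  apply (rectangle_bisection (fun a' b' c' d' => a <= a' -> b' <= b -> c <= c' -> d' <= d ->
     Cmod (bdry F a' b' c' d') <= e * ((b' - a') * (d' - c')))); auto.
  - intros p q s t Hpq Hst K1 K2 K3 K4 H1 H2 H3 H4.
    rewrite (bdry_split F p q s t ((p + q) / 2) ((s + t) / 2)); try lra; [|apply sub; auto].
    specialize (K1 ltac:(lra) ltac:(lra) ltac:(lra) ltac:(lra)).
    specialize (K2 ltac:(lra) ltac:(lra) ltac:(lra) ltac:(lra)).
    specialize (K3 ltac:(lra) ltac:(lra) ltac:(lra) ltac:(lra)).
    specialize (K4 ltac:(lra) ltac:(lra) ltac:(lra) ltac:(lra)).
    eapply Rle_trans; [apply Cmod_triangle|].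
    eapply Rle_trans; [apply Rplus_le_compat_r, Cmod_triangle|].
    eapply Rle_trans; [apply Rplus_le_compat_r, Rplus_le_compat_r, Cmod_triangle|].
    nra.
  - intros x y Hx Hy.
    destruct (HF x y Hx Hy) as [l [s [Hs [El [d0 [Hd0 Heq]]]]]].
    set (W := b - a). set (V := d - c).
    assert (HW : 0 < W) by (unfold W; lra). assert (HV : 0 < V) by (unfold V; lra).
    assert (HWV : 0 < W * V) by (apply Rmult_lt_0_compat; auto).
    (* Chosen so that [2 * e' * (W' + V')^2 = e * W' * V'] for all sides [W'], [V'] in the ratio of
       [W] to [V]. *)
    set (e' := e * (W * V) / (2 * (W + V) * (W + V))).
    assert (HWV2 : 0 < 2 * (W + V) * (W + V)) by (repeat apply Rmult_lt_0_compat; lra).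
    assert (He' : 0 < e') by (apply Rdiv_lt_0_compat; [apply Rmult_lt_0_compat|]; auto).
    destruct (Hs e' He') as [d1 [Hd1 Hs1]].
    exists (Rmin d0 d1 / 2); split; [pose proof (Rmin_pos _ _ Hd0 Hd1); lra|].
    intros k a' b' c' d' Ha Hb Hc Hd W' V' Wd Vd H1 H2 H3 H4.
    set (z0 := (x, y) : C) in *.
    set (L := fun w : C => (F z0 + (w - z0) * l)%C).
    assert (HL : forall w, ccont L w).
    { intros w. apply ccont_plus; [apply ccont_const|]. apply ccont_mult; [|apply ccont_const].
      apply ccont_minus; [apply ccont_id|apply ccont_const]. }
    assert (E0 : bdry L a' b' c' d' = 0).
    { apply (bdry_primitive (fun w => w * (F z0 - z0 * l) + (w * w) * (l / 2))%C); try lra.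
      - intros ? ? ? ?; apply HL.
      - intros u v _ _. set (w := (u, v) : C).
        replace (L w) with ((1 * (F z0 - z0 * l) + w * 0) + ((1 * w + w * 1) * (l / 2) + (w * w) * 0))%C.
        + apply (cderiv_plus (fun w => w * (F z0 - z0 * l))%C (fun w => w * w * (l / 2))%C).
          * apply (cderiv_mult (fun w => w) (fun _ => F z0 - z0 * l)%C); [apply cderiv_id|apply cderiv_const].
          * apply (cderiv_mult (fun w => w * w)%C (fun _ => l / 2)%C);
              [apply (cderiv_mult (fun w => w) (fun w => w)); apply cderiv_id|apply cderiv_const].
        + unfold L. field. }
    assert (HFc : cont_rect F a' b' c' d') by (apply sub; auto).
    assert (HLc : cont_rect L a' b' c' d') by (intros ? ? ? ?; apply HL).
    replace (bdry F a' b' c' d') with (bdry (fun z => F z - L z)%C a' b' c' d')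
      by (rewrite bdry_minus by (auto; lra); rewrite E0; ring).
    apply Rle_trans with (2 * (e' * ((b' - a') + (d' - c'))) * ((b' - a') + (d' - c'))).
    + apply bdry_bound; try lra.
      * intros u v Hu Hv. apply ccont_minus; [apply HFc|apply HL]; lra.
      * intros u v Hu Hv.
        assert (Hd2 : Cmod ((u, v) - z0)%C <= (b' - a') + (d' - c')).
        { eapply Rle_trans; [apply Cmod_le_abs|]. unfold z0, Cminus, Cplus, Copp, Re, Im; cbn [fst snd].
          apply Rplus_le_compat; apply Rabs_le; lra. }
        pose proof (Rmin_l d0 d1). pose proof (Rmin_r d0 d1).
        rewrite Heq by lra. unfold L.
        replace (F z0 + ((u, v) - z0) * s (u, v) - (F z0 + ((u, v) - z0) * l))%C
          with (((u, v) - z0) * (s (u, v) - s z0))%C by (rewrite El; ring).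
        rewrite Cmod_mult, Rmult_comm. apply Rmult_le_compat; try apply Cmod_ge_0; auto.
        left; apply Hs1; lra.
    + fold W in W'. fold V in V'. rewrite W', V'.
      assert (0 < 2 ^ k) by (apply pow_lt; lra).
      right. unfold e'. field. split; lra.
Qed.

(** By periodicity the vertical sides cancel in Goursat's lemma, which leaves the two horizontal
    ones. *)
Lemma periodic_contour_shift F a T y1 y2 : 0 < T -> y1 <= y2 ->
  (forall x y, y1 <= y <= y2 -> cdiff F (x, y)) ->
  (forall y, y1 <= y <= y2 -> F (a + T, y) = F (a, y)) ->
  CInt (fun x => F (x, y1)) a (a + T) = CInt (fun x => F (x, y2)) a (a + T).
Proof.
  intros HT Hy HF HP. destruct Hy as [Hy|<-]; auto.
  assert (H := goursat F a (a + T) y1 y2 ltac:(lra) Hy ltac:(auto)).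
  unfold bdry in H. rewrite (CInt_ext (fun y => F (a + T, y)) (fun y => F (a, y))) in H.
  - match type of H with (?X - ?Y + Ci * (?Z - ?Z))%C = _ =>
      replace X with (X - Y + Ci * (Z - Z) + Y)%C by ring end.
    rewrite H. ring.
  - lra.
  - intros y Hy'. apply HP; lra.
Qed.

(** Continuity at the points of the line is uniform along a period. This lets a contour reach a line
    on which the integrand is merely continuous, where [periodic_contour_shift] does not apply. *)
Lemma contour_continuous F a T y0 e : 0 < T -> 0 < e ->
  (forall x, a <= x <= a + T -> ccont F (x, y0)) ->
  exists d, 0 < d /\ forall y, Rabs (y - y0) < d -> Cintegrable (fun x => F (x, y)) a (a + T) ->
    Cmod (CInt (fun x => F (x, y)) a (a + T) - CInt (fun x => F (x, y0)) a (a + T))%C <= e.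
Proof.
  intros HT He HF.
  assert (K : exists d, 0 < d /\ forall x y, a <= x <= a + T -> Rabs (y - y0) < d ->
     Cmod (F (x, y) - F (x, y0))%C <= e / T).
  { apply (interval_cousin (fun u v => exists d, 0 < d /\ forall x y, u <= x <= v -> Rabs (y - y0) < d ->
     Cmod (F (x, y) - F (x, y0))%C <= e / T)); [lra| |].
    - intros u m v _ _ [d [Hd H]] [d' [Hd' H']].
      exists (Rmin d d'); split; [now apply Rmin_pos|]. intros x y Hx Hy.
      pose proof (Rmin_l d d'). pose proof (Rmin_r d d').
      destruct (Rle_dec x m); [apply H|apply H']; lra.
    - intros x Hx. destruct (HF x Hx (e / T / 2)) as [d [Hd H]].
      { apply Rdiv_lt_0_compat; [|lra]. now apply Rdiv_lt_0_compat. }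
      exists (d / 2); split; [lra|]. intros u v Hu Hv _ Huv.
      exists (d / 2); split; [lra|]. intros s y Hs Hy.
      assert (A : Rabs (s - x) < d / 2) by (apply Rabs_def1; lra).
      pose proof (Cmod_sub_tri (F (s, y)) (F (x, y0)) (F (s, y0))).
      rewrite (Cmod_sub_sym (F (x, y0))) in H0.
      assert (Cmod (F (s, y) - F (x, y0))%C < e / T / 2).
      { apply H. eapply Rle_lt_trans; [apply Cmod_le_abs|].
        unfold Cminus, Cplus, Copp, Re, Im; cbn [fst snd]. unfold Rminus in *. lra. }
      assert (Cmod (F (s, y0) - F (x, y0))%C < e / T / 2).
      { apply H. rewrite Cmod_hor. lra. }
      lra. }
  destruct K as [d [Hd K]]. exists d; split; auto. intros y Hy Hint.
  assert (Hint0 : Cintegrable (fun x => F (x, y0)) a (a + T)).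
  { apply rcont_integrable; [lra|]. intros; apply rcont_hor; auto. }
  rewrite <- CInt_minus by auto.
  replace e with (e / T * (a + T - a)) by (field; lra).
  apply CInt_norm_const; [lra| |intros; apply K; auto].
  apply (ex_RInt_minus (V := C_R_NormedModule)); auto.
Qed.

(** * Finite sums and products of integrands *)

Fixpoint csum (f : nat -> C) (n : nat) : C :=
  match n with O => RtoC 0 | S n => (csum f n + f n)%C end.

Lemma csum_ext f g n : (forall k, (k < n)%nat -> f k = g k) -> csum f n = csum g n.
Proof. induction n as [|n IH]; intros H; simpl; auto. rewrite IH, H by auto; auto. Qed.

Lemma csum_scal c f n : csum (fun k => c * f k)%C n = (c * csum f n)%C.
Proof. induction n as [|n IH]; simpl; [ring|rewrite IH; ring]. Qed.

Lemma csum_zero f n : (forall k, (k < n)%nat -> f k = RtoC 0) -> csum f n = RtoC 0.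
Proof. induction n as [|n IH]; intros H; simpl; auto. rewrite IH, H by auto. ring. Qed.

Lemma Cintegrable_csum (f : nat -> R -> C) a b n : (forall k, Cintegrable (f k) a b) ->
  Cintegrable (fun x => csum (fun k => f k x) n) a b.
Proof.
  intros H. induction n as [|n IH]; simpl.
  - apply (ex_RInt_const (V := C_R_NormedModule)).
  - now apply Cintegrable_plus.
Qed.

Lemma CInt_csum (f : nat -> R -> C) a b n : (forall k, Cintegrable (f k) a b) ->
  CInt (fun x => csum (fun k => f k x) n) a b = csum (fun k => CInt (f k) a b) n.
Proof.
  intros H. induction n as [|n IH]; simpl.
  - rewrite CInt_const. ring.
  - rewrite CInt_plus; auto using Cintegrable_csum. now rewrite IH.
Qed.

Lemma csum_geom q n : (csum (Cpow q) n * (1 - q) = 1 - q ^ n)%C.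
Proof. induction n as [|n IH]; simpl; [ring|]. rewrite Cmult_plus_distr_r, IH. ring. Qed.

Lemma rcont_mult g h x : rcont g x -> rcont h x -> rcont (fun t => g t * h t)%C x.
Proof.
  intros Hg Hh. apply rcont_eps. intros e He.
  rewrite rcont_eps in Hg, Hh.
  (* reduced to [ccont_mult] by extending constantly in the imaginary direction *)
  assert (K : forall f : R -> C, (forall e, 0 < e -> exists d, 0 < d /\
      forall y, Rabs (y - x) < d -> Cmod (f y - f x)%C < e) -> ccont (fun z => f (Re z)) (RtoC x)).
  { intros f Hf e' He'. destruct (Hf e' He') as [d [Hd H]]. exists d; split; auto.
    intros w Hw. apply H. eapply Rle_lt_trans; [|exact Hw].
    eapply Rle_trans; [|apply Rabs_Re_le]. apply Req_le. reflexivity. }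
  destruct (ccont_mult _ _ _ (K g Hg) (K h Hh) e He) as [d [Hd H]].
  exists d; split; auto. intros y Hy. apply (H (RtoC y)).
  replace (RtoC y - RtoC x)%C with (RtoC (y - x)) by apply RtoC_minus. now rewrite Cmod_R.
Qed.

Lemma rcont_const c x : rcont (fun _ => c) x.
Proof. apply rcont_eps. intros e He; exists 1; split; [lra|]. intros; now rewrite Cmod_sub_self. Qed.

Lemma rcont_e2pi l x y : rcont (fun t => e2pi l (t, y)) x.
Proof. apply rcont_hor, cdiff_cont, cdiff_e2pi. Qed.

Lemma Cmod_continuous g x : rcont g x -> continuous (fun t => Cmod (g t)) x.
Proof.
  intros H P [e HP]. destruct (proj1 (rcont_eps _ _) H e (cond_pos e)) as [d [Hd K]].
  exists (mkposreal d Hd). intros y Hy. apply HP.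
  change (Rabs (Cmod (g y) - Cmod (g x)) < e).
  eapply Rle_lt_trans; [|apply (K y Hy)].
  pose proof (Cmod_triangle (g y - g x) (g x))%C as A1.
  pose proof (Cmod_triangle (g x - g y) (g y))%C as A2.
  replace (g y - g x + g x)%C with (g y) in A1 by ring.
  replace (g x - g y + g y)%C with (g x) in A2 by ring.
  rewrite (Cmod_sub_sym (g x)) in A2. apply Rabs_le; lra.
Qed.

(** * Periodic functions and their Fourier coefficients *)

Lemma e2pi_INR_1 n : e2pi (INR n) (RtoC 1) = RtoC 1.
Proof.
  unfold RtoC. rewrite e2pi_rect, Rmult_0_r, Ropp_0, exp_0, !Rmult_1_l, !Rmult_1_r.
  rewrite <- (Rplus_0_l (2 * PI * INR n)).
  replace (0 + 2 * PI * INR n) with (0 + 2 * INR n * PI) by ring.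
  now rewrite cos_period, sin_period, cos_0, sin_0.
Qed.

Lemma e2pi_eq (l l' : R) (z z' : C) : (RtoC l * z = RtoC l' * z')%C -> e2pi l z = e2pi l' z'.
Proof.
  intros H. unfold e2pi. f_equal. rewrite !RtoC_mult.
  transitivity (RtoC 2 * RtoC PI * Ci * (RtoC l * z))%C; [ring|]. rewrite H; ring.
Qed.

Lemma e2pi_period T n z : T <> 0 -> e2pi (INR n / T) (z + RtoC T) = e2pi (INR n / T) z.
Proof.
  intros HT. rewrite e2pi_addr.
  rewrite (e2pi_eq (INR n / T) (INR n) (RtoC T) (RtoC 1)).
  - rewrite e2pi_INR_1. ring.
  - unfold Rdiv. rewrite RtoC_mult, RtoC_inv by auto. field.
    intros E; apply HT. now apply RtoC_inj in E.
Qed.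

Lemma pair_add_R (x y t : R) : ((x, y) + RtoC t)%C = (x + t, y).
Proof. unfold Cplus, RtoC; simpl. now rewrite Rplus_0_r. Qed.

Lemma CInt_e2pi l a b y : l <> 0 -> a <= b ->
  CInt (fun x => e2pi l (x, y)) a b
  = ((e2pi l (b, y) - e2pi l (a, y)) / (RtoC (2 * PI * l) * Ci))%C.
Proof.
  intros Hl Hab.
  assert (Hk : (RtoC (2 * PI * l) * Ci)%C <> RtoC 0).
  { apply Cmult_neq_0.
    - intros E. apply RtoC_inj in E. pose proof PI_RGT_0.
      apply Rmult_integral in E. destruct E; [lra|auto].
    - intros E. apply (f_equal Im) in E. simpl in E. lra. }
  set (k := (RtoC (2 * PI * l) * Ci)%C) in *.
  rewrite <- (CInt_hor (e2pi l) (fun z => k * e2pi l z)%C); auto.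
  - rewrite CInt_scal; [field; auto|]. apply rcont_integrable; auto using rcont_e2pi.
  - intros; apply cderiv_e2pi.
  - intros. apply rcont_mult; auto using rcont_const, rcont_e2pi.
Qed.

Lemma CInt_e2pi_period n T a y : 0 < T -> (0 < n)%nat ->
  CInt (fun x => e2pi (INR n / T) (x, y)) a (a + T) = 0.
Proof.
  intros HT Hn. rewrite CInt_e2pi; [|apply Rgt_not_eq, Rdiv_lt_0_compat; auto; now apply lt_0_INR|lra].
  rewrite <- pair_add_R, e2pi_period by lra. unfold Cminus, Cdiv. rewrite Cplus_opp_r. ring.
Qed.

Lemma CInt_e2pi_neg_period n T a y : 0 < T -> (0 < n)%nat ->
  CInt (fun x => e2pi (- (INR n / T)) (x, y)) a (a + T) = 0.
Proof.
  intros HT Hn. assert (0 < INR n / T) by (apply Rdiv_lt_0_compat; auto; now apply lt_0_INR).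
  rewrite CInt_e2pi; [|lra|lra].
  rewrite <- pair_add_R, !e2pi_oppl, e2pi_period by lra. unfold Cminus, Cdiv. rewrite Cplus_opp_r. ring.
Qed.

(** [T] times the Fourier coefficient at the frequency [l]. The factor [e2pi (- l)] is taken at the
    complex point, not at its real part, so that the integrand is holomorphic and the value does not
    depend on [y]. *)
Definition coef (F : C -> C) (a T l y : R) : C :=
  CInt (fun x => F (x, y) * e2pi (- l) (x, y))%C a (a + T).

(** This links the line just above the poles, where the coefficients are used, with the heights at
    which the expansion is available. *)
Lemma coef_indep F a T y0 l y1 y2 : 0 < T ->
  (forall z, y0 < Im z -> cdiff F z) ->
  (forall z, y0 < Im z -> (F (z + RtoC T) * e2pi (- l) (z + RtoC T) = F z * e2pi (- l) z)%C) ->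
  y0 < y1 -> y0 < y2 -> coef F a T l y1 = coef F a T l y2.
Proof.
  intros HT HF HP.
  assert (K : forall y1 y2, y0 < y1 -> y1 <= y2 -> coef F a T l y1 = coef F a T l y2).
  { clear y1 y2. intros y1 y2 H1 H2.
    apply (periodic_contour_shift (fun z => F z * e2pi (- l) z)%C); auto.
    - intros x y Hy. apply cdiff_mult; [|apply cdiff_e2pi]. apply HF. simpl; lra.
    - intros y Hy. rewrite <- pair_add_R. apply HP. simpl; lra. }
  intros H1 H2. destruct (Rle_dec y1 y2); [now apply K|]. symmetry; apply K; lra.
Qed.

(** * Laurent expansion of a periodic holomorphic function *)

Lemma e2pi_eq_1 (t : R) : Rabs t <= / 2 -> e2pi 1 (RtoC t) = RtoC 1 -> t = 0.
Proof.
  intros Ht H. unfold RtoC in H. rewrite e2pi_rect in H. injection H as H1 H2.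
  rewrite Rmult_0_r, Ropp_0, exp_0, Rmult_1_l, Rmult_1_r in H1.
  pose proof PI_RGT_0.
  replace (2 * PI * t) with (2 * (PI * t)) in H1 by ring. rewrite cos_2a_sin in H1.
  assert (S : sin (PI * t) = 0) by nra.
  apply Rabs_le_between in Ht.
  destruct (Rtotal_order t 0) as [N|[N|N]]; auto; exfalso.
  - assert (0 < sin (PI * - t)) by (apply sin_gt_0; nra).
    replace (PI * - t) with (- (PI * t)) in H0 by ring. rewrite sin_neg in H0. lra.
  - assert (0 < sin (PI * t)) by (apply sin_gt_0; nra). lra.
Qed.

Section Laurent.
Variables (F : C -> C) (a T y0 v : R).
Hypothesis (HT : 0 < T) (Hv : y0 < v).
Hypothesis HF : forall z, y0 < Im z -> cdiff F z.
Hypothesis HP : forall z, y0 < Im z -> F (z + RtoC T)%C = F z.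

Let w : C := (a + T / 2, v).
(** [1 / (1 - Q z)] is the periodic substitute for the Cauchy kernel. Below the height [v] one has
    [Cmod (Q z) < 1] and above it [Cmod (Q z) > 1], so the kernel has a geometric expansion on
    either side. The zeros of [1 - Q] are the translates of [w] by multiples of [T]; as [w] is the
    midpoint of the period, the others stay off the closed strip. *)
Let Q (z : C) : C := e2pi (/ T) (w - z).

Lemma kernel_period z : Q (z + RtoC T)%C = Q z.
Proof.
  unfold Q. pose proof (e2pi_period T 1 (w - (z + RtoC T))%C ltac:(lra)) as E.
  unfold Rdiv in E. change (INR 1) with 1 in E. rewrite Rmult_1_l in E.
  rewrite <- E. f_equal. ring.
Qed.

Lemma kernel_mod z : Cmod (Q z) = exp (2 * PI / T * (Im z - v)).
Proof.
  unfold Q. rewrite Cmod_e2pi. f_equal. unfold w. destruct z as [x y]. simpl. field. lra.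
Qed.

(** The modulus forces [y = v]; then [Q] has phase [(a + T / 2 - x) / T], which lies in
    [[-1/2, 1/2]] and so can only be the integer 0. *)
Lemma kernel_neq1 x y : a <= x <= a + T -> (x, y) <> w -> Q (x, y) <> RtoC 1.
Proof.
  intros Hx Hne E.
  assert (Hy : y = v).
  { pose proof (f_equal Cmod E) as E1. rewrite kernel_mod, Cmod_1 in E1.
    rewrite <- exp_0 in E1. apply exp_inv in E1. simpl in E1.
    assert (0 < 2 * PI / T) by (apply Rdiv_lt_0_compat; auto; pose proof PI_RGT_0; lra).
    apply Rmult_integral in E1. destruct E1; lra. }
  subst y. apply Hne. unfold w. f_equal.
  assert (E2 : (a + T / 2 - x) / T = 0).
  { apply e2pi_eq_1.
    - set (u := a + T / 2 - x). assert (Hu : - (T / 2) <= u <= T / 2) by (unfold u; lra).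
      apply Rabs_le; split; apply Rmult_le_reg_r with T; auto;
        replace (u / T * T) with u by (field; lra); lra.
    - rewrite <- E. unfold Q. apply e2pi_eq.
      unfold w, Cminus, Cplus, Copp, Cmult, RtoC; simpl. f_equal; field; lra. }
  assert (a + T / 2 - x = 0).
  { replace (a + T / 2 - x) with ((a + T / 2 - x) / T * T) by (field; lra). rewrite E2; ring. }
  lra.
Qed.

Lemma kernel_deriv z : cderiv Q z (- (RtoC (2 * PI * / T) * Ci) * Q z).
Proof.
  assert (E : forall z, (e2pi (/ T) w * e2pi (- / T) z)%C = Q z).
  { intros u. unfold Q, Cminus. rewrite e2pi_addr. f_equal. apply e2pi_eq.
    rewrite RtoC_opp. ring. }
  apply cderiv_ext with (fun z => e2pi (/ T) w * e2pi (- / T) z)%C.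
  { exists 1; split; [lra|]; intros; apply E. }
  replace (- (RtoC (2 * PI * / T) * Ci) * Q z)%C
    with (0 * e2pi (- / T) z + e2pi (/ T) w * (RtoC (2 * PI * - / T) * Ci * e2pi (- / T) z))%C.
  - apply (cderiv_mult (fun _ => e2pi (/ T) w)); [apply cderiv_const|apply cderiv_e2pi].
  - rewrite <- E. replace (2 * PI * - / T) with (- (2 * PI * / T)) by ring. rewrite RtoC_opp. ring.
Qed.

Lemma kernel_slope_neq0 : (RtoC (2 * PI * / T) * Ci)%C <> RtoC 0.
Proof.
  apply Cmult_neq_0.
  - intros E. apply RtoC_inj in E. pose proof PI_RGT_0. pose proof (Rinv_0_lt_compat T HT). nra.
  - intros E. apply (f_equal Im) in E. simpl in E. lra.
Qed.

(** [F z - F w] and [1 - Q z] both carry the factor [z - w], so their quotient extends to [w] by the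
    ratio of the cofactors [s] and [- q]. At [w] continuity alone is asserted; the contour will
    cross this point by a limit and not by Goursat's lemma. *)
Lemma cauchy_kernel_quotient : exists H : C -> C,
  (forall x y, a <= x <= a + T -> y0 < y -> ccont H (x, y)) /\
  (forall x y, y0 < y -> y <> v -> cdiff H (x, y)) /\
  (forall x y, y0 < y -> y <> v -> H (x, y) = (F (x, y) - F w) / (1 - Q (x, y)))%C.
Proof.
  destruct (HF w Hv) as [l [s [Cs [Es Hs]]]].
  destruct (kernel_deriv w) as [q [Cq [Eq Hq]]].
  assert (Qw : Q w = RtoC 1).
  { unfold Q. replace (w - w)%C with (RtoC 0) by ring. apply e2pi_0r. }
  rewrite Qw, Cmult_1_r in Eq.
  set (H := fun z => if excluded_middle_informative (z = w) then (s w / - q w)%C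
                     else ((F z - F w) / (1 - Q z))%C).
  assert (Hne : forall z, z <> w -> H z = ((F z - F w) / (1 - Q z))%C).
  { intros z Hz. unfold H. destruct (excluded_middle_informative (z = w)); tauto. }
  assert (Hoff : forall z, z <> w -> Q z <> RtoC 1 -> y0 < Im z -> cdiff H z).
  { intros z Hz HQ Hy.
    apply cdiff_ext with (fun z => (F z - F w) * / (1 - Q z))%C.
    - assert (0 < Cmod (z - w)%C).
      { apply Cmod_gt_0. intros E. apply Hz. replace z with ((z - w) + w)%C by ring. rewrite E; ring. }
      exists (Cmod (z - w)%C); split; auto. intros u Hu. rewrite Hne; auto.
      intros ->. rewrite Cmod_sub_sym in Hu. lra.
    - destruct (HF z Hy) as [lz Hlz]. pose proof (kernel_deriv z) as Hk.
      eexists. apply (cderiv_mult (fun z => F z - F w)%C).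
      + apply (cderiv_plus F (fun _ => - F w)%C); [exact Hlz|apply cderiv_const].
      + apply (cderiv_inv (fun z => 1 - Q z)%C).
        * apply cderiv_ext with (fun z => 1 + (-1) * Q z)%C.
          { exists 1; split; [lra|]; intros. ring. }
          apply (cderiv_plus (fun _ => RtoC 1)); [apply cderiv_const|].
          apply (cderiv_mult (fun _ => (-1)%C)); [apply cderiv_const|exact Hk].
        * intros E. apply HQ. replace (Q z) with (1 - (1 - Q z))%C by ring. rewrite E; ring. }
  assert (Hline : forall x y, y <> v -> (x, y) <> w /\ Q (x, y) <> RtoC 1).
  { intros x y Hy; split.
    - intros E; apply Hy. now injection E.
    - intros E. apply (f_equal Cmod) in E. rewrite kernel_mod, Cmod_1 in E.
      rewrite <- exp_0 in E. apply exp_inv in E. simpl in E.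
      assert (0 < 2 * PI / T) by (apply Rdiv_lt_0_compat; auto; pose proof PI_RGT_0; lra).
      apply Rmult_integral in E. destruct E; lra. }
  exists H; repeat split.
  - intros x y Hx Hy. destruct (classic ((x, y) = w)) as [->|Hz].
    + assert (Hqw : (- q w)%C <> RtoC 0).
      { rewrite Eq. replace (- - (RtoC (2 * PI * / T) * Ci))%C with (RtoC (2 * PI * / T) * Ci)%C by ring.
        apply kernel_slope_neq0. }
      assert (Cq' : ccont (fun z => - q z)%C w) by now apply ccont_opp.
      apply ccont_ext with (fun z => s z * / - q z)%C.
      * generalize (near_and _ _ _ (near_and _ _ _ Hs Hq) (ccont_lower _ _ Cq' Hqw)).
        apply near_imp. intros z [[E1 E2] E3].
        unfold H. destruct (excluded_middle_informative (z = w)) as [->|Hzw]; [reflexivity|].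
        assert (Hn : (z - w)%C <> RtoC 0).
        { intros E; apply Hzw. replace z with ((z - w) + w)%C by ring. rewrite E; ring. }
        assert (Hqz : q z <> RtoC 0).
        { intros E. rewrite E, (Cmod_opp (RtoC 0)), Cmod_0 in E3. pose proof (Cmod_ge_0 (- q w)%C). lra. }
        rewrite E1, E2, Qw. field. repeat split; auto.
        replace (1 - (1 + (z - w) * q z))%C with (- ((z - w) * q z))%C by ring.
        intros E. apply (Cmult_neq_0 _ _ Hn Hqz).
        replace ((z - w) * q z)%C with (- - ((z - w) * q z))%C by ring. rewrite E; ring.
      * apply ccont_mult; auto. now apply ccont_inv.
    + apply cdiff_cont, Hoff; auto. now apply kernel_neq1.
  - intros x y Hy Hyv. destruct (Hline x y Hyv). now apply Hoff.
  - intros x y Hy Hyv. destruct (Hline x y Hyv). now apply Hne.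
Qed.

End Laurent.

Lemma Cmod_pow z n : Cmod (z ^ n)%C = Cmod z ^ n.
Proof. induction n as [|n IH]; simpl; [apply Cmod_1|]. now rewrite Cmod_mult, IH. Qed.

Lemma rcont_pow g x n : rcont g x -> rcont (fun t => g t ^ n)%C x.
Proof.
  intros H. induction n as [|n IH]; simpl; [apply rcont_const|]. now apply rcont_mult.
Qed.

Lemma CInt_mult_bound g h a b r : a <= b -> 0 <= r ->
  (forall x, a <= x <= b -> rcont g x) -> (forall x, a <= x <= b -> rcont h x) ->
  (forall x, a <= x <= b -> Cmod (h x) <= r) ->
  Cmod (CInt (fun x => g x * h x)%C a b) <= RInt (fun x => Cmod (g x)) a b * r.
Proof.
  intros Hab Hr Hg Hh Hb.
  assert (E : ex_RInt (fun x => Cmod (g x)) a b).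
  { apply (ex_RInt_continuous (V := R_CompleteNormedModule)).
    rewrite Rmin_left, Rmax_right by auto. intros; apply Cmod_continuous; auto. }
  rewrite Rmult_comm.
  assert (E2 : RInt (fun x => r * Cmod (g x)) a b = r * RInt (fun x => Cmod (g x)) a b)
    by exact (RInt_scal (V := R_CompleteNormedModule) _ _ _ r E).
  rewrite <- E2.
  apply CInt_norm; auto.
  - apply rcont_integrable; auto. intros; apply rcont_mult; auto.
  - now apply (ex_RInt_scal (V := R_NormedModule)).
  - intros x Hx. rewrite Cmod_mult, Rmult_comm. apply Rmult_le_compat_r; auto. apply Cmod_ge_0.
Qed.

Section LaurentRemainder.
Variables (F : C -> C) (a T y0 v y1 : R).
Hypothesis (HT : 0 < T) (Hy1 : y0 < y1) (Hv : y1 < v).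
Hypothesis HF : forall z, y0 < Im z -> cdiff F z.
Hypothesis HP : forall z, y0 < Im z -> F (z + RtoC T)%C = F z.
Hypothesis Hneg : forall n, (0 < n)%nat -> coef F a T (- (INR n / T)) (v + 1) = 0.

Let w : C := (a + T / 2, v).

(** The quotient [H] has the same integral over a period on the lines [y1] and [v + 1], below and
    above [w]. On the lower line the geometric expansion in [Q] yields the partial sum, from which
    the constant [F w] subtracts [T * F w] through its term of index 0, and a remainder. On the
    upper line the expansion in [/ Q] involves negative frequencies only, which vanish by [Hneg], so
    just a remainder is left. Both remainders decay geometrically. The sum has [S M] terms so that
    index 0 is always present. *)
Lemma laurent_remainder : exists B r, 0 <= r < 1 /\ forall M,
  Cmod (csum (fun n => e2pi (INR n / T) w * coef F a T (INR n / T) y1) (S M) - RtoC T * F w)%C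
  <= B * r ^ S M.
Proof.
  destruct (cauchy_kernel_quotient F a T y0 v HT ltac:(lra) HF) as [H [Hc [Hd He]]].
  set (Q := fun z => e2pi (/ T) (w - z)).
  change (forall x y, y0 < y -> y <> v -> H (x, y) = ((F (x, y) - F w) / (1 - Q (x, y)))%C) in He.
  assert (HQmod : forall z, Cmod (Q z) = exp (2 * PI / T * (Im z - v))) by (apply kernel_mod; auto).
  assert (HQper : forall z, Q (z + RtoC T)%C = Q z) by (apply kernel_period; auto).
  assert (HQne : forall x y, y <> v -> (1 - Q (x, y))%C <> RtoC 0).
  { intros x y Hy E.
    assert (E1 : Q (x, y) = RtoC 1).
    { replace (Q (x, y)) with (1 - (1 - Q (x, y)))%C by ring. rewrite E; ring. }
    apply (f_equal Cmod) in E1. rewrite HQmod, Cmod_1, <- exp_0 in E1. apply exp_inv in E1.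
    simpl in E1.
    assert (0 < 2 * PI / T) by (apply Rdiv_lt_0_compat; auto; pose proof PI_RGT_0; lra).
    apply Rmult_integral in E1. destruct E1; lra. }
  assert (HQ0 : forall z, Q z <> RtoC 0) by (intros; apply e2pi_neq0).
  assert (HQc : forall x y, rcont (fun t => Q (t, y)) x).
  { intros x y. apply (rcont_hor Q). apply cdiff_cont. eexists. apply kernel_deriv. }
  assert (Hint : forall y, y0 < y -> Cintegrable (fun x => H (x, y)) a (a + T)).
  { intros y Hy. apply rcont_integrable; [lra|]. intros; apply rcont_hor; auto. }
  assert (Hper : forall y, y0 < y -> y <> v -> H (a + T, y) = H (a, y)).
  { intros y Hy Hne. rewrite !He by auto. rewrite <- pair_add_R, HP, HQper by auto. reflexivity. }
  (* Goursat's lemma brings the contour arbitrarily close to the line through [w], and continuity of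
     the integral does the rest. *)
  assert (Hshift : forall y, y0 < y -> y <> v ->
    CInt (fun x => H (x, y)) a (a + T) = CInt (fun x => H (x, v)) a (a + T)).
  { intros y Hy Hne.
    assert (K : forall e, 0 < e ->
      Cmod (CInt (fun x => H (x, y)) a (a + T) - CInt (fun x => H (x, v)) a (a + T))%C <= e).
    { intros e E.
      destruct (contour_continuous H a T v e HT E) as [d [Hd0 K]].
      { intros x Hx; apply Hc; auto; lra. }
      destruct (Rlt_le_dec y v) as [L|L].
      - set (y' := Rmax y (v - d / 2)).
        assert (y <= y' < v /\ v - d / 2 <= y').
        { split; [split; [apply Rmax_l|apply Rmax_lub_lt; lra]|apply Rmax_r]. }
        rewrite (periodic_contour_shift H a T y y').
        + apply K; [apply Rabs_def1; lra|]. apply Hint; lra.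
        + auto.
        + lra.
        + intros; apply Hd; lra.
        + intros; apply Hper; lra.
      - set (y' := Rmin y (v + d / 2)).
        assert (v < y' <= y /\ y' <= v + d / 2).
        { split; [split; [apply Rmin_glb_lt; lra|apply Rmin_l]|apply Rmin_r]. }
        rewrite <- (periodic_contour_shift H a T y' y).
        + apply K; [apply Rabs_def1; lra|]. apply Hint; lra.
        + auto.
        + lra.
        + intros; apply Hd; lra.
        + intros; apply Hper; lra. }
    set (X := (CInt (fun x => H (x, y)) a (a + T) - CInt (fun x => H (x, v)) a (a + T))%C) in *.
    assert (X = 0).
    { apply Cmod_eq_0. apply Rle_antisym; [|apply Cmod_ge_0].
      apply Rnot_lt_le; intros N. specialize (K (Cmod X / 2) ltac:(lra)). lra. }
    replace (CInt (fun x => H (x, y)) a (a + T)) with (X + CInt (fun x => H (x, v)) a (a + T))%C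
      by (unfold X; ring). rewrite H0. ring. }
  assert (HQpow : forall k z, (Q z ^ k)%C = (e2pi (INR k / T) w * e2pi (- (INR k / T)) z)%C).
  { intros k z. unfold Q. rewrite e2pi_pow. change (INR k * / T) with (INR k / T).
    unfold Cminus. rewrite e2pi_addr. f_equal. apply e2pi_eq. rewrite RtoC_opp; ring. }
  assert (Fc : forall x y, y0 < y -> rcont (fun t => F (t, y)) x).
  { intros x y Hy. apply rcont_hor, cdiff_cont, HF. exact Hy. }
  set (N := fun (l y : R) (x : R) => ((F (x, y) - F w) * e2pi (- l) (x, y))%C).
  assert (HN : forall l y, y0 < y -> Cintegrable (N l y) a (a + T)).
  { intros l y Hy. apply rcont_integrable; [lra|]. intros x _. unfold N.
    apply rcont_mult; [|apply rcont_e2pi].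
    apply (rcont_hor (fun z => F z - F w)%C).
    apply ccont_minus; [apply cdiff_cont, HF; exact Hy|apply ccont_const]. }
  assert (HNc : forall l y, y0 < y -> CInt (N l y) a (a + T)
     = (coef F a T l y - F w * CInt (fun x => e2pi (- l) (x, y)) a (a + T))%C).
  { intros l y Hy. unfold coef.
    rewrite <- CInt_scal by (apply rcont_integrable; [lra|intros; apply rcont_e2pi]).
    rewrite <- CInt_minus.
    - apply CInt_ext; [lra|]. intros x _. unfold N. ring.
    - apply rcont_integrable; [lra|]. intros; apply rcont_mult; auto using rcont_e2pi.
    - apply Cintegrable_scal, rcont_integrable; [lra|intros; apply rcont_e2pi]. }
  set (r1 := exp (2 * PI / T * (y1 - v))). set (r2 := exp (- (2 * PI / T))).
  assert (P2 : 0 < 2 * PI / T) by (apply Rdiv_lt_0_compat; auto; pose proof PI_RGT_0; lra).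
  assert (R1 : 0 < r1 < 1).
  { split; [apply exp_pos|]. rewrite <- exp_0. apply exp_increasing. nra. }
  assert (R2 : 0 < r2 < 1).
  { split; [apply exp_pos|]. rewrite <- exp_0. apply exp_increasing. lra. }
  set (B1 := RInt (fun x => Cmod (H (x, y1))) a (a + T)).
  set (B2 := RInt (fun x => Cmod (H (x, v + 1))) a (a + T)).
  assert (HB1 : forall n, Cmod (CInt (fun x => H (x, y1) * Q (x, y1) ^ n)%C a (a + T)) <= B1 * r1 ^ n).
  { intros n. apply (CInt_mult_bound (fun x => H (x, y1)) (fun x => Q (x, y1) ^ n)%C).
    - lra.
    - apply pow_le; lra.
    - intros; apply rcont_hor, Hc; auto.
    - intros; apply rcont_pow, HQc.
    - intros x _. rewrite Cmod_pow, HQmod. simpl Im. right; reflexivity. }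
  assert (HB2 : forall n, Cmod (CInt (fun x => H (x, v + 1)%R * / Q (x, v + 1)%R ^ n)%C a (a + T))
     <= B2 * r2 ^ n).
  { intros n. apply (CInt_mult_bound (fun x => H (x, v + 1)) (fun x => / Q (x, v + 1)%R ^ n)%C).
    - lra.
    - apply pow_le; lra.
    - intros; apply rcont_hor, Hc; auto. lra.
    - intros x _.
      apply rcont_hor with (g := fun z => (/ Q z ^ n)%C). apply ccont_inv; [|now apply Cpow_nz].
      clear -HT. induction n as [|n IH]; simpl; [apply ccont_const|].
      apply ccont_mult; auto. apply cdiff_cont. eexists. apply kernel_deriv; auto.
    - intros x _. rewrite Cmod_inv by now apply Cpow_nz. rewrite Cmod_pow, HQmod. simpl Im.
      rewrite <- pow_inv, <- exp_Ropp. right. unfold r2. do 2 f_equal. ring. }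
  (* Expansion [1 / (1 - Q) = sum_(k < M) Q^k + Q^M / (1 - Q)], used where [Cmod Q < 1]. *)
  assert (I1 : forall M, CInt (fun x => H (x, y1)) a (a + T) =
    (CInt (fun x => H (x, y1) * Q (x, y1) ^ M) a (a + T)
     + csum (fun k => e2pi (INR k / T) w * CInt (N (INR k / T)%R y1) a (a + T)) M)%C).
  { intros M.
    rewrite (CInt_ext _ (fun x => H (x, y1) * Q (x, y1) ^ M
      + csum (fun k => e2pi (INR k / T) w * N (INR k / T)%R y1 x) M)%C); [|lra|].
    - rewrite CInt_plus.
      + f_equal. rewrite CInt_csum by (intros; apply Cintegrable_scal, HN; auto).
        apply csum_ext. intros k _. apply CInt_scal. apply HN; auto.
      + apply rcont_integrable; [lra|]. intros x Hx.
        apply rcont_mult; [apply rcont_hor, Hc; auto|apply rcont_pow, HQc].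
      + apply (Cintegrable_csum (fun k x => (e2pi (INR k / T) w * N (INR k / T)%R y1 x)%C)).
        intros; apply Cintegrable_scal, HN; auto.
    - intros x _. rewrite He by lra.
      rewrite (csum_ext _ (fun k => (F (x, y1) - F w) * Q (x, y1) ^ k)%C).
      2:{ intros k _. rewrite HQpow. unfold N. ring. }
      rewrite csum_scal.
      pose proof (csum_geom (Q (x, y1)) M) as G.
      replace (Q (x, y1) ^ M)%C
        with (1 - csum (Cpow (Q (x, y1))) M * (1 - Q (x, y1)))%C by (rewrite G; ring).
      field. apply HQne. lra. }
  (* Expansion [1 / (1 - Q) = - sum_(k < M) Q^(-k-1) + Q^(-M) / (1 - Q)]. Each term of the sum
     integrates to 0: the part with [F] by [Hneg], the part with the constant [F w] by
     periodicity. *)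
  assert (I2 : forall M, CInt (fun x => H (x, v + 1)%R) a (a + T) =
    (CInt (fun x => H (x, v + 1)%R * / Q (x, v + 1)%R ^ M) a (a + T))%C).
  { intros M.
    rewrite (CInt_ext _ (fun x => H (x, v + 1)%R * / Q (x, v + 1)%R ^ M
      + csum (fun k => - e2pi (- (INR (S k) / T))%R w * N (- (INR (S k) / T))%R (v + 1)%R x) M)%C); [|lra|].
    - rewrite CInt_plus.
      + rewrite CInt_csum by (intros; apply Cintegrable_scal, HN; lra).
        rewrite csum_zero; [ring|]. intros k _. rewrite CInt_scal by (apply HN; lra).
        rewrite HNc by lra. rewrite Hneg by lia. rewrite Ropp_involutive, CInt_e2pi_period by (auto; lia).
        ring.
      + apply rcont_integrable; [lra|]. intros x Hx.
        apply rcont_mult; [apply rcont_hor, Hc; auto; lra|].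
        apply rcont_hor with (g := fun z => (/ Q z ^ M)%C). apply ccont_inv; [|now apply Cpow_nz].
        clear -HT. induction M as [|n IH]; simpl; [apply ccont_const|].
        apply ccont_mult; auto. apply cdiff_cont. eexists. apply kernel_deriv; auto.
      + apply (Cintegrable_csum
          (fun k x => (- e2pi (- (INR (S k) / T))%R w * N (- (INR (S k) / T))%R (v + 1)%R x)%C)).
        intros; apply Cintegrable_scal, HN; lra.
    - intros x _. rewrite He by lra.
      set (z := (x, v + 1) : C).
      rewrite (csum_ext _ (fun k => (- ((F z - F w) * / Q z)) * (/ Q z) ^ k)%C).
      2:{ intros k _. unfold N. fold z.
          assert (E : (/ Q z * (/ Q z) ^ k)%C = (e2pi (- (INR (S k) / T)) w * e2pi (- - (INR (S k) / T)) z)%C).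
          { change (/ Q z * (/ Q z) ^ k)%C with ((/ Q z) ^ S k)%C.
            rewrite Cpow_inv by auto. rewrite HQpow, !e2pi_oppl. field.
            split; apply e2pi_neq0. }
          transitivity (- ((F z - F w) * (e2pi (- (INR (S k) / T)) w * e2pi (- - (INR (S k) / T)) z)))%C; [ring|].
          rewrite <- E. ring. }
      rewrite csum_scal.
      pose proof (csum_geom (/ Q z)%C M) as G. rewrite Cpow_inv in G by auto.
      replace (/ Q z ^ M)%C
        with (1 - csum (Cpow (/ Q z)) M * (1 - / Q z))%C by (rewrite G; ring).
      assert ((1 - Q z)%C <> RtoC 0) by (apply HQne; lra).
      field. auto. }
  exists (Rabs B1 + Rabs B2), (Rmax r1 r2). split.
  { split; [apply Rle_trans with r1; [lra|apply Rmax_l]|apply Rmax_lub_lt; lra]. }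
  intros M.
  (* Against the constant [F w], the exponentials integrate to [T] at index 0 and to 0 at all later
     indices. *)
  assert (ES : csum (fun k => e2pi (INR k / T) w * CInt (N (INR k / T)%R y1) a (a + T))%C (S M)
    = (csum (fun n => e2pi (INR n / T) w * coef F a T (INR n / T) y1) (S M) - RtoC T * F w)%C).
  { clear -HNc Hy1 HT. induction M as [|M IH].
    - simpl. rewrite HNc by auto.
      rewrite (CInt_ext (fun x => e2pi (- (0 / T)) (x, y1)) (fun _ => RtoC 1)); [|lra|].
      + rewrite CInt_const. replace (a + T - a) with T by ring.
        replace (0 / T) with 0 by (unfold Rdiv; ring). rewrite e2pi_0l. ring.
      + intros x _. replace (- (0 / T)) with 0 by (unfold Rdiv; ring). apply e2pi_0l.
    - cbn [csum] in *. rewrite IH. rewrite (HNc (INR (S M) / T)) by auto.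
      rewrite CInt_e2pi_neg_period by (auto; lia). ring. }
  rewrite <- ES.
  pose proof (I1 (S M)) as J1. rewrite Hshift, <- (Hshift (v + 1)) in J1 by lra. rewrite (I2 (S M)) in J1.
  set (S1 := csum _ _) in *.
  set (U1 := CInt (fun x => H (x, y1) * Q (x, y1) ^ S M)%C a (a + T)) in *.
  set (U2 := CInt (fun x => H (x, v + 1)%R * / Q (x, v + 1)%R ^ S M)%C a (a + T)) in *.
  replace S1 with (U2 - U1)%C by (rewrite J1; ring).
  apply Rle_trans with (Cmod U2 + Cmod U1).
  { unfold Cminus. rewrite <- (Cmod_opp U1). apply Cmod_triangle. }
  pose proof (HB1 (S M)) as K1. pose proof (HB2 (S M)) as K2. fold U1 in K1. fold U2 in K2.
  assert (L1 : r1 ^ S M <= Rmax r1 r2 ^ S M) by (apply pow_incr; split; [lra|apply Rmax_l]).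
  assert (L2 : r2 ^ S M <= Rmax r1 r2 ^ S M) by (apply pow_incr; split; [lra|apply Rmax_r]).
  assert (0 <= r1 ^ S M) by (apply pow_le; lra). assert (0 <= r2 ^ S M) by (apply pow_le; lra).
  rewrite Rmult_plus_distr_r, Rplus_comm. apply Rplus_le_compat.
  - eapply Rle_trans; [exact K1|]. apply Rle_trans with (Rabs B1 * r1 ^ S M).
    + apply Rmult_le_compat_r; auto. apply Rle_abs.
    + apply Rmult_le_compat_l; auto. apply Rabs_pos.
  - eapply Rle_trans; [exact K2|]. apply Rle_trans with (Rabs B2 * r2 ^ S M).
    + apply Rmult_le_compat_r; auto. apply Rle_abs.
    + apply Rmult_le_compat_l; auto. apply Rabs_pos.
Qed.

End LaurentRemainder.

(** * Parseval's identity and the growth of sparse series *)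

Fixpoint rsum (f : nat -> R) (n : nat) : R :=
  match n with O => 0 | S n => rsum f n + f n end.

(** Abel summation, arranged as an induction: [G] compares the weighted sum with [e] times the
    geometric sum and keeps the boundary term, whose coefficient [rsum s n - e * INR n - K] is
    nonpositive, so that passing from [x ^ n] to the smaller [x ^ S n] only enlarges the right
    side. *)
Lemma weighted_sum_bound (s : nat -> R) e K x : 0 < e -> 0 < x < 1 ->
  (forall n, rsum s n <= e * INR n + K) ->
  forall n, rsum (fun k => s k * x ^ k) n <= K + e / (1 - x).
Proof.
  intros He Hx H n.
  assert (G : rsum (fun k => s k * x ^ k) n - e * (1 - x ^ n) / (1 - x)
     <= K + (rsum s n - e * INR n - K) * x ^ n).
  { induction n as [|n IH].
    - simpl. unfold Rdiv. rewrite Rminus_diag, Rmult_0_r, Rmult_0_l. lra.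
    - cbn [rsum].
      assert (0 < x ^ n) by (apply pow_lt; lra).
      apply Rle_trans with (K + (rsum s (S n) - e * INR (S n) - K) * x ^ n).
      + cbn [rsum]. rewrite S_INR.
        replace (e * (1 - x ^ S n) / (1 - x)) with (e * (1 - x ^ n) / (1 - x) + e * x ^ n)
          by (simpl; field; lra). lra.
      + apply Rplus_le_compat_l. specialize (H (S n)).
        assert (x ^ S n <= x ^ n) by (simpl; nra).
        cbn [rsum] in *. nra. }
  specialize (H n). assert (0 < x ^ n) by (apply pow_lt; lra).
  assert (e * (1 - x ^ n) / (1 - x) <= e / (1 - x)).
  { unfold Rdiv. apply Rmult_le_compat_r; [left; apply Rinv_0_lt_compat; lra|]. nra. }
  nra.
Qed.

Lemma exp_pow_INR x n : exp x ^ n = exp (INR n * x).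
Proof.
  induction n as [|n IH].
  - simpl. now rewrite Rmult_0_l, exp_0.
  - rewrite S_INR. simpl. rewrite IH, <- exp_plus. f_equal; ring.
Qed.

Lemma Re_CInt g a b : Cintegrable g a b -> RInt (fun x => Re (g x)) a b = Re (CInt g a b).
Proof.
  intros H. apply is_RInt_unique.
  exact (is_RInt_fct_extend_fst (U := R_NormedModule) (V := R_NormedModule) _ _ _ _ (is_CInt _ _ _ H)).
Qed.

Lemma ex_RInt_Re g a b : Cintegrable g a b -> ex_RInt (fun x => Re (g x)) a b.
Proof.
  intros H. eexists.
  exact (is_RInt_fct_extend_fst (U := R_NormedModule) (V := R_NormedModule) _ _ _ _ (is_CInt _ _ _ H)).
Qed.

Lemma ex_RInt_sqr g a b : a <= b -> (forall x, a <= x <= b -> rcont g x) ->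
  ex_RInt (fun x => Cmod (g x) ^ 2) a b.
Proof.
  intros Hab Hg. apply (ex_RInt_continuous (V := R_CompleteNormedModule)).
  rewrite Rmin_left, Rmax_right by auto. intros x Hx.
  apply (continuous_ext (fun x => mult (Cmod (g x)) (Cmod (g x)))).
  - intros y. unfold mult; simpl. ring.
  - apply (continuous_mult (K := R_AbsRing)); now apply Cmod_continuous, Hg.
Qed.

Lemma Cmod_sqr_plus u v : Cmod (u + v)%C ^ 2 = Cmod u ^ 2 + (Cmod v ^ 2 + 2 * Re (u * Cconj v)%C).
Proof.
  unfold Cmod. rewrite !pow2_sqrt by nra.
  destruct u, v; unfold Re, Cconj, Cmult, Cplus; simpl. ring.
Qed.

Lemma conj_e2pi l x y : Cconj (e2pi (- l) (x, y)) = (RtoC (exp (4 * PI * l * y)) * e2pi l (x, y))%C.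
Proof.
  rewrite !e2pi_rect. unfold Cconj, RtoC, Cmult; simpl.
  replace (2 * PI * - l * x) with (- (2 * PI * l * x)) by ring.
  rewrite cos_neg, sin_neg.
  replace (- (2 * PI * - l * y)) with (4 * PI * l * y + - (2 * PI * l * y)) by ring.
  rewrite exp_plus. f_equal; ring.
Qed.

(** Parseval's identity for the truncated kernel restricted to the support: the new term is
    orthogonal to the earlier ones. Since [s n] is 0 or 1, its square is itself, and the diagonal
    terms are the powers of [exp (- (4 * PI / T * (Im w - y)))]. *)
Lemma kernel_square_integral (T a y : R) (w : C) (s : nat -> R) (M : nat) : 0 < T ->
  (forall n, s n = 0 \/ s n = 1) ->
  RInt (fun x => Cmod (csum (fun n => RtoC (s n) * e2pi (INR n / T) w * e2pi (- (INR n / T)) (x, y)) M)%C ^ 2)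
    a (a + T)
  = T * rsum (fun n => s n * exp (- (4 * PI / T * (Im w - y))) ^ n) M.
Proof.
  intros HT Hs.
  set (g := fun n x => (RtoC (s n) * e2pi (INR n / T) w * e2pi (- (INR n / T)) (x, y))%C).
  change (RInt (fun x => Cmod (csum (fun n => g n x) M) ^ 2) a (a + T)
    = T * rsum (fun n => s n * exp (- (4 * PI / T * (Im w - y))) ^ n) M).
  assert (Hg : forall n x, rcont (g n) x).
  { intros n x. apply (rcont_mult (fun _ => (RtoC (s n) * e2pi (INR n / T) w)%C));
      [apply rcont_const|apply rcont_e2pi]. }
  assert (HK : forall M x, rcont (fun x => csum (fun n => g n x) M) x).
  { clear M. intros M x. apply (rcont_hor (fun z => csum (fun n => g n (Re z)) M) x 0).
    induction M as [|M IH]; simpl; [apply ccont_const|]. apply ccont_plus; auto.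
    unfold g. intros e He. destruct (proj1 (rcont_eps _ _) (Hg M x) e He) as [d [Hd H]].
    exists d; split; auto. intros u Hu. apply H. eapply Rle_lt_trans; [|exact Hu].
    apply (Rabs_Re_le (u - (x, 0))%C). }
  induction M as [|M IH].
  - simpl. rewrite (RInt_ext _ (fun _ => 0)).
    + rewrite RInt_const. unfold scal; simpl; unfold mult; simpl. ring.
    + intros x _. rewrite Cmod_0. apply Rmult_0_l.
  - cbn [csum rsum].
    set (q := s M * exp (- (4 * PI / T * (Im w - y))) ^ M).
    rewrite (RInt_ext _ (fun x => Cmod (csum (fun n => g n x) M) ^ 2
       + (q + 2 * Re (csum (fun n => g n x) M * Cconj (g M x))%C))).
    2:{ intros x _. rewrite Cmod_sqr_plus. unfold q.
        match goal with |- ?l = ?r => change (@eq R l r) end.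
        f_equal. f_equal. unfold g. rewrite !Cmod_mult, Cmod_R, !Cmod_e2pi. simpl Im.
        transitivity (s M * (exp (- (2 * PI * (INR M / T) * Im w)) * exp (- (2 * PI * - (INR M / T) * y))) ^ 2).
        - rewrite !Rpow_mult_distr. destruct (Hs M) as [-> | ->]; [rewrite Rabs_R0|rewrite Rabs_R1]; ring.
        - f_equal. rewrite <- !exp_plus, !exp_pow_INR. f_equal. simpl (INR 2).
          field. lra. }
    assert (E0 : ex_RInt (fun x => Cmod (csum (fun n => g n x) M) ^ 2) a (a + T))
      by (apply ex_RInt_sqr; [lra|intros; apply HK]).
    (* Conjugation reverses the sign of the frequency up to a constant depending on [y], so every
       cross term has the frequency [(M - n) / T > 0] and integrates to 0. *)
    assert (EC : forall x, (csum (fun n => g n x) M * Cconj (g M x))%C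
      = csum (fun n => (Cconj (RtoC (s M) * e2pi (INR M / T) w) * RtoC (exp (4 * PI * (INR M / T) * y))
          * (RtoC (s n) * e2pi (INR n / T) w)) * e2pi (INR (M - n) / T) (x, y))%C M).
    { intros x. unfold g at 2. rewrite Cmult_conj, conj_e2pi, Cmult_comm, <- csum_scal.
      apply csum_ext. intros k Hk. unfold g.
      rewrite minus_INR by lia.
      replace ((INR M - INR k) / T) with (INR M / T + - (INR k / T)) by (unfold Rdiv; ring).
      rewrite e2pi_addl. ring. }
    set (c := fun n => (Cconj (RtoC (s M) * e2pi (INR M / T) w) * RtoC (exp (4 * PI * (INR M / T) * y))
          * (RtoC (s n) * e2pi (INR n / T) w))%C) in EC.
    assert (EI : forall n, Cintegrable (fun x => c n * e2pi (INR (M - n) / T) (x, y))%C a (a + T)).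
    { intros n. apply Cintegrable_scal, rcont_integrable; [lra|intros; apply rcont_e2pi]. }
    assert (E1 : Cintegrable (fun x => csum (fun n => g n x) M * Cconj (g M x))%C a (a + T)).
    { apply (ex_RInt_ext (V := C_R_NormedModule) (fun x => csum (fun n => c n * e2pi (INR (M - n) / T) (x, y))%C M)).
      - intros x _. symmetry. apply EC.
      - apply (Cintegrable_csum (fun n x => c n * e2pi (INR (M - n) / T) (x, y))%C); exact EI. }
    assert (E2 : CInt (fun x => csum (fun n => g n x) M * Cconj (g M x))%C a (a + T) = 0).
    { rewrite (CInt_ext _ (fun x => csum (fun n => c n * e2pi (INR (M - n) / T) (x, y))%C M));
        [|lra|intros; apply EC].
      rewrite (CInt_csum (fun n x => c n * e2pi (INR (M - n) / T) (x, y))%C) by exact EI.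
      apply csum_zero. intros k Hk.
      rewrite CInt_scal by (apply rcont_integrable; [lra|intros; apply rcont_e2pi]).
      rewrite CInt_e2pi_period by (auto; lia). ring. }
    assert (E3 : ex_RInt (fun x => Re (csum (fun n => g n x) M * Cconj (g M x))%C) a (a + T))
      by now apply ex_RInt_Re.
    assert (E4 : ex_RInt (fun x => 2 * Re (csum (fun n => g n x) M * Cconj (g M x))%C) a (a + T))
      by now apply (ex_RInt_scal (V := R_NormedModule)).
    assert (E5 : ex_RInt (fun _ => q) a (a + T)) by apply ex_RInt_const.
    etransitivity.
    { apply (RInt_plus (V := R_CompleteNormedModule)); [exact E0|].
      exact (ex_RInt_plus (V := R_NormedModule) _ _ _ _ E5 E4). }
    rewrite IH.
    transitivity (T * rsum (fun n => s n * exp (- (4 * PI / T * (Im w - y))) ^ n) M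
      + ((a + T - a) * q + 2 * Re (CInt (fun x => csum (fun n => g n x) M * Cconj (g M x))%C a (a + T)))).
    2:{ rewrite E2. simpl. ring. }
    apply (f_equal (Rplus _)).
    etransitivity; [exact (RInt_plus (V := R_CompleteNormedModule) _ _ _ _ E5 E4)|].
    apply (f_equal2 Rplus); [exact (RInt_const (V := R_CompleteNormedModule) _ _ q)|].
    etransitivity; [exact (RInt_scal (V := R_CompleteNormedModule) _ _ _ 2 E3)|].
    apply (f_equal (Rmult 2)). now apply Re_CInt.
Qed.

Section Growth.
Variables (F : C -> C) (a T y0 : R) (s : nat -> R).
Hypothesis (HT : 0 < T).
Hypothesis HF : forall z, y0 < Im z -> cdiff F z.
Hypothesis HP : forall z, y0 < Im z -> F (z + RtoC T)%C = F z.
Hypothesis Hneg : forall n y, (0 < n)%nat -> y0 < y -> coef F a T (- (INR n / T)) y = 0.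
Hypothesis Hs : forall n, s n = 0 \/ s n = 1.
Hypothesis Hsupp : forall n y, y0 < y -> s n = 0 -> coef F a T (INR n / T) y = 0.

(** The point sits at height [y0 + 2 t] and the contour at [y0 + t], so the kernel decays at the
    rate given by their gap [t]. Integrating [p q <= (g p^2 + q^2 / g) / 2], with [p] and [q] the
    moduli of [F] and of the kernel, bounds every partial sum of Cauchy's formula by the same
    quantity; the remainder then tends to 0. *)
Lemma value_bound t g X A : 0 < t -> 0 < g ->
  RInt (fun x => Cmod (F (x, y0 + t)) ^ 2) a (a + T) <= A ->
  (forall M, rsum (fun n => s n * exp (- (4 * PI / T * t)) ^ n) M <= X) ->
  T * Cmod (F (a + T / 2, y0 + 2 * t)) <= / 2 * (g * A + T * X / g).
Proof.
  intros Ht Hg HA HX.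
  set (v := y0 + 2 * t). set (y1 := y0 + t). set (w := (a + T / 2, v) : C).
  destruct (laurent_remainder F a T y0 v y1 HT ltac:(unfold y1; lra) ltac:(unfold y1, v; lra) HF HP
    ltac:(intros; apply Hneg; auto; unfold v; lra)) as [B [r [Hr HB]]].
  fold w in HB.
  set (E := / 2 * (g * A + T * X / g)).
  assert (KM : forall M, Cmod (csum (fun n => e2pi (INR n / T) w * coef F a T (INR n / T) y1) M)%C <= E).
  { intros M.
    (* Terms with [s n = 0] contribute nothing by [Hsupp] and are deleted from the kernel. This
       deletion is where sparsity enters, since the square integral of the full kernel would run
       over all [n]. *)
    set (K := fun x => csum (fun n => RtoC (s n) * e2pi (INR n / T) w * e2pi (- (INR n / T)) (x, y1))%C M).
    assert (Fc : forall x, rcont (fun x => F (x, y1)) x).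
    { intros x. apply rcont_hor, cdiff_cont, HF. simpl. unfold y1; lra. }
    assert (gc : forall n x, ccont (fun z => RtoC (s n) * e2pi (INR n / T) w * e2pi (- (INR n / T)) z)%C (x, y1)).
    { intros n x. apply ccont_mult; [apply ccont_const|]. apply cdiff_cont, cdiff_e2pi. }
    assert (Kc : forall x, rcont K x).
    { intros x. apply (rcont_hor (fun z => csum (fun n => RtoC (s n) * e2pi (INR n / T) w * e2pi (- (INR n / T)) z)%C M)).
      clear -gc. induction M as [|M IH]; simpl; [apply ccont_const|]. apply ccont_plus; auto. }
    assert (gi : forall n, Cintegrable
      (fun x => RtoC (s n) * e2pi (INR n / T) w * (F (x, y1) * e2pi (- (INR n / T)) (x, y1)))%C a (a + T)).
    { intros n. apply Cintegrable_scal, rcont_integrable; [lra|].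
      intros; apply rcont_mult; auto using rcont_e2pi. }
    replace (csum (fun n => e2pi (INR n / T) w * coef F a T (INR n / T) y1)%C M)
      with (CInt (fun x => F (x, y1) * K x)%C a (a + T)).
    2:{ rewrite (CInt_ext _ (fun x => csum (fun n =>
          RtoC (s n) * e2pi (INR n / T) w * (F (x, y1) * e2pi (- (INR n / T)) (x, y1)))%C M)); [|lra|].
        - rewrite (CInt_csum (fun n x =>
            RtoC (s n) * e2pi (INR n / T) w * (F (x, y1) * e2pi (- (INR n / T)) (x, y1)))%C) by exact gi.
          apply csum_ext. intros k _.
          rewrite CInt_scal by (apply rcont_integrable; [lra|intros; apply rcont_mult; auto using rcont_e2pi]).
          change (CInt _ _ _) with (coef F a T (INR k / T) y1).
          destruct (Hs k) as [Z|Z].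
          + rewrite (Hsupp k y1) by (auto; unfold y1; lra). ring.
          + rewrite Z. ring.
        - intros x _. unfold K. rewrite <- csum_scal. apply csum_ext. intros; ring. }
    set (h := fun x => / 2 * (g * Cmod (F (x, y1)) ^ 2 + / g * Cmod (K x) ^ 2)).
    assert (e1 : ex_RInt (fun x => Cmod (F (x, y1)) ^ 2) a (a + T)) by (apply ex_RInt_sqr; auto; lra).
    assert (e2 : ex_RInt (fun x => Cmod (K x) ^ 2) a (a + T)) by (apply ex_RInt_sqr; auto; lra).
    assert (e3 : ex_RInt (fun x => g * Cmod (F (x, y1)) ^ 2) a (a + T))
      by now apply (ex_RInt_scal (V := R_NormedModule)).
    assert (e4 : ex_RInt (fun x => / g * Cmod (K x) ^ 2) a (a + T))
      by now apply (ex_RInt_scal (V := R_NormedModule)).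
    assert (e5 : ex_RInt (fun x => g * Cmod (F (x, y1)) ^ 2 + / g * Cmod (K x) ^ 2) a (a + T))
      by now apply (ex_RInt_plus (V := R_NormedModule)).
    assert (e6 : RInt h a (a + T) = / 2 * (g * RInt (fun x => Cmod (F (x, y1)) ^ 2) a (a + T)
       + / g * RInt (fun x => Cmod (K x) ^ 2) a (a + T))).
    { transitivity (/ 2 * RInt (fun x => g * Cmod (F (x, y1)) ^ 2 + / g * Cmod (K x) ^ 2) a (a + T)).
      { exact (RInt_scal (V := R_CompleteNormedModule) _ _ _ (/ 2) e5). }
      f_equal.
      transitivity (RInt (fun x => g * Cmod (F (x, y1)) ^ 2) a (a + T)
        + RInt (fun x => / g * Cmod (K x) ^ 2) a (a + T)).
      { exact (RInt_plus (V := R_CompleteNormedModule) _ _ _ _ e3 e4). }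
      f_equal.
      - exact (RInt_scal (V := R_CompleteNormedModule) _ _ _ g e1).
      - exact (RInt_scal (V := R_CompleteNormedModule) _ _ _ (/ g) e2). }
    apply Rle_trans with (RInt h a (a + T)).
    - apply CInt_norm; [lra| | |].
      + apply rcont_integrable; [lra|]. intros; apply rcont_mult; auto.
      + now apply (ex_RInt_scal (V := R_NormedModule)).
      + intros x _. unfold h. rewrite Cmod_mult.
        set (p := Cmod (F (x, y1))). set (q := Cmod (K x)).
        assert (0 <= (g * p - q) ^ 2 * / g).
        { apply Rmult_le_pos; [apply pow2_ge_0|]. left; now apply Rinv_0_lt_compat. }
        replace ((g * p - q) ^ 2 * / g) with (g * p ^ 2 + / g * q ^ 2 - 2 * (p * q)) in H by (field; lra).
        lra.
    - rewrite e6. unfold E. apply Rmult_le_compat_l; [lra|].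
      apply Rplus_le_compat.
      + apply Rmult_le_compat_l; [lra|]. exact HA.
      + unfold K. rewrite kernel_square_integral by auto.
        replace (Im w - y1) with t by (unfold w, v, y1; simpl; ring).
        unfold Rdiv. rewrite (Rmult_comm (T * X)). apply Rmult_le_compat_l.
        * left; now apply Rinv_0_lt_compat.
        * apply Rmult_le_compat_l; [lra|]. apply HX. }
  apply Rnot_lt_le. intros N. change (a + T / 2, y0 + 2 * t) with w in N.
  (* The supposed excess [D] is fixed, while the remainder [B * r ^ S n] falls below it. *)
  set (D := T * Cmod (F w) - E). assert (HD : 0 < D) by (unfold D; lra).
  destruct (pow_lt_1_zero r) with (y := D / (Rabs B + 1)) as [n Hn].
  - rewrite Rabs_pos_eq; lra.
  - apply Rdiv_lt_0_compat; auto. pose proof (Rabs_pos B); lra.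
  - specialize (Hn (S n) ltac:(lia)). specialize (HB n). specialize (KM (S n)).
    assert (0 <= r ^ S n) by (apply pow_le; lra).
    rewrite Rabs_pos_eq in Hn by auto.
    set (Z := csum _ (S n)) in *.
    pose proof (Cmod_triangle (Z) (- (Z - RtoC T * F w)))%C as Tr.
    rewrite Cmod_opp in Tr.
    replace (Z + - (Z - RtoC T * F w))%C with (RtoC T * F w)%C in Tr by ring.
    rewrite Cmod_mult, Cmod_R, (Rabs_pos_eq T) in Tr by lra.
    pose proof (Rabs_pos B). pose proof (Rle_abs B).
    assert (B * r ^ S n <= (Rabs B + 1) * r ^ S n) by (apply Rmult_le_compat_r; lra).
    assert ((Rabs B + 1) * r ^ S n < (Rabs B + 1) * (D / (Rabs B + 1))) by (apply Rmult_lt_compat_l; lra).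
    replace ((Rabs B + 1) * (D / (Rabs B + 1))) with D in H3 by (field; lra).
    unfold D in *. lra.
Qed.

(** After multiplication by [t ^ m], the weight [g = tau * t ^ m / t] turns the two terms of
    [value_bound] into [tau * A'] and [T * (K * t + e / k) / tau], free of negative powers of [t].
    The constants are fixed in the order [tau], [e], then [K], which depends on [e], and finally
    [t]. Half the sum of the two terms is then less than [3 * c' / 4], whereas the lower bound gives
    [c']. *)
Lemma sparse_coefficients_contradiction (m : nat) (A c d : R) :
  (forall e, 0 < e -> exists K, forall n, rsum s n <= e * INR n + K) ->
  0 < c -> 0 < d ->
  (forall t, 0 < t < d -> RInt (fun x => Cmod (F (x, y0 + t)) ^ 2) a (a + T) <= A * t / (t ^ m) ^ 2) ->
  (forall t, 0 < t < d -> c <= t ^ m * Cmod (F (a + T / 2, y0 + t))) -> False.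
Proof.
  intros Hdens Hc Hd HA Hlow.
  set (k := 2 * PI / T).
  assert (Hk : 0 < k) by (apply Rdiv_lt_0_compat; auto; pose proof PI_RGT_0; lra).
  (* The division by [2 ^ m] accounts for the evaluation at height [2 * t] above [y0]. *)
  set (c' := T * c / 2 ^ m).
  assert (P2 : 0 < 2 ^ m) by (apply pow_lt; lra).
  assert (Hc' : 0 < c') by (apply Rdiv_lt_0_compat; auto; now apply Rmult_lt_0_compat).
  set (A' := Rabs A + 1). assert (HA' : 0 < A') by (unfold A'; pose proof (Rabs_pos A); lra).
  (* The values of [tau], [e] and [t0] make each of [tau * A'], [T * e / (k * tau)] and
     [T * K * t0 / tau] equal to [c' / 2]. *)
  set (tau := c' / (2 * A')). assert (Htau : 0 < tau) by (apply Rdiv_lt_0_compat; lra).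
  set (e := k * tau * c' / (2 * T)).
  assert (He : 0 < e) by (apply Rdiv_lt_0_compat; [|lra]; apply Rmult_lt_0_compat; [apply Rmult_lt_0_compat|]; assumption).
  destruct (Hdens e He) as [K0 HK0].
  set (K := Rabs K0 + 1).
  assert (HKp : 0 < K) by (unfold K; pose proof (Rabs_pos K0); lra).
  assert (HK : forall n, rsum s n <= e * INR n + K).
  { intros n. specialize (HK0 n). unfold K. pose proof (Rle_abs K0). lra. }
  set (t0 := tau * c' / (2 * T * K)).
  assert (Ht0 : 0 < t0) by (apply Rdiv_lt_0_compat; [|repeat apply Rmult_lt_0_compat; lra]; now apply Rmult_lt_0_compat).
  set (t := Rmin (d / 4) (Rmin t0 (/ (2 * k))) / 2).
  assert (Hk2 : 0 < / (2 * k)) by (apply Rinv_0_lt_compat; lra).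
  assert (Ht : 0 < t /\ t < d / 4 /\ t < t0 /\ t < / (2 * k)).
  { assert (P : 0 < Rmin (d / 4) (Rmin t0 (/ (2 * k)))).
    { apply Rmin_pos; [lra|]. apply Rmin_pos; auto. }
    pose proof (Rmin_l (d / 4) (Rmin t0 (/ (2 * k)))). pose proof (Rmin_r (d / 4) (Rmin t0 (/ (2 * k)))).
    pose proof (Rmin_l t0 (/ (2 * k))). pose proof (Rmin_r t0 (/ (2 * k))). unfold t. lra. }
  destruct Ht as [Ht [Ht1 [Ht2 Ht3]]]. clearbody t.
  set (p := t ^ m). assert (Hp : 0 < p) by (apply pow_lt; auto).
  set (u := 2 * (k * t)).
  assert (Hu : 0 < u <= 1).
  { unfold u; split; [nra|]. apply Rmult_lt_compat_r with (r := 2 * k) in Ht3; [|lra].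
    rewrite Rinv_l in Ht3 by lra. lra. }
  set (x := exp (- u)).
  assert (Hx : 0 < x < 1).
  { split; [apply exp_pos|]. rewrite <- exp_0. apply exp_increasing. lra. }
  (* For [0 < u <= 1], [1 - exp (- u) >= u / (1 + u) >= u / 2], and [u / 2 = k * t]. *)
  assert (H1x : k * t <= 1 - x).
  { assert (X1 : x * (1 + u) <= 1).
    { apply Rle_trans with (x * exp u).
      - apply Rmult_le_compat_l; [lra|]. left; apply exp_ineq1; lra.
      - unfold x. rewrite <- exp_plus, Rplus_opp_l, exp_0. lra. }
    assert (x * (1 + u) >= x + x * u) by lra. unfold u in *. nra. }
  pose proof (weighted_sum_bound s e K x He Hx HK) as HX.
  assert (HX' : forall M, rsum (fun n => s n * exp (- (4 * PI / T * t)) ^ n) M <= K + e / (k * t)).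
  { intros M. replace (- (4 * PI / T * t)) with (- u) by (unfold u, k; field; lra). fold x.
    eapply Rle_trans; [apply HX|]. apply Rplus_le_compat_l. unfold Rdiv.
    apply Rmult_le_compat_l; [lra|]. apply Rinv_le_contravar; auto. apply Rmult_lt_0_compat; auto. }
  pose proof (value_bound t (tau * p / t) (K + e / (k * t)) (A' * t / p ^ 2) Ht) as HV.
  specialize (HV ltac:(apply Rdiv_lt_0_compat; auto; now apply Rmult_lt_0_compat)).
  assert (HA1 : RInt (fun x => Cmod (F (x, y0 + t)) ^ 2) a (a + T) <= A' * t / p ^ 2).
  { eapply Rle_trans; [apply HA; lra|]. fold p. unfold Rdiv. apply Rmult_le_compat_r.
    - left; apply Rinv_0_lt_compat, pow_lt; auto.
    - apply Rmult_le_compat_r; [lra|]. unfold A'. pose proof (Rle_abs A); lra. }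
  specialize (HV HA1 HX').
  pose proof (Hlow (2 * t) ltac:(lra)) as HL. rewrite Rpow_mult_distr in HL. fold p in HL.
  set (f := Cmod (F (a + T / 2, y0 + 2 * t))) in *.
  assert (Q1 : c' <= T * f * p).
  { unfold c'. apply Rmult_le_reg_r with (2 ^ m); auto.
    replace (T * c / 2 ^ m * 2 ^ m) with (T * c) by (field; lra).
    replace (T * f * p * 2 ^ m) with (T * (2 ^ m * p * f)) by ring. apply Rmult_le_compat_l; lra. }
  assert (Q2 : T * f * p <= / 2 * (tau * A' + T * (K * t + e / k) / tau)).
  { apply Rle_trans with (/ 2 * (tau * p / t * (A' * t / p ^ 2) + T * (K + e / (k * t)) / (tau * p / t)) * p).
    - apply Rmult_le_compat_r; lra.
    - right. field. repeat split; lra. }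
  assert (Q3 : tau * A' = c' / 2) by (unfold tau; field; lra).
  assert (Q4 : T * (K * t + e / k) / tau < c').
  { replace (T * (K * t + e / k) / tau) with (T * K / tau * t + c' / 2) by (unfold e; field; repeat split; lra).
    apply Rlt_le_trans with (T * K / tau * t0 + c' / 2).
    - apply Rplus_lt_compat_r, Rmult_lt_compat_l; auto. apply Rdiv_lt_0_compat; auto.
      now apply Rmult_lt_0_compat.
    - right. unfold t0. field. repeat split; lra. }
  lra.
Qed.

End Growth.

(** * Mean square near a line carrying poles *)

(** The integrand is [PI * t] times the Poisson kernel of the half plane, with antiderivative
    [t * atan ((x - x0) / t)]. The bound is independent of [u] and [v]. *)
Lemma poisson_kernel_integral x0 t u v : 0 < t -> u <= v ->
  ex_RInt (fun x => t ^ 2 / ((x - x0) ^ 2 + t ^ 2)) u v /\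
  RInt (fun x => t ^ 2 / ((x - x0) ^ 2 + t ^ 2)) u v <= PI * t.
Proof.
  intros Ht Huv.
  assert (P : forall x, 0 < (x - x0) ^ 2 + t ^ 2).
  { intros x. pose proof (pow2_ge_0 (x - x0)). pose proof (pow_lt t 2 Ht). lra. }
  assert (H : is_RInt (fun x => t ^ 2 / ((x - x0) ^ 2 + t ^ 2)) u v
     (minus (t * atan ((v - x0) / t)) (t * atan ((u - x0) / t)))).
  { apply (is_RInt_derive (V := R_CompleteNormedModule) (fun x => t * atan ((x - x0) / t))).
    - intros x _. specialize (P x).
      assert (Q : 1 + ((x - x0) / t) ^ 2 <> 0).
      { pose proof (pow2_ge_0 ((x - x0) / t)). lra. }
      assert (D : is_derive (fun x => (x - x0) / t) x (/ t)).
      { auto_derive; [lra|]. field; lra. }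
      assert (D2 : is_derive (fun x => atan ((x - x0) / t)) x (/ t * (/ (1 + ((x - x0) / t) ^ 2)))).
      { apply (is_derive_comp atan (fun x => (x - x0) / t) x); auto.
        replace (((x - x0) / t) ^ 2) with (Rsqr ((x - x0) / t)) by (unfold Rsqr; ring).
        apply is_derive_atan. }
      replace (t ^ 2 / ((x - x0) ^ 2 + t ^ 2)) with (t * (/ t * / (1 + ((x - x0) / t) ^ 2))).
      + apply is_derive_scal. exact D2.
      + field. repeat split; try lra.
    - intros x _. specialize (P x).
      apply (ex_derive_continuous (fun x => t ^ 2 / ((x - x0) ^ 2 + t ^ 2)) x).
      auto_derive. lra. }
  split; [eexists; exact H|].
  rewrite (is_RInt_unique _ _ _ _ H). unfold minus, plus, opp; simpl.
  pose proof (atan_bound ((v - x0) / t)). pose proof (atan_bound ((u - x0) / t)). nra.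
Qed.

(** Near [(x0, y0)] one has [Cmod (F z) <= B / p ^ S m], where [p >= t] is the distance. Keeping one
    factor [p] and replacing the other [m] by [t] leaves [B^2 / t^(2 m + 2)] times [t^2 / p^2],
    whose integral is at most [PI * t]: this is the gain of one power of [t]. Exponent at least 1 is
    essential to the argument, hence [S m]. The local bounds are added up along the period. *)
Lemma mean_square_near_poles (F : C -> C) (a T y0 : R) (m : nat) : 0 < T ->
  (forall x y, y0 < y -> rcont (fun x => F (x, y)) x) ->
  (forall x, a <= x <= a + T -> exists B, near (x, y0) (fun z => z <> (x, y0) ->
     Cmod (F z) * Cmod (z - (x, y0))%C ^ S m <= B)) ->
  exists A d, 0 < d /\ forall t, 0 < t < d ->
    RInt (fun x => Cmod (F (x, y0 + t)) ^ 2) a (a + T) <= A * t / (t ^ S m) ^ 2.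
Proof.
  intros HT HF HB.
  assert (EI : forall u v t, 0 < t -> u <= v -> ex_RInt (fun x => Cmod (F (x, y0 + t)) ^ 2) u v).
  { intros u v t Ht Huv. apply ex_RInt_sqr; auto. intros; apply HF; lra. }
  apply (interval_cousin (fun u v => exists A d, 0 < d /\ forall t, 0 < t < d ->
    RInt (fun x => Cmod (F (x, y0 + t)) ^ 2) u v <= A * t / (t ^ S m) ^ 2)); [lra| |].
  - intros u n v Hu Hv [A [d [Hd H]]] [A' [d' [Hd' H']]].
    exists (A + A'), (Rmin d d'); split; [now apply Rmin_pos|].
    intros t Ht. pose proof (Rmin_l d d'). pose proof (Rmin_r d d').
    specialize (H t ltac:(lra)). specialize (H' t ltac:(lra)).
    rewrite <- (RInt_Chasles (V := R_CompleteNormedModule) _ u n v) by (apply EI; lra).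
    unfold plus; simpl.
    replace ((A + A') * t / (t ^ S m) ^ 2) with (A * t / (t ^ S m) ^ 2 + A' * t / (t ^ S m) ^ 2)
      by (unfold Rdiv; ring).
    simpl in *. lra.
  - intros x0 Hx0. destruct (HB x0 Hx0) as [B [d [Hd H]]].
    exists (d / 2); split; [lra|]. intros u v Hu Hv Huv Hs.
    exists (PI * B ^ 2), (d / 2); split; [lra|]. intros t Ht.
    set (q := t ^ S m). assert (Hq : 0 < q) by (apply pow_lt; lra).
    destruct (poisson_kernel_integral x0 t u v ltac:(lra) ltac:(lra)) as [K1 K2].
    set (k := fun x => t ^ 2 / ((x - x0) ^ 2 + t ^ 2)) in *.
    assert (Hpt : forall x, u < x < v -> Cmod (F (x, y0 + t)) ^ 2 <= (B ^ 2 / q ^ 2) * k x).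
    { intros x Hx. set (z := (x, y0 + t) : C). set (z0 := (x0, y0) : C).
      assert (Hz : (z - z0)%C = (x - x0, t)).
      { unfold z, z0, Cminus, Cplus, Copp; simpl. f_equal; ring. }
      set (p := Cmod (z - z0)%C).
      assert (Hp2 : p ^ 2 = (x - x0) ^ 2 + t ^ 2).
      { unfold p. rewrite Hz. unfold Cmod; simpl fst; simpl snd. apply pow2_sqrt.
        pose proof (pow2_ge_0 (x - x0)). pose proof (pow2_ge_0 t). lra. }
      assert (Hp : 0 < p).
      { apply Cmod_gt_0. rewrite Hz. intros E. injection E as E1 E2. lra. }
      assert (Hne : z <> z0) by (unfold z, z0; intros E; injection E; lra).
      assert (Hnear : p < d).
      { unfold p. eapply Rle_lt_trans; [apply Cmod_le_abs|]. rewrite Hz. unfold Re, Im; simpl.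
        rewrite (Rabs_pos_eq t) by lra.
        assert (Rabs (x - x0) < d / 2) by (apply Rabs_def1; lra). lra. }
      specialize (H z Hnear Hne). fold z0 in H. fold p in H.
      set (W := Cmod (F z)) in *. assert (HW : 0 <= W) by apply Cmod_ge_0.
      assert (Htp : t <= p).
      { apply Rnot_lt_le; intros N. assert (p ^ 2 < t ^ 2) by (simpl; nra).
        pose proof (pow2_ge_0 (x - x0)). lra. }
      assert (Hpm : 0 < p ^ m) by (apply pow_lt; auto).
      assert (Htm : 0 < t ^ m) by (apply pow_lt; lra).
      assert (Htpm : t ^ m <= p ^ m) by (apply pow_incr; lra).
      (* Of the [S m] factors [p] one survives; the others are bounded below by [t]. *)
      assert (H1 : W * p * t ^ m <= B).
      { simpl in H. assert (0 <= W * p) by (apply Rmult_le_pos; lra). nra. }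
      assert (H2 : (W * p * t ^ m) ^ 2 <= B ^ 2).
      { apply pow_incr. split; auto. apply Rmult_le_pos; [apply Rmult_le_pos|]; lra. }
      unfold k. rewrite <- Hp2. unfold q.
      replace (B ^ 2 / (t ^ S m) ^ 2 * (t ^ 2 / p ^ 2)) with (B ^ 2 * / (p * t ^ m) ^ 2).
      2:{ simpl. field. repeat split; lra. }
      apply Rmult_le_reg_r with ((p * t ^ m) ^ 2).
      - apply pow_lt. now apply Rmult_lt_0_compat.
      - rewrite Rmult_assoc, Rinv_l, Rmult_1_r.
        + eapply Rle_trans; [|exact H2]. right; ring.
        + apply pow_nonzero. apply Rgt_not_eq. now apply Rmult_lt_0_compat. }
    assert (K3 : ex_RInt (fun x => (B ^ 2 / q ^ 2) * k x) u v)
      by now apply (ex_RInt_scal (V := R_NormedModule)).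
    apply Rle_trans with (RInt (fun x => (B ^ 2 / q ^ 2) * k x) u v).
    + apply RInt_le; auto; [lra|]. apply EI; lra.
    + replace (RInt (fun x => (B ^ 2 / q ^ 2) * k x) u v) with ((B ^ 2 / q ^ 2) * RInt k u v)
        by (symmetry; exact (RInt_scal (V := R_CompleteNormedModule) _ _ _ _ K1)).
      replace (PI * B ^ 2 * t / q ^ 2) with (B ^ 2 / q ^ 2 * (PI * t)) by (field; lra).
      apply Rmult_le_compat_l; auto.
      apply Rmult_le_pos; [apply pow2_ge_0|]. left; apply Rinv_0_lt_compat, pow_lt; auto.
Qed.

(** * Poles of a meromorphic function *)

(** The value 0 at a pole is a placeholder. It is compatible with multiplication by a constant, as
    [fval_smul] requires, and the order conditions below leave out the centre. *)
Definition fval (f : C -> sphere) (z : C) : C :=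
  match f z with Some w => w | None => RtoC 0 end.

(** Orders are measured by growth, which is all that the estimates use. The clause [f z <> None]
    makes [z0] isolated from other poles; the compactness argument for the orders relies on it. *)
Definition order_le (f : C -> sphere) (z0 : C) (m : nat) : Prop :=
  exists B, near z0 (fun z => z <> z0 ->
    f z <> None /\ Cmod (fval f z) * Cmod (z - z0)%C ^ m <= B).

Definition order_ge (f : C -> sphere) (z0 : C) (m : nat) : Prop :=
  exists c, 0 < c /\ near z0 (fun z => z <> z0 -> c <= Cmod (fval f z) * Cmod (z - z0)%C ^ m).

Lemma regular_cdiff f z : regular_at f z ->
  f z <> None /\ near z (fun w => f w <> None) /\ cdiff (fval f) z.
Proof.
  intros [g Hg]. apply (proj1 (locally_near _ _)) in Hg.
  assert (N : near z (fun w => f w <> None)).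
  { revert Hg. apply near_imp. intros w [-> _]. discriminate. }
  split; [|split]; auto.
  - exact (near_self _ _ N).
  - apply cdiff_ext with g.
    + revert Hg. apply near_imp. intros w [E _]. unfold fval. now rewrite E.
    + apply complex_differentiable_cdiff. exact (proj2 (near_self _ _ Hg)).
Qed.

Lemma cdiff_near_order_le f z : near z (fun w => f w <> None) -> cdiff (fval f) z -> order_le f z 0.
Proof.
  intros N H. exists (Cmod (fval f z) + 1).
  generalize (near_and _ _ _ N (ccont_upper _ _ (cdiff_cont _ _ H))). apply near_imp.
  intros w [H1 H2] _. split; auto. simpl. lra.
Qed.

Lemma near_le1 z : near z (fun w => Cmod (w - z)%C <= 1).
Proof. exists 1; split; [lra|]; intros; lra. Qed.

Lemma order_le_mono f z m n : (m <= n)%nat -> order_le f z m -> order_le f z n.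
Proof.
  intros Hmn [B H]. exists B.
  generalize (near_and _ _ _ H (near_le1 z)). apply near_imp.
  intros w [H1 H2] Hw. destruct (H1 Hw) as [H3 H4]. split; auto.
  eapply Rle_trans; [|exact H4]. apply Rmult_le_compat_l; [apply Cmod_ge_0|].
  replace n with (m + (n - m))%nat by lia. rewrite pow_add.
  pose proof (Cmod_ge_0 (w - z)%C).
  assert (0 <= Cmod (w - z)%C ^ m) by (apply pow_le; auto).
  assert (Cmod (w - z)%C ^ (n - m) <= 1) by (rewrite <- (pow1 (n - m)); apply pow_incr; auto).
  nra.
Qed.

Lemma pole_order f z0 : pole_at f z0 -> exists m, (0 < m)%nat /\ order_le f z0 m /\ order_ge f z0 m.
Proof.
  intros [_ [g [m [Hm [Hg0 [Hd Hl]]]]]]. exists m. split; auto.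
  apply (proj1 (locally_near _ _)) in Hd. apply (proj1 (locally_near _ _)) in Hl.
  assert (Cg : ccont g z0).
  { apply cdiff_cont, complex_differentiable_cdiff. exact (near_self _ _ Hd). }
  assert (E : forall z, z <> z0 -> f z = Some (g z / (z - z0) ^ m)%C ->
     f z <> None /\ Cmod (fval f z) * Cmod (z - z0)%C ^ m = Cmod (g z)).
  { intros z Hz E. unfold fval. rewrite E. split; [discriminate|].
    assert (Hn : (z - z0)%C <> RtoC 0).
    { intros Q; apply Hz. replace z with ((z - z0) + z0)%C by ring. rewrite Q; ring. }
    rewrite Cmod_div by now apply Cpow_nz. rewrite Cmod_pow.
    assert (0 < Cmod (z - z0)%C) by now apply Cmod_gt_0.
    field. apply pow_nonzero. lra. }
  split.
  - exists (Cmod (g z0) + 1). generalize (near_and _ _ _ Hl (ccont_upper _ _ Cg)).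
    apply near_imp. intros z [H1 H2] Hz. destruct (E z Hz (H1 Hz)) as [E1 E2]. split; auto. lra.
  - exists (Cmod (g z0) / 2). apply Cmod_gt_0 in Hg0. split; [lra|].
    assert (Hg0' : g z0 <> RtoC 0) by now apply Cmod_gt_0.
    generalize (near_and _ _ _ Hl (ccont_lower _ _ Cg Hg0')).
    apply near_imp. intros z [H1 H2] Hz. destruct (E z Hz (H1 Hz)) as [E1 E2]. lra.
Qed.

Lemma near_up z P : near z P -> exists d, 0 < d /\ forall t, 0 < t < d -> P (z + (0, t))%C.
Proof.
  intros [d [Hd H]]. exists d; split; auto. intros t Ht. apply H.
  replace (z + (0, t) - z)%C with ((0, t) - (0, 0))%C.
  - rewrite Cmod_ver, Rminus_0_r, Rabs_pos_eq; lra.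
  - destruct z; unfold Cminus, Cplus, Copp; simpl; f_equal; ring.
Qed.

Lemma Cmod_up z t : 0 < t -> (z + (0, t))%C <> z /\ Cmod (z + (0, t) - z)%C = t.
Proof.
  intros Ht. split.
  - intros E. apply (f_equal Im) in E. destruct z; simpl in E. lra.
  - replace (z + (0, t) - z)%C with ((0, t) - (0, 0))%C.
    + rewrite Cmod_ver, Rminus_0_r, Rabs_pos_eq; lra.
    + destruct z; unfold Cminus, Cplus, Copp; simpl; f_equal; ring.
Qed.

(** Approach [z] vertically: if [n < m], then [Cmod (fval f) * t ^ n] stays bounded, and the extra
    factor [t ^ (m - n) <= t] drives [Cmod (fval f) * t ^ m] below any [c > 0]. *)
Lemma order_ge_le f z m n : order_ge f z m -> order_le f z n -> (m <= n)%nat.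
Proof.
  intros [c [Hc H1]] [B H2]. apply Nat.nlt_ge. intros Hmn.
  destruct (near_up _ _ (near_and _ _ _ (near_and _ _ _ H1 H2) (near_le1 z))) as [d [Hd H]].
  set (B' := Rabs B + 1). assert (HB' : 0 < B') by (unfold B'; pose proof (Rabs_pos B); lra).
  assert (Hcb : 0 < c / B') by (apply Rdiv_lt_0_compat; lra).
  set (t := Rmin d (c / B') / 2).
  assert (Ht : 0 < t < d /\ t < c / B').
  { pose proof (Rmin_l d (c / B')). pose proof (Rmin_r d (c / B')).
    pose proof (Rmin_pos _ _ Hd Hcb). unfold t. lra. }
  destruct Ht as [Ht Ht2]. destruct (H t Ht) as [[K1 K2] K3].
  destruct (Cmod_up z t ltac:(lra)) as [U1 U2].
  specialize (K1 U1). destruct (K2 U1) as [_ K4]. rewrite U2 in *.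
  replace m with (n + S (m - n - 1))%nat in K1 by lia. rewrite pow_add in K1.
  assert (P : t ^ S (m - n - 1) <= t).
  { simpl. assert (t ^ (m - n - 1) <= 1) by (rewrite <- (pow1 (m - n - 1)); apply pow_incr; lra).
    assert (0 <= t ^ (m - n - 1)) by (apply pow_le; lra). nra. }
  assert (0 <= t ^ S (m - n - 1)) by (apply pow_le; lra).
  set (X := Cmod (fval f (z + (0, t))%C) * t ^ n) in *.
  assert (0 <= X) by (apply Rmult_le_pos; [apply Cmod_ge_0|apply pow_le; lra]).
  rewrite <- Rmult_assoc in K1. fold X in K1.
  assert (X <= B') by (unfold B'; pose proof (Rle_abs B); lra).
  assert (c <= B' * t) by nra.
  assert (L : B' * t < B' * (c / B')) by (apply Rmult_lt_compat_l; lra).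
  replace (B' * (c / B')) with c in L by (field; lra). lra.
Qed.

Lemma order_le_mult f e F z0 m :
  (forall z, F z = (fval f z * e z)%C) -> ccont e z0 -> order_le f z0 m ->
  exists B, near z0 (fun z => z <> z0 -> Cmod (F z) * Cmod (z - z0)%C ^ m <= B).
Proof.
  intros HF He [B H]. exists ((Rabs B) * (Cmod (e z0) + 1)).
  generalize (near_and _ _ _ H (ccont_upper _ _ He)). apply near_imp.
  intros z [H1 H2] Hz. destruct (H1 Hz) as [_ H3]. rewrite HF, Cmod_mult.
  set (p := Cmod (z - z0)%C ^ m) in *.
  replace (Cmod (fval f z) * Cmod (e z) * p) with ((Cmod (fval f z) * p) * Cmod (e z)) by ring.
  apply Rmult_le_compat.
  - apply Rmult_le_pos; [apply Cmod_ge_0|apply pow_le, Cmod_ge_0].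
  - apply Cmod_ge_0.
  - pose proof (Rle_abs B); lra.
  - lra.
Qed.

Lemma order_ge_mult f e F z0 m :
  (forall z, F z = (fval f z * e z)%C) -> ccont e z0 -> e z0 <> RtoC 0 -> order_ge f z0 m ->
  exists c d, 0 < c /\ 0 < d /\ forall t, 0 < t < d -> c <= t ^ m * Cmod (F (z0 + (0, t))%C).
Proof.
  intros HF He He0 [c [Hc H]].
  destruct (near_up _ _ (near_and _ _ _ H (ccont_lower _ _ He He0))) as [d [Hd K]].
  apply Cmod_gt_0 in He0.
  exists (c * (Cmod (e z0) / 2)), d. split; [apply Rmult_lt_0_compat; lra|]. split; auto.
  intros t Ht. destruct (K t Ht) as [K1 K2]. destruct (Cmod_up z0 t ltac:(lra)) as [U1 U2].
  specialize (K1 U1). rewrite U2 in K1. rewrite HF, Cmod_mult.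
  replace (t ^ m * (Cmod (fval f (z0 + (0, t))%C) * Cmod (e (z0 + (0, t))%C)))
    with ((Cmod (fval f (z0 + (0, t))%C) * t ^ m) * Cmod (e (z0 + (0, t))%C)) by ring.
  apply Rmult_le_compat; lra.
Qed.

(** * Expansions and Fourier coefficients *)

Definition lsum (t : R -> C) (l : list R) : C := fold_right Cplus (RtoC 0) (map t l).

Lemma lsum_app t l l' : lsum t (l ++ l') = (lsum t l + lsum t l')%C.
Proof.
  unfold lsum. induction l as [|x l IH]; simpl; [ring|]. rewrite IH. ring.
Qed.

Fixpoint labs (t : R -> C) (l : list R) : R :=
  match l with nil => 0 | x :: l => Cmod (t x) + labs t l end.

Lemma lsum_le_labs t l : Cmod (lsum t l) <= labs t l.
Proof.
  unfold lsum. induction l as [|x l IH]; simpl.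
  - rewrite Cmod_0. lra.
  - eapply Rle_trans; [apply Cmod_triangle|]. lra.
Qed.

Lemma labs_ext t t' l : (forall x, Cmod (t x) = Cmod (t' x)) -> labs t l = labs t' l.
Proof. intros H; induction l as [|x l IH]; simpl; auto. now rewrite IH, H. Qed.

(* Splitting a family according to the signs of real and imaginary parts, a
   bound on all subsums gives a bound on the sum of absolute values. *)
Lemma labs_le t l e : NoDup l ->
  (forall l', NoDup l' -> incl l' l -> Cmod (lsum t l') <= e) -> labs t l <= 4 * e.
Proof.
  intros Hl H.
  set (p := fun (g : C -> R) x => if Rle_dec 0 (g (t x)) then true else false).
  assert (part : forall g : C -> R, (forall z w, g (z + w)%C = g z + g w) -> g 0 = 0 ->
    (forall z, Rabs (g z) <= Cmod z) ->
    fold_right Rplus 0 (map (fun x => Rabs (g (t x))) l) <= 2 * e).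
  { intros g Hadd H0 Hg.
    assert (E : forall l, fold_right Rplus 0 (map (fun x => Rabs (g (t x))) l)
      = g (lsum t (filter (p g) l)) - g (lsum t (filter (fun x => negb (p g x)) l))).
    { clear l Hl H. intros l. unfold lsum. induction l as [|x l IH]; simpl; [lra|].
      rewrite IH. destruct (p g x) eqn:Q; unfold p in Q; destruct (Rle_dec 0 (g (t x))) as [P|P];
        try discriminate; simpl; rewrite Hadd.
      - rewrite Rabs_pos_eq by auto. lra.
      - rewrite Rabs_left by lra. lra. }
    rewrite E.
    assert (B : forall q, Rabs (g (lsum t (filter q l))) <= e).
    { intros q. eapply Rle_trans; [apply Hg|]. apply H; [now apply NoDup_filter|].
      intros x Hx. now apply filter_In in Hx. }
    pose proof (B (p g)) as B1. pose proof (B (fun x => negb (p g x))) as B2.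
    apply Rabs_le_between in B1. apply Rabs_le_between in B2. lra. }
  assert (PR := part Re (fun z w => eq_refl) eq_refl Rabs_Re_le).
  assert (PI := part Im (fun z w => eq_refl) eq_refl Rabs_Im_le).
  clear -PR PI.
  assert (K : labs t l <= fold_right Rplus 0 (map (fun x => Rabs (Re (t x))) l)
     + fold_right Rplus 0 (map (fun x => Rabs (Im (t x))) l)).
  { clear. induction l as [|x l IH]; simpl; [lra|]. pose proof (Cmod_le_abs (t x)). lra. }
  lra.
Qed.

Definition terms (al : R -> C) (z : C) (l : R) : C := (al l * e2pi l z)%C.

(** On a horizontal line the modulus of each term is constant. Summability at [x = 0] bounds the
    sums of moduli over finite sets disjoint from [l0], and this bound holds at every [x]. *)
Lemma expansion_uniform (f : C -> sphere) (al : R -> C) (A : R -> Prop) (y e : R) : 0 < e ->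
  (forall x, exists w, f (x, y) = Some w /\ is_sum_over A (terms al (x, y)) w) ->
  exists l0, forall x, Cmod (fval f (x, y) - lsum (terms al (x, y)) l0)%C <= e.
Proof.
  intros He H.
  destruct (H 0) as [w0 [_ Hw0]].
  (* Two partial sums within [e / 16] of the limit differ by at most [e / 8]; [labs_le] costs a
     factor 4, which gives [e / 2], and the convergence at [x] itself takes the other [e / 2]. *)
  assert (He16 : 0 < e / 16) by lra.
  destruct (Hw0 (mkposreal _ He16)) as [l00 [F0 K0]]. simpl in K0.
  set (l0 := nodup Req_EM_T l00).
  assert (N0 : NoDup l0) by apply NoDup_nodup.
  assert (I0 : incl l00 l0) by (intros x Hx; now apply nodup_In).
  assert (A0 : List.Forall A l0).
  { apply List.Forall_forall. intros x Hx. apply nodup_In in Hx.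
    rewrite List.Forall_forall in F0. auto. }
  exists l0. intros x.
  assert (small : forall l, NoDup l -> List.Forall A l -> (forall u, In u l -> ~ In u l0) ->
     Cmod (lsum (terms al (0, y)) l) <= e / 8).
  { intros l Nl Al Dl.
    assert (N1 : NoDup (l0 ++ l)).
    { apply NoDup_app; auto. intros u Hu Hu'. exact (Dl u Hu' Hu). }
    pose proof (K0 (l0 ++ l) N1 ltac:(apply Forall_app; auto) ltac:(apply incl_appl; auto)) as K1.
    pose proof (K0 l0 N0 A0 I0) as K2.
    change (Cmod (lsum (terms al (0, y)) (l0 ++ l) - w0)%C < e / 16) in K1.
    change (Cmod (lsum (terms al (0, y)) l0 - w0)%C < e / 16) in K2.
    rewrite lsum_app in K1.
    set (a0 := lsum (terms al (0, y)) l0) in *. set (a1 := lsum (terms al (0, y)) l) in *.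
    pose proof (Cmod_triangle (a0 + a1 - w0) (- (a0 - w0)))%C as Tr. rewrite Cmod_opp in Tr.
    replace (a0 + a1 - w0 + - (a0 - w0))%C with a1 in Tr by ring. lra. }
  assert (absb : forall l, NoDup l -> List.Forall A l -> (forall u, In u l -> ~ In u l0) ->
     Cmod (lsum (terms al (x, y)) l) <= e / 2).
  { intros l Nl Al Dl. eapply Rle_trans; [apply lsum_le_labs|].
    rewrite (labs_ext _ (terms al (0, y))).
    - replace (e / 2) with (4 * (e / 8)) by field. apply labs_le; auto.
      intros l' Nl' Il'. apply small; auto.
      + rewrite List.Forall_forall in *. auto.
    - intros u. unfold terms. rewrite !Cmod_mult, !Cmod_e2pi. reflexivity. }
  destruct (H x) as [w [Ew Hw]]. assert (He2 : 0 < e / 2) by lra.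
  destruct (Hw (mkposreal _ He2)) as [l1 [F1 K1]]. simpl in K1.
  (* A list adapted to [x] is merged with [l0]; what it adds is disjoint from [l0] and therefore
     small. *)
  set (rest := filter (fun u => if in_dec Req_EM_T u l0 then false else true) (nodup Req_EM_T l1)).
  assert (Hrest : forall u, In u rest <-> In u l1 /\ ~ In u l0).
  { intros u. unfold rest. rewrite filter_In, nodup_In.
    destruct (in_dec Req_EM_T u l0); intuition discriminate. }
  assert (Nr : NoDup rest) by (apply NoDup_filter, NoDup_nodup).
  assert (Ar : List.Forall A rest).
  { apply List.Forall_forall. intros u Hu. apply Hrest in Hu.
    rewrite List.Forall_forall in F1. apply F1; tauto. }
  assert (Dr : forall u, In u rest -> ~ In u l0) by (intros u Hu; apply Hrest in Hu; tauto).
  specialize (K1 (l0 ++ rest)).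
  change (NoDup (l0 ++ rest) -> List.Forall A (l0 ++ rest) -> incl l1 (l0 ++ rest) ->
     Cmod (lsum (terms al (x, y)) (l0 ++ rest) - w)%C < e / 2) in K1.
  rewrite lsum_app in K1.
  assert (K2 := absb rest Nr Ar Dr).
  unfold fval. rewrite Ew.
  set (a0 := lsum (terms al (x, y)) l0) in *. set (a1 := lsum (terms al (x, y)) rest) in *.
  assert (K3 : Cmod (a0 + a1 - w)%C < e / 2).
  { apply K1.
    - apply NoDup_app; auto. intros u Hu Hu'. exact (Dr u Hu' Hu).
    - apply Forall_app; auto.
    - intros u Hu. apply in_or_app. destruct (in_dec Req_EM_T u l0); [now left|right].
      now apply Hrest. }
  pose proof (Cmod_triangle a1 (- (a0 + a1 - w)))%C as Tr. rewrite Cmod_opp in Tr.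
  replace (a1 + - (a0 + a1 - w))%C with (w - a0)%C in Tr by ring. lra.
Qed.

(** An exponential of frequency [m - l0 <> 0] has integrals bounded independently of the length of
    the interval, and the constant term that [m = l0] would give has coefficient 0. *)
Lemma lsum_integral_bounded (al : R -> C) (l0 y a : R) : al l0 = RtoC 0 -> forall l,
  exists B, forall b, a <= b ->
    Cintegrable (fun x => lsum (terms al (x, y)) l * e2pi (- l0) (x, y))%C a b /\
    Cmod (CInt (fun x => lsum (terms al (x, y)) l * e2pi (- l0) (x, y))%C a b) <= B.
Proof.
  intros H0. induction l as [|m l [B IH]].
  - exists 0. intros b Hb.
    assert (E : forall x, (lsum (terms al (x, y)) nil * e2pi (- l0) (x, y))%C = RtoC 0)
      by (intros; unfold lsum; simpl; ring).
    split.
    + apply (ex_RInt_ext (V := C_R_NormedModule) (fun _ => RtoC 0)); [intros; symmetry; apply E|].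
      apply (ex_RInt_const (V := C_R_NormedModule)).
    + rewrite (CInt_ext _ (fun _ => RtoC 0)); auto. rewrite CInt_const, Cmult_0_r, Cmod_0. lra.
  - set (ex := exp (- (2 * PI * (m - l0) * y))).
    exists (Cmod (al m) * (2 * ex / Rabs (2 * PI * (m - l0))) + B). intros b Hb.
    destruct (IH b Hb) as [I1 I2].
    assert (E : forall x, (lsum (terms al (x, y)) (m :: l) * e2pi (- l0) (x, y))%C
       = (al m * e2pi (m - l0) (x, y) + lsum (terms al (x, y)) l * e2pi (- l0) (x, y))%C).
    { intros x. unfold lsum; simpl. unfold terms at 1. unfold Rminus. rewrite e2pi_addl. ring. }
    assert (I3 : Cintegrable (fun x => e2pi (m - l0) (x, y)) a b)
      by (apply rcont_integrable; auto; intros; apply rcont_e2pi).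
    assert (I4 : Cintegrable (fun x => al m * e2pi (m - l0) (x, y))%C a b) by now apply Cintegrable_scal.
    split.
    + apply (ex_RInt_ext (V := C_R_NormedModule)
        (fun x => al m * e2pi (m - l0) (x, y) + lsum (terms al (x, y)) l * e2pi (- l0) (x, y))%C).
      * intros; symmetry; apply E.
      * now apply Cintegrable_plus.
    + rewrite (CInt_ext _ (fun x => al m * e2pi (m - l0) (x, y)
         + lsum (terms al (x, y)) l * e2pi (- l0) (x, y))%C); auto.
      rewrite CInt_plus by auto. eapply Rle_trans; [apply Cmod_triangle|].
      apply Rplus_le_compat; auto. rewrite CInt_scal, Cmod_mult by auto.
      destruct (Req_EM_T m l0) as [->|Hne].
      * rewrite H0, Cmod_0. lra.
      * apply Rmult_le_compat_l; [apply Cmod_ge_0|].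
        rewrite CInt_e2pi by (auto; lra).
        pose proof PI_RGT_0.
        assert (N : 2 * PI * (m - l0) <> 0).
        { apply Rmult_integral_contrapositive_currified; lra. }
        assert (N1 : (RtoC (2 * PI * (m - l0)) * Ci)%C <> RtoC 0).
        { apply Cmult_neq_0.
          - intros Q. now apply RtoC_inj in Q.
          - intros Q. apply (f_equal Im) in Q. simpl in Q. lra. }
        rewrite Cmod_div by auto. rewrite (Cmod_mult (RtoC _)), Cmod_R.
        rewrite Cmod_Ci.
        rewrite Rmult_1_r. unfold Rdiv. apply Rmult_le_compat_r.
        { left. apply Rinv_0_lt_compat. now apply Rabs_pos_lt. }
        unfold Cminus. eapply Rle_trans; [apply Cmod_triangle|].
        rewrite Cmod_opp, !Cmod_e2pi. unfold ex; simpl. lra.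
Qed.

(** Mean value over long segments, as for almost periodic functions. Over [K] periods the integral
    is [K * c]; a uniform approximation by a finite sum has an integral bounded in [K], with an
    error of at most [e * E * K * T], where [E] is the modulus of [e2pi (- l0)] on the line. Large
    [K], then small [e], force [c = 0]. The frequencies in [A] need not be commensurable with
    [/ T]. *)
Lemma coef_expansion_zero (f : C -> sphere) (al : R -> C) (A : R -> Prop) (a T l0 y : R) : 0 < T ->
  (forall x, exists w, f (x, y) = Some w /\ is_sum_over A (terms al (x, y)) w) ->
  (forall x, rcont (fun x => fval f (x, y)) x) ->
  (forall x, (fval f ((x + T)%R, y) * e2pi (- l0) ((x + T)%R, y) = fval f (x, y) * e2pi (- l0) (x, y))%C) ->
  al l0 = RtoC 0 -> coef (fval f) a T l0 y = 0.
Proof.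
  intros HT Hsum Hc Hper H0.
  set (G := fun x => (fval f (x, y) * e2pi (- l0) (x, y))%C).
  assert (GI : forall u v, u <= v -> Cintegrable G u v).
  { intros u v Huv. apply rcont_integrable; auto. intros; apply rcont_mult; auto using rcont_e2pi. }
  set (c := coef (fval f) a T l0 y). change (CInt G a (a + T)) with c in *.
  assert (HK : forall K, CInt G a (a + INR K * T) = (RtoC (INR K) * c)%C).
  { induction K as [|K IH].
    - simpl. rewrite Rmult_0_l, Rplus_0_r, Cmult_0_l.
      apply CInt_point.
    - assert (P : 0 <= INR K * T) by (apply Rmult_le_pos; [apply pos_INR|lra]).
      rewrite S_INR. rewrite <- (CInt_Chasles G a (a + INR K * T)) by (apply GI; lra).
      rewrite IH.
      assert (S : forall j, CInt G (a + INR j * T) (a + INR j * T + T) = c).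
      { induction j as [|j IHj].
        - simpl. rewrite Rmult_0_l, Rplus_0_r. reflexivity.
        - rewrite <- IHj. rewrite S_INR.
          replace (a + (INR j + 1) * T) with ((a + INR j * T) + T) by ring.
          replace (a + INR j * T + T + T) with ((a + INR j * T + T) + T) by ring.
          rewrite <- (CInt_shift G) by (apply GI; lra).
          apply CInt_ext; [lra|]. intros x _. unfold G. apply Hper. }
      replace (a + (INR K + 1) * T) with (a + INR K * T + T) by ring.
      rewrite S, RtoC_plus. ring. }
  set (E := exp (2 * PI * l0 * y)). assert (HE : 0 < E) by apply exp_pos.
  assert (main : forall e, 0 < e -> Cmod c <= T * E * e).
  { intros e He.
    destruct (expansion_uniform f al A y e He Hsum) as [l Hl].
    destruct (lsum_integral_bounded al l0 y a H0 l) as [B HB].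
    apply Rnot_lt_le. intros N.
    set (D := Cmod c - T * E * e). assert (HD : 0 < D) by (unfold D; lra).
    destruct (archimed_cor1 (D / (Rabs B + 1))) as [K [K1 K2]].
    { apply Rdiv_lt_0_compat; auto. pose proof (Rabs_pos B). lra. }
    assert (KP : 0 < INR K) by now apply lt_0_INR.
    set (b := a + INR K * T).
    assert (Hab : a <= b) by (unfold b; assert (0 < INR K * T) by (now apply Rmult_lt_0_compat); lra).
    destruct (HB b Hab) as [I1 I2].
    set (L := fun x => (lsum (terms al (x, y)) l * e2pi (- l0) (x, y))%C) in *.
    assert (M : Cmod (CInt G a b - CInt L a b)%C <= e * E * (b - a)).
    { rewrite <- CInt_minus by auto. apply CInt_norm_const; auto.
      - apply (ex_RInt_minus (V := C_R_NormedModule)); auto. now apply GI.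
      - intros x _. unfold G, L.
        replace (fval f (x, y) * e2pi (- l0) (x, y) - lsum (terms al (x, y)) l * e2pi (- l0) (x, y))%C
          with ((fval f (x, y) - lsum (terms al (x, y)) l) * e2pi (- l0) (x, y))%C by ring.
        rewrite Cmod_mult, Cmod_e2pi. apply Rmult_le_compat.
        + apply Cmod_ge_0.
        + left; apply exp_pos.
        + apply Hl.
        + right. unfold E. f_equal. simpl. ring. }
    unfold b in M at 1. rewrite HK in M. replace (b - a) with (INR K * T) in M by (unfold b; ring).
    pose proof (Cmod_triangle (RtoC (INR K) * c - CInt L a b) (CInt L a b))%C as Tr.
    replace (RtoC (INR K) * c - CInt L a b + CInt L a b)%C with (RtoC (INR K) * c)%C in Tr by ring.
    rewrite Cmod_mult, Cmod_R, Rabs_pos_eq in Tr by lra.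
    assert (INR K * D <= B).
    { unfold D. replace (INR K * (Cmod c - T * E * e)) with (INR K * Cmod c - e * E * (INR K * T)) by ring. lra. }
    assert (B < INR K * D).
    { pose proof (Rabs_pos B). pose proof (Rle_abs B).
      apply Rmult_lt_compat_r with (r := INR K * (Rabs B + 1)) in K1; [|apply Rmult_lt_0_compat; lra].
      replace (/ INR K * (INR K * (Rabs B + 1))) with (Rabs B + 1) in K1 by (field; lra).
      replace (D / (Rabs B + 1) * (INR K * (Rabs B + 1))) with (INR K * D) in K1 by (field; lra). lra. }
    lra. }
  apply Cmod_eq_0. apply Rle_antisym; [|apply Cmod_ge_0]. apply Rnot_lt_le. intros N.
  assert (0 < T * E) by (now apply Rmult_lt_0_compat).
  specialize (main (Cmod c / (2 * (T * E))) ltac:(apply Rdiv_lt_0_compat; lra)).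
  replace (T * E * (Cmod c / (2 * (T * E)))) with (Cmod c / 2) in main by (field; split; lra). lra.
Qed.

(** * The translation in a subgroup of finite index *)

Lemma SL2Z_eq g h : ma g = ma h -> mb g = mb h -> mc g = mc h -> md g = md h -> g = h.
Proof.
  destruct g as [a b c d p], h as [a' b' c' d' q]; simpl. intros; subst.
  f_equal. apply UIP_dec, Z.eq_dec.
Qed.

Lemma translation_det (n : Z) : (1 * 1 - n * 0 = 1)%Z.
Proof. ring. Qed.

Definition translation (n : Z) : SL2Z := mkSL2Z (translation_det n).

(** Pigeonhole principle: two of the translations by [0, ..., length l] have the same representative
    [s], and the quotient of the two elements of [G] obtained is a translation by the difference. *)
Lemma finite_index_translation G : is_subgroup G -> finite_index G ->
  exists n : Z, (0 < n)%Z /\ G (translation n).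
Proof.
  intros [_ [Gmul Ginv]] [l Hl].
  set (phi := fun i : nat => proj1_sig (constructive_indefinite_description _ (Hl (translation (Z.of_nat i))))).
  assert (Hphi : forall i, In (phi i) l /\ G (sl2_mul (sl2_inv (phi i)) (translation (Z.of_nat i)))).
  { intros i. unfold phi. now destruct (constructive_indefinite_description _ _). }
  assert (Hij : exists i j, (i < j)%nat /\ phi i = phi j).
  { apply NNPP. intros N.
    assert (Inj : Injective phi).
    { intros i j E. destruct (Nat.lt_trichotomy i j) as [H|[H|H]]; auto; exfalso; apply N.
      - now exists i, j.
      - now exists j, i. }
    pose proof (Injective_map_NoDup Inj (seq_NoDup (S (length l)) 0)) as ND.
    apply NoDup_incl_length with (l' := l) in ND.
    - rewrite length_map, length_seq in ND. lia.
    - intros x Hx. apply in_map_iff in Hx. destruct Hx as [i [<- _]]. apply Hphi. }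
  destruct Hij as [i [j [Hij E]]].
  exists (Z.of_nat j - Z.of_nat i)%Z. split; [lia|].
  destruct (Hphi i) as [_ Hi]. destruct (Hphi j) as [_ Hj]. rewrite <- E in Hj.
  pose proof (Gmul _ _ (Ginv _ Hi) Hj) as K.
  eapply eq_ind; [exact K|].
  pose proof (sl2_det (phi i)) as D. apply SL2Z_eq; simpl.
  - transitivity ((ma (phi i) * md (phi i) - mb (phi i) * mc (phi i)) * 1)%Z; [ring|rewrite D; ring].
  - transitivity ((ma (phi i) * md (phi i) - mb (phi i) * mc (phi i)) * (Z.of_nat j - Z.of_nat i))%Z;
      [ring|rewrite D; ring].
  - ring.
  - transitivity ((ma (phi i) * md (phi i) - mb (phi i) * mc (phi i)) * 1)%Z; [ring|rewrite D; ring].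
Qed.

(** Otherwise a small step in the direction [j z * Cconj l] multiplies [j z] by a number with real
    part greater than 1, against [Cmod (j w) = 1]. *)
Lemma unimodular_cderiv_zero j z l : cderiv j z l -> near z (fun w => Cmod (j w) = 1) -> l = 0.
Proof.
  intros [s [Cs [Es Hs]]] H1. apply NNPP. intros Hl.
  assert (Hl' := proj1 (Cmod_gt_0 _) Hl).
  pose proof (Cs (Cmod l / 2) ltac:(lra)) as Hn.
  destruct (near_and _ _ _ (near_and _ _ _ Hs H1) Hn) as [d [Hd K]].
  (* in this direction |j| increases to first order *)
  set (v := (j z * Cconj l)%C).
  assert (Jz : Cmod (j z) = 1) by exact (near_self _ _ H1).
  assert (Hv : Cmod v = Cmod l) by (unfold v; rewrite Cmod_mult, Cmod_conj, Jz; ring).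
  set (e := d / (2 * Cmod l)).
  assert (He : 0 < e) by (apply Rdiv_lt_0_compat; lra).
  set (w := (z + RtoC e * v)%C).
  assert (Hw : Cmod (w - z)%C < d).
  { unfold w. replace (z + RtoC e * v - z)%C with (RtoC e * v)%C by ring.
    rewrite Cmod_mult, Cmod_R, Rabs_pos_eq, Hv by lra.
    unfold e. replace (d / (2 * Cmod l) * Cmod l) with (d / 2) by (field; lra). lra. }
  destruct (K w Hw) as [[E1 E2] E3]. rewrite Es in E3.
  assert (E4 : j w = (j z * (1 + RtoC e * (Cconj l * s w)))%C).
  { rewrite E1. unfold w at 1, v. ring. }
  rewrite E4, Cmod_mult, Jz, Rmult_1_l in E2.
  pose proof (Rabs_Re_le (1 + RtoC e * (Cconj l * s w))%C) as R1. rewrite E2 in R1.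
  apply Rabs_le_between in R1.
  assert (R2 : Re (1 + RtoC e * (Cconj l * s w))%C = 1 + e * Re (Cconj l * s w)%C).
  { destruct l, (s w); unfold Re, Cconj, Cmult, Cplus, RtoC; simpl. ring. }
  rewrite R2 in R1.
  assert (R3 : 0 < Re (Cconj l * s w)%C).
  { replace (Cconj l * s w)%C with (Cconj l * l + Cconj l * (s w - l))%C by ring.
    assert (Re (Cconj l * l)%C = Cmod l ^ 2).
    { unfold Cmod. rewrite pow2_sqrt by nra. destruct l; unfold Re, Cconj, Cmult; simpl. ring. }
    pose proof (Rabs_Re_le (Cconj l * (s w - l))%C) as R4.
    rewrite Cmod_mult, Cmod_conj in R4. apply Rabs_le_between in R4.
    change (Re (Cconj l * l + Cconj l * (s w - l))%C)
      with (Re (Cconj l * l)%C + Re (Cconj l * (s w - l))%C).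
    rewrite H. nra. }
  nra.
Qed.

Lemma unimodular_constant j :
  (forall z, half_plane 0 z -> cdiff j z) -> (forall z, half_plane 0 z -> Cmod (j z) = 1) ->
  forall z z', half_plane 0 z -> half_plane 0 z' -> j z = j z'.
Proof.
  intros Hd H1 z z' Hz Hz'. unfold half_plane in *.
  assert (H0 : forall w, 0 < Im w -> cderiv j w 0).
  { intros w Hw. destruct (Hd w Hw) as [l Hl].
    rewrite (unimodular_cderiv_zero j w l Hl) in Hl; auto.
    generalize (near_half_plane 0 w Hw). apply near_imp. exact H1. }
  set (p := fun t : R => (z + RtoC t * (z' - z))%C).
  assert (E := CInt_path j (fun _ => 0) p (z' - z) 0 1 ltac:(lra)).
  cbv beta in E. rewrite CInt_const in E.
  assert (K : ((z' - z) * (RtoC (1 - 0) * 0))%C = (j (p 1) - j (p 0))%C).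
  { apply E.
    - intros x y. unfold p. rewrite RtoC_minus. ring.
    - intros x Hx. apply H0. unfold p. destruct z as [a b], z' as [a' b']; simpl in *.
      replace (b + (x * (b' + - b) + 0 * (a' + - a))) with ((1 - x) * b + x * b') by ring.
      destruct (Rle_lt_dec x (1 / 2)); nra.
    - intros; apply rcont_const. }
  replace (p 1) with z' in K by (unfold p; ring). replace (p 0) with z in K by (unfold p; ring).
  replace (j z') with (j z + (j z' - j z))%C by ring. rewrite <- K. ring.
Qed.

(** For a translation [c z + d = 1], so its automorphy factor has modulus 1 whatever the weight;
    being holomorphic, it is a constant [u], evaluated here at [Ci]. *)
Lemma modular_translation k G f : is_subgroup G -> finite_index G -> modular_function k G f ->
  exists T u, 0 < T /\ Cmod u = 1 /\
    forall z, half_plane 0 z -> f (z + RtoC T)%C = smul u (f z).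
Proof.
  intros HG HI [_ [[j Hj] _]].
  destruct (finite_index_translation G HG HI) as [n [Hn HGn]].
  destruct (Hj _ HGn) as [[Jh Jm] Jf].
  set (J := j (translation n)) in *.
  assert (Hden : forall z, denom (translation n) z = 1)
    by (intros z; unfold denom; simpl; ring).
  assert (J1 : forall z, half_plane 0 z -> Cmod (J z) = 1).
  { intros z Hz. rewrite Jm, Hden, Cmod_1 by auto. unfold Rpower. rewrite ln_1, Rmult_0_r. apply exp_0. }
  assert (Jd : forall z, half_plane 0 z -> cdiff J z).
  { intros z Hz. destruct (regular_cdiff _ _ (Jh z Hz)) as [_ [_ H]]. exact H. }
  assert (HT : 0 < IZR n) by now apply IZR_lt.
  exists (IZR n), (J Ci). split; [auto|]. 
  assert (HCi : half_plane 0 Ci) by (unfold half_plane; simpl; lra).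
  split; [apply J1; auto|].
  intros z Hz. rewrite <- (unimodular_constant J Jd J1 z Ci Hz HCi).
  rewrite <- Jf by auto. f_equal. unfold moebius. rewrite Hden. simpl.
  field.
Qed.

(** * Density of the support *)

Definition support_ind (al : R -> C) (l0 T : R) (n : nat) : R :=
  if excluded_middle_informative (al (l0 + INR n / T) = RtoC 0) then 0 else 1.

Lemma support_count al l0 T N x n : 0 < T ->
  has_card (fun l => l <= x /\ al l <> RtoC 0) N -> l0 + INR n / T <= x ->
  rsum (support_ind al l0 T) n <= INR N.
Proof.
  intros HT [l [Nl [Ll Hl]]] Hx.
  (* The strict bound by [l0 + INR n / T] guarantees that the frequency added at the next step is
     new. *)
  assert (K : exists l', NoDup l' /\ rsum (support_ind al l0 T) n = INR (length l') /\
     forall y, In y l' -> y < l0 + INR n / T /\ al y <> RtoC 0).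
  { clear Hx. induction n as [|n [l' [N' [E' H']]]].
    - exists nil. repeat split; try constructor; destruct H.
    - assert (Hn : l0 + INR n / T < l0 + INR (S n) / T).
      { apply Rplus_lt_compat_l. unfold Rdiv. apply Rmult_lt_compat_r.
        - now apply Rinv_0_lt_compat.
        - apply lt_INR; lia. }
      cbn [rsum]. rewrite E'. unfold support_ind.
      destruct (excluded_middle_informative (al (l0 + INR n / T) = RtoC 0)) as [Z|Z].
      + exists l'. split; [auto|]. split; [ring|]. intros y Hy. destruct (H' y Hy). split; auto; lra.
      + exists ((l0 + INR n / T) :: l'). split; [|split].
        * constructor; auto. intros Q. apply H' in Q. lra.
        * cbn [length]. rewrite S_INR. ring.
        * intros y [<-|Hy]; [split; auto; lra|]. destruct (H' y Hy). split; auto; lra. }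
  destruct K as [l' [N' [-> H']]]. rewrite <- Ll. apply le_INR, NoDup_incl_length; auto.
  intros y Hy. apply Hl. destruct (H' y Hy). split; auto; lra.
Qed.

(** At [x = l0 + INR n / T] the counting function is at most [e * T * x = e * INR n + e * T * l0]
    once [x] is large, which is why the limit is used with [e * T]. The remaining [x] are covered by
    the single count [N M']. *)
Lemma support_density al l0 T (N : R -> nat) : 0 < T ->
  (forall x, has_card (fun l => l <= x /\ al l <> RtoC 0) (N x)) ->
  is_lim (fun x => INR (N x) / x) p_infty 0 ->
  forall e, 0 < e -> exists K, forall n, rsum (support_ind al l0 T) n <= e * INR n + K.
Proof.
  intros HT HN Hlim e He.
  apply is_lim_spec in Hlim.
  assert (He' : 0 < e * T) by now apply Rmult_lt_0_compat.
  destruct (Hlim (mkposreal _ He')) as [M HM]. simpl in HM.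
  set (M' := Rmax M 0 + 1).
  assert (HM' : M < M' /\ 0 < M').
  { pose proof (Rmax_l M 0). pose proof (Rmax_r M 0). unfold M'. lra. }
  exists (INR (N M') + e * T * Rabs l0). intros n.
  set (x := l0 + INR n / T).
  assert (P1 : 0 <= INR n) by apply pos_INR.
  assert (P2 : 0 <= e * T * Rabs l0) by (apply Rmult_le_pos; [lra|apply Rabs_pos]).
  destruct (Rle_lt_dec x M') as [Hx|Hx].
  - pose proof (support_count al l0 T (N M') M' n HT (HN M') Hx).
    assert (0 <= e * INR n) by (apply Rmult_le_pos; lra). lra.
  - pose proof (support_count al l0 T (N x) x n HT (HN x) (Rle_refl x)) as H.
    specialize (HM x ltac:(lra)). rewrite Rminus_0_r in HM.
    apply Rabs_lt_between in HM. destruct HM as [_ HM].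
    apply Rmult_lt_compat_r with (r := x) in HM; [|lra].
    replace (INR (N x) / x * x) with (INR (N x)) in HM by (field; lra).
    assert (E : e * T * x = e * T * l0 + e * INR n) by (unfold x; field; lra).
    assert (e * T * l0 <= e * T * Rabs l0) by (apply Rmult_le_compat_l; [lra|apply Rle_abs]).
    pose proof (pos_INR (N M')). lra.
Qed.

(** * Reduction modulo the period *)

Lemma shift_into_period (P : C -> Prop) T a : 0 < T ->
  (forall z, half_plane 0 z -> (P (z + RtoC T)%C <-> P z)) ->
  forall z, half_plane 0 z -> exists x, a <= x <= a + T /\ (P (x, Im z) <-> P z).
Proof.
  intros HT HP z Hz.
  assert (K : forall n x, P (x + INR n * T, Im z) <-> P (x, Im z)).
  { induction n as [|n IH]; intros x.
    - simpl. rewrite Rmult_0_l, Rplus_0_r. tauto.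
    - rewrite S_INR. replace (x + (INR n + 1) * T) with ((x + INR n * T) + T) by ring.
      rewrite <- pair_add_R, HP; auto. }
  destruct z as [x y]; simpl Im in *. unfold half_plane in Hz.
  (* [up] is strictly above its argument by at most 1, so [k - 1] is the integer part. *)
  destruct (archimed ((x - a) / T)) as [A1 A2]. set (k := up ((x - a) / T)) in *.
  assert (B : a <= x - IZR (k - 1) * T <= a + T).
  { rewrite minus_IZR.
    assert (E : (x - a) / T * T = x - a) by (field; lra).
    split; nra. }
  destruct (Z_le_gt_dec 0 (k - 1)) as [H|H].
  - exists (x - IZR (k - 1) * T). split; auto.
    rewrite <- (K (Z.to_nat (k - 1))). rewrite INR_IZR_INZ, Z2Nat.id by lia.
    replace (x - IZR (k - 1) * T + IZR (k - 1) * T) with x by ring. tauto.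
  - exists (x - IZR (k - 1) * T). split; auto.
    rewrite <- (K (Z.to_nat (- (k - 1))) x). rewrite INR_IZR_INZ, Z2Nat.id by lia.
    rewrite opp_IZR. replace (x + - IZR (k - 1) * T) with (x - IZR (k - 1) * T) by ring. tauto.
Qed.

Lemma near_shift z v P : near (z + v)%C P <-> near z (fun w => P (w + v)%C).
Proof.
  split; intros [d [Hd H]]; exists d; split; auto; intros w Hw.
  - apply H. now replace (w + v - (z + v))%C with (w - z)%C by ring.
  - replace w with ((w - v) + v)%C by ring. apply H.
    now replace (w - v - z)%C with (w - (z + v))%C by ring.
Qed.

Lemma fval_smul (f : C -> sphere) (u z z' : C) : f z' = smul u (f z) ->
  fval f z' = (u * fval f z)%C /\ (f z' = None <-> f z = None).
Proof.
  unfold fval. intros ->. destruct (f z); simpl; split; try ring; split; auto; discriminate.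
Qed.

Lemma order_le_shift f u T z m : Cmod u = 1 ->
  (forall z, half_plane 0 z -> f (z + RtoC T)%C = smul u (f z)) ->
  half_plane 0 z -> (order_le f (z + RtoC T)%C m <-> order_le f z m).
Proof.
  intros Hu Hf Hz. unfold order_le.
  assert (K : forall B w, half_plane 0 w ->
    ((w + RtoC T <> z + RtoC T)%C -> f (w + RtoC T)%C <> None /\
      Cmod (fval f (w + RtoC T)) * Cmod (w + RtoC T - (z + RtoC T))%C ^ m <= B) <->
    (w <> z -> f w <> None /\ Cmod (fval f w) * Cmod (w - z)%C ^ m <= B)).
  { intros B w Hw. destruct (fval_smul f u w (w + RtoC T) (Hf w Hw)) as [E1 E2].
    rewrite E1, E2, Cmod_mult, Hu, Rmult_1_l.
    replace (w + RtoC T - (z + RtoC T))%C with (w - z)%C by ring.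
    assert (Q : (w + RtoC T)%C <> (z + RtoC T)%C <-> w <> z).
    { split; intros H E; apply H.
      - now rewrite E.
      - replace w with ((w + RtoC T) - RtoC T)%C by ring. rewrite E. ring. }
    tauto. }
  split; intros [B H]; exists B.
  - apply near_shift in H. generalize (near_and _ _ _ H (near_half_plane 0 z Hz)).
    apply near_imp. intros w [H1 H2]. now apply K.
  - apply near_shift. generalize (near_and _ _ _ H (near_half_plane 0 z Hz)).
    apply near_imp. intros w [H1 H2]. now apply (proj2 (K B w H2)).
Qed.

Lemma unit_circle u : Cmod u = 1 -> exists th, u = (cos th, sin th).
Proof.
  destruct u as [x y]. intros H.
  assert (H2 : x * x + y * y = 1).
  { unfold Cmod in H. cbn [fst snd] in H.
    assert (sqrt (x ^ 2 + y ^ 2) ^ 2 = 1) by (rewrite H; ring).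
    rewrite pow2_sqrt in H0 by nra. nra. }
  assert (Hx : -1 <= x <= 1) by nra.
  pose proof (cos_acos x Hx) as E1. pose proof (sin_acos x Hx) as E2.
  unfold Rsqr in E2.
  destruct (Rle_lt_dec 0 y) as [Hy|Hy].
  - exists (acos x). rewrite E1, E2. f_equal.
    replace (1 - x * x) with (y * y) by lra. symmetry. now apply sqrt_square.
  - exists (- acos x). rewrite cos_neg, sin_neg, E1, E2. f_equal.
    replace (1 - x * x) with ((- y) * (- y)) by lra. rewrite sqrt_square; lra.
Qed.

(** The solutions are determined modulo [/ T], so one of them can be moved below [b]. With [b] below
    all frequencies of the expansion, division by [e2pi l] makes the function periodic and removes
    its negative frequencies. *)
Lemma base_frequency u T b : 0 < T -> Cmod u = 1 -> exists l, l < b /\ e2pi l (RtoC T) = u.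
Proof.
  intros HT Hu. destruct (unit_circle u Hu) as [th ->].
  pose proof PI_RGT_0.
  set (l := th / (2 * PI * T)).
  destruct (archimed (Rabs (T * (l - b)))) as [A _].
  set (k := up (Rabs (T * (l - b)))) in *.
  pose proof (Rabs_pos (T * (l - b))). pose proof (Rle_abs (T * (l - b))).
  assert (Hk : (0 <= k)%Z) by (apply le_IZR; lra).
  set (n := Z.to_nat k).
  assert (Hn : INR n = IZR k) by (unfold n; rewrite INR_IZR_INZ, Z2Nat.id; auto).
  exists (l - INR n / T). split.
  - rewrite Hn. apply Rmult_lt_reg_r with T; auto.
    replace ((l - IZR k / T) * T) with (T * l - IZR k) by (field; lra). lra.
  - unfold RtoC. rewrite e2pi_rect. rewrite Rmult_0_r, Ropp_0, exp_0, !Rmult_1_l.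
    assert (E : 2 * PI * (l - INR n / T) * T + 2 * INR n * PI = th) by (unfold l; field; lra).
    rewrite <- E, cos_period, sin_period. reflexivity.
Qed.

Lemma finite_order_lower_bound al : finite_order_expansion al ->
  exists b, forall l, l < b -> al l = RtoC 0.
Proof.
  intros [n [l [_ [_ Hl]]]].
  (* The list contains only negative frequencies; [b <= 0] ensures that any [x < b] would be listed
     if its coefficient were nonzero. *)
  assert (K : exists b, b <= 0 /\ forall x, In x l -> b <= x).
  { clear Hl. induction l as [|y l [b [Hb IH]]].
    - exists 0. split; [lra|]. intros x [].
    - exists (Rmin b y). pose proof (Rmin_l b y). pose proof (Rmin_r b y). split; [lra|].
      intros x [<-|Hx]; auto. specialize (IH x Hx). lra. }
  destruct K as [b [Hb K]]. exists b. intros x Hx. apply NNPP. intros N.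
  assert (In x l) by (apply Hl; split; auto; lra). specialize (K x H). lra.
Qed.

Lemma least_nat (P : nat -> Prop) : (exists n, P n) -> exists n, P n /\ forall k, (k < n)%nat -> ~ P k.
Proof.
  intros [n Hn]. induction n as [n IH] using (well_founded_induction lt_wf).
  destruct (classic (exists k, (k < n)%nat /\ P k)) as [[k [Hk Pk]]|N].
  - exact (IH k Hk Pk).
  - exists n. split; auto. intros k Hk Pk. apply N. now exists k.
Qed.

(** * The highest poles *)

Section HighestPoles.
Variables (f : C -> sphere) (T r : R) (u : C).
Hypothesis (HT : 0 < T) (Hu : Cmod u = 1).
Hypothesis Hmer : meromorphic_on (half_plane 0) f.
Hypothesis Hper : forall z, half_plane 0 z -> f (z + RtoC T)%C = smul u (f z).
Hypothesis Hhol : holomorphic_on (half_plane r) f.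
Hypothesis Hnot : ~ holomorphic_on (half_plane 0) f.

Lemma regular_or_pole z : half_plane 0 z -> f z <> None -> regular_at f z.
Proof. intros Hz Hf. destruct (Hmer z Hz) as [H|[H _]]; auto. contradiction. Qed.

Lemma none_shift z : half_plane 0 z -> (f (z + RtoC T)%C = None <-> f z = None).
Proof. intros Hz. exact (proj2 (fval_smul _ _ _ _ (Hper z Hz))). Qed.

(** The heights of the poles are bounded by [r]; let [y0] be their supremum. If it were not
    attained, every point at height [y0] would have a neighbourhood free of poles, and by
    compactness so would a strip around one period. Translation by multiples of [T] would bring into
    this strip a pole of height close to [y0]. *)
Lemma highest_pole_line : exists y0 x0, 0 < y0 /\ f (x0, y0) = None /\
  forall z, y0 < Im z -> f z <> None.
Proof.
  assert (Hz1 : exists z, half_plane 0 z /\ f z = None).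
  { apply NNPP. intros N. apply Hnot. intros z Hz. apply regular_or_pole; auto.
    intros E. apply N. now exists z. }
  destruct Hz1 as [z1 [Hz1 Ez1]].
  destruct (completeness (fun y => exists z, half_plane 0 z /\ f z = None /\ y = Im z)) as [y0 [Y1 Y2]].
  - exists r. intros y [z [Hz [Ez ->]]]. apply Rnot_lt_le. intros N.
    destruct (regular_cdiff f z (Hhol z N)). contradiction.
  - exists (Im z1), z1. auto.
  - assert (Hy0 : Im z1 <= y0) by (apply Y1; now exists z1).
    unfold half_plane in Hz1.
    assert (Habove : forall z, y0 < Im z -> f z <> None).
    { intros z Hz E. assert (Im z <= y0); [|lra]. apply Y1. exists z.
      repeat split; auto. unfold half_plane; lra. }
    destruct (classic (exists x, f (x, y0) = None)) as [[x Hx]|N].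
    { exists y0, x. repeat split; auto. lra. }
    exfalso.
    assert (K : exists d, 0 < d /\ forall x y, 0 <= x <= 0 + T -> Rabs (y - y0) < d -> f (x, y) <> None).
    { apply (interval_cousin (fun s t => exists d, 0 < d /\ forall x y, s <= x <= t ->
        Rabs (y - y0) < d -> f (x, y) <> None)); [lra| |].
      - intros s m t _ _ [d [Hd H]] [d' [Hd' H']]. exists (Rmin d d'). split; [now apply Rmin_pos|].
        intros x y Hx Hy. pose proof (Rmin_l d d'). pose proof (Rmin_r d d').
        destruct (Rle_dec x m); [apply H|apply H']; lra.
      - intros x _.
        assert (Hx : f (x, y0) <> None) by (intros E; apply N; now exists x).
        assert (Hh : half_plane 0 (x, y0)) by (unfold half_plane; simpl; lra).
        destruct (regular_cdiff f _ (regular_or_pole _ Hh Hx)) as [_ [[d [Hd H]] _]].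
        exists (d / 2). split; [lra|]. intros s t Hs Ht _ Hst. exists (d / 2). split; [lra|].
        intros x' y Hx' Hy. apply H. eapply Rle_lt_trans; [apply Cmod_le_abs|].
        unfold Cminus, Cplus, Copp, Re, Im; cbn [fst snd].
        assert (Rabs (x' - x) < d / 2) by (apply Rabs_def1; lra). unfold Rminus in *. lra. }
    destruct K as [d [Hd K]].
    set (d' := Rmin d y0). assert (Hd' : 0 < d') by (apply Rmin_pos; lra).
    assert (Hz2 : exists z, half_plane 0 z /\ f z = None /\ y0 - d' < Im z).
    { apply NNPP. intros N2. assert (y0 <= y0 - d'); [|lra]. apply Y2.
      intros y [z [Hz [Ez ->]]]. apply Rnot_lt_le. intros L. apply N2. now exists z. }
    destruct Hz2 as [z [Hz [Ez Lz]]].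
    assert (Uz : Im z <= y0) by (apply Y1; now exists z).
    destruct (shift_into_period (fun z => f z = None) T 0 HT none_shift z Hz) as [x [Hx Ex]].
    apply (K x (Im z) Hx); [|now apply Ex].
    assert (d' <= d) by apply Rmin_l. apply Rabs_def1; lra.
Qed.

(** The orders are bounded on one period by compactness, hence on the whole line by periodicity. The
    least common bound is positive because the line carries a pole, and by minimality it is
    attained. *)
Lemma highest_pole_maximal_order : exists y0 x0 m, 0 < y0 /\
  (forall z, y0 < Im z -> regular_at f z) /\
  (forall x, order_le f (x, y0) (S m)) /\ order_ge f (x0, y0) (S m).
Proof.
  destruct highest_pole_line as [y0 [x1 [Hy0 [Hx1 Habove]]]].
  assert (Hl : forall x, half_plane 0 (x, y0)) by (intros; unfold half_plane; simpl; lra).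
  assert (Hreg : forall x, f (x, y0) <> None -> order_le f (x, y0) 0).
  { intros x Hx. destruct (regular_cdiff f _ (regular_or_pole _ (Hl x) Hx)) as [_ [H1 H2]].
    now apply cdiff_near_order_le. }
  assert (Hpole : forall x, f (x, y0) = None -> exists m, (0 < m)%nat /\
     order_le f (x, y0) m /\ order_ge f (x, y0) m).
  { intros x Hx. apply pole_order. destruct (Hmer _ (Hl x)) as [H|H]; auto.
    destruct (regular_cdiff f _ H). contradiction. }
  assert (Hsome : forall x, exists m, order_le f (x, y0) m).
  { intros x. destruct (classic (f (x, y0) = None)) as [H|H].
    - destruct (Hpole x H) as [m [_ [Hm _]]]. now exists m.
    - exists O. auto. }
  assert (Hbd : exists m, forall x, 0 <= x <= 0 + T -> order_le f (x, y0) m).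
  { apply (interval_cousin (fun s t => exists m, forall x, s <= x <= t -> order_le f (x, y0) m)); [lra| |].
    - intros s v t _ _ [m H] [m' H']. exists (m + m')%nat. intros x Hx.
      destruct (Rle_dec x v).
      + apply order_le_mono with m; [lia|]. apply H; lra.
      + apply order_le_mono with m'; [lia|]. apply H'; lra.
    (* Close to [x] the other points of the line are not poles, so they have order at most 0 and the
       bound for [x] serves for all of them. *)
    - intros x _. destruct (Hsome x) as [m [B [d [Hd H]]]].
      exists d. split; auto. intros s t Hs Ht _ Hst. exists m. intros x' Hx'.
      destruct (Req_EM_T x' x) as [->|Hne]; [exists B, d; auto|].
      apply order_le_mono with O; [lia|]. apply Hreg.
      apply H.
      + rewrite Cmod_hor. apply Rabs_def1; lra.
      + intros E; apply Hne. now injection E. }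
  assert (Hall : exists m, forall x, order_le f (x, y0) m).
  { destruct Hbd as [m H]. exists m. intros x.
    destruct (shift_into_period (fun z => order_le f z m) T 0 HT) with (z := (x, y0) : C) as [x' [Hx' E]]; auto.
    - intros z Hz. apply (order_le_shift f u T z m Hu Hper Hz).
    - apply E, H, Hx'. }
  destruct (least_nat _ Hall) as [m [Hm Hmin]].
  destruct m as [|m].
  (* A common bound 0 is excluded by the pole at [x1]. *)
  { exfalso. destruct (Hpole x1 Hx1) as [k [Hk [_ Hge]]].
    pose proof (order_ge_le _ _ _ _ Hge (Hm x1)). lia. }
  assert (Hx0 : exists x, ~ order_le f (x, y0) m).
  { apply not_all_ex_not. apply Hmin. lia. }
  destruct Hx0 as [x0 Hx0]. exists y0, x0, m.
  split; auto. split; [|split; auto].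
  - intros z Hz. apply regular_or_pole; auto. unfold half_plane; lra.
  - destruct (classic (f (x0, y0) = None)) as [H|H].
    + destruct (Hpole x0 H) as [k [Hk [Hle Hge]]].
      pose proof (order_ge_le _ _ _ _ Hge (Hm x0)).
      destruct (Nat.le_gt_cases k m) as [L|L].
      * exfalso. apply Hx0. now apply order_le_mono with k.
      * replace (S m) with k by lia. exact Hge.
    + exfalso. apply Hx0. apply order_le_mono with O; [lia|]. auto.
Qed.

End HighestPoles.

(** * Lacunarity against the highest poles *)

Theorem theorem1 (k : R) (Gamma : SL2Z -> Prop) (f : C -> sphere)
  (Gamma_subgroup : is_subgroup Gamma)
  (Gamma_finite_index : finite_index Gamma)
  (f_modular : modular_function k Gamma f)
  (f_nonzero : exists z, half_plane 0 z /\ f z <> Some (RtoC 0))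
  (f_not_holomorphic : ~ holomorphic_on (half_plane 0) f) :
  ~ lacunary f.
Proof.
  intros [al [[r [h [u0 [_ [_ [Hhol [_ [_ Hexp]]]]]]]] [Hfin [N [HN Hlim]]]]].
  destruct (modular_translation k Gamma f Gamma_subgroup Gamma_finite_index f_modular)
    as [T [u [HT [Hu Hper]]]].
  destruct f_modular as [Hmer _].
  destruct (highest_pole_maximal_order f T r u HT Hu Hmer Hper Hhol f_not_holomorphic)
    as [y0 [x0 [m [Hy0 [Hreg [Hle Hge]]]]]].
  destruct (finite_order_lower_bound al Hfin) as [b Hb].
  (* [l0] has the multiplier [u] of the translation, so [F] is [T]-periodic, and it lies below every
     frequency of the expansion, so [F] has no negative frequency. *)
  destruct (base_frequency u T b HT Hu) as [l0 [Hl0 Eu]].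
  set (F := fun z => (fval f z * e2pi (- l0) z)%C).
  (* The period is centred at the pole, because [value_bound] evaluates at its midpoint
     [a + T / 2]. *)
  set (a := x0 - T / 2).
  assert (Hfv : forall z, y0 < Im z -> cdiff (fval f) z).
  { intros z Hz. destruct (regular_cdiff f z (Hreg z Hz)) as [_ [_ H]]. exact H. }
  assert (HF : forall z, y0 < Im z -> cdiff F z).
  { intros z Hz. apply cdiff_mult; auto using cdiff_e2pi. }
  assert (Hu0 : u <> RtoC 0) by (rewrite <- Eu; apply e2pi_neq0).
  assert (HP : forall z, y0 < Im z -> F (z + RtoC T)%C = F z).
  { intros z Hz. unfold F.
    destruct (fval_smul f u z (z + RtoC T)) as [-> _]; [apply Hper; unfold half_plane; lra|].
    rewrite e2pi_addr, (e2pi_oppl l0 (RtoC T)), Eu. field. auto. }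
  (* The coefficient of [F] at [l] is that of [f] at [l0 + l]. It is moved up to [y1 > r], where the
     expansion holds and its vanishing coefficient can be read off. *)
  assert (Hzero : forall l, e2pi (- l) (RtoC T) = RtoC 1 -> al (l0 + l) = RtoC 0 ->
     forall y, y0 < y -> coef F a T l y = 0).
  { intros l El Hal y Hy.
    assert (HPl : forall z, y0 < Im z -> (F (z + RtoC T) * e2pi (- l) (z + RtoC T) = F z * e2pi (- l) z)%C).
    { intros z Hz. rewrite HP, e2pi_addr, El by auto. ring. }
    set (y1 := Rmax r y0 + 1).
    assert (Hy1 : r < y1 /\ y0 < y1).
    { pose proof (Rmax_l r y0). pose proof (Rmax_r r y0). unfold y1. lra. }
    rewrite (coef_indep F a T y0 l y y1) by (auto; lra).
    rewrite <- (coef_expansion_zero f al (frequencies h u0) a T (l0 + l) y1); auto.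
    - unfold coef. apply CInt_ext; [lra|]. intros x _. unfold F.
      rewrite Ropp_plus_distr, e2pi_addl. ring.
    - intros x. destruct (Hexp (x, y1)) as [w Hw]; [unfold half_plane; simpl; lra|]. exists w. exact Hw.
    - intros x. apply rcont_hor, cdiff_cont, Hfv. simpl; lra.
    - intros x. pose proof (HPl (x, y1) ltac:(simpl; lra)) as E. rewrite pair_add_R in E.
      unfold F in E. rewrite Ropp_plus_distr, !e2pi_addl, !Cmult_assoc. exact E. }
  assert (Hfreq : forall n, e2pi (INR n / T) (RtoC T) = RtoC 1).
  { intros n. rewrite <- (e2pi_0r (INR n / T)), <- (e2pi_period T n 0) by lra. f_equal. ring. }
  assert (Hfreq' : forall n, e2pi (- (INR n / T)) (RtoC T) = RtoC 1).
  { intros n. rewrite e2pi_oppl, Hfreq. field. }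
  destruct (mean_square_near_poles F a T y0 m HT) as [A [d1 [Hd1 HA]]].
  { intros x y Hy. apply rcont_hor, cdiff_cont, HF. exact Hy. }
  { intros x _. apply (order_le_mult f (e2pi (- l0))); auto. apply cdiff_cont, cdiff_e2pi. }
  destruct (order_ge_mult f (e2pi (- l0)) F (x0, y0) (S m)) as [c [d2 [Hc [Hd2 Hlow]]]];
    auto using e2pi_neq0.
  { apply cdiff_cont, cdiff_e2pi. }
  apply (sparse_coefficients_contradiction F a T y0 (support_ind al l0 T) HT HF HP) with
    (m := S m) (A := A) (c := c) (d := Rmin d1 d2); auto.
  (* A negative index gives a frequency below [l0 < b], where the expansion has no term. *)
  - intros n y Hn Hy. apply Hzero; auto.
    + rewrite Ropp_involutive. apply Hfreq.
    + apply Hb. assert (0 < INR n / T) by (apply Rdiv_lt_0_compat; auto; now apply lt_0_INR). lra.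
  - intros n. unfold support_ind. destruct (excluded_middle_informative _); auto.
  - intros n y Hy Hs. apply Hzero; auto. unfold support_ind in Hs.
    destruct (excluded_middle_informative _); auto. lra.
  - now apply support_density with N.
  - now apply Rmin_pos.
  - intros t Ht. apply HA. pose proof (Rmin_l d1 d2). lra.
  - intros t Ht. pose proof (Rmin_r d1 d2).
    replace (a + T / 2, y0 + t) with ((x0, y0) + (0, t))%C.
    + apply Hlow. lra.
    + unfold a, Cplus; simpl. f_equal; field.
Qed.
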